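(* Let $I$ be a compact interval and let $(X_n,d_n)$ be a sequence of compact length spaces that converge to the compact metric space $(X,d)$ in the Gromov-Hausdorff sense. If the timelike curvature of each of the Lorentzian products $I\times_1X_n$ is non-negative (i.e. bounded below by $0$), then the timelike curvature of $I\times_1X$ is non-negative.
   Context: Length space: a metric space $(X,d)$ in which $d(x,y)$ is the infimum of the $d$-lengths of curves joining $x$ and $y$; it is assumed throughout that any two points can be joined by a curve of finite length. Generalized cone: let $I\subseteq\mathbb R$ be a nondegenerate interval, $(X,d)$ a metric space and $f:I\to(0,\infty)$ continuous. The generalized cone $Y=I\times_f X$ is $I\times X$ with the metric $D((t,x),(t',x'))=|t-t'|+d(x,x')$ and the following structure. A curve $\gamma=(\alpha,\beta):J\to Y$ with $\alpha:J\to I$, $\beta:J\to X$ absolutely continuous and $\alpha$ strictly monotone is causal (timelike) if $-\dot\alpha^2+(f\circ\alpha)^2v_\beta^2\le0$ ($<0$) a.e., $v_\beta$ being the metric derivative; it is future directed if $\dot\alpha>0$ a.e. Its length is $L(\gamma)=\int\sqrt{\dot\alpha^2-(f\circ\alpha)^2v_\beta^2}$. Put $p\le q$ (resp. $p\ll q$) if there is a future directed causal (resp. timelike) curve from $p$ to $q$ (with $p\le p$), and $\rho(p,q)=\sup\{L(\gamma):\gamma\text{ future directed causal from }p\text{ to }q\}$, $\rho(p,q)=0$ if there is no such curve. $I\times_1X$ is the case $f\equiv1$. Timelike curvature bounds for $(Y,D,\ll,\le,\rho)$: a future directed causal curve in $Y$ is a locally Lipschitz curve $\gamma$, not constant on any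 nontrivial subinterval, with $\gamma(s)\le\gamma(s')$ for $s<s'$; for $\gamma:[a,b]\to Y$, $L_\rho(\gamma)=\inf\{\sum_i\rho(\gamma(t_i),\gamma(t_{i+1}))\}$ over all partitions of $[a,b]$; $\gamma$ is maximal if $L_\rho(\gamma)=\rho(\gamma(a),\gamma(b))$. A timelike geodesic triangle is a triple $x\ll y\ll z$ with $\rho(x,z)<\infty$ whose sides are realized by maximal future directed causal curves. $Y$ has timelike curvature bounded below by $0$ if every point of $Y$ has a neighborhood $U$ such that: (a) $\rho|_{U\times U}$ is finite and continuous; (b) whenever $x,y\in U$, $x\ll y$, there is a causal curve $\alpha$ in $U$ from $x$ to $y$ with $L_\rho(\alpha)=\rho(x,y)$; (c) if $(x,y,z)$ is a timelike geodesic triangle in $U$ realized by maximal causal curves, and $(x',y',z')$ is a comparison triangle in two-dimensional Minkowski space $\mathbb R^2_1$ (timelike geodesic triangle with the same side lengths with respect to its time separation $\rho'$), then for all points $p,q$ on the sides of $(x,y,z)$ and corresponding points $p',q'$ on the sides of $(x',y',z')$ one has $\rho(p,q)\le\rho'(p',q')$. Here $p'$ corresponds to $p$ if it lies on the corresponding side at the same time separation from the vertices (e.g. $\rho(x,p)=\rho'(x',p')$ if $p$ lies on the side $xy$). *)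

(* Defs.v *)
From HB Require Import structures.
From mathcomp Require Import all_boot all_order all_algebra.
From mathcomp Require Import all_classical all_reals all_analysis.

Set Implicit Arguments.
Unset Strict Implicit.
Unset Printing Implicit Defensive.

Import Order.TTheory GRing.Theory Num.Theory.
Import numFieldNormedType.Exports.

Local Open Scope classical_set_scope.
Local Open Scope ring_scope.

(* A curve [lo, hi] -> T is a total function on R of which only the values on
   `[lo, hi] are relevant. *)
Record pcurve (R : realType) (T : Type) := PCurve {
  lo : R;
  hi : R;
  cmap : R -> T }.

Definition trace (R : realType) (T : Type) (c : pcurve R T) : set T :=
  [set cmap c s | s in `[lo c, hi c]%classic].

Definition joins (R : realType) (T : Type) (c : pcurve R T) (x y : T) : Prop :=
  cmap c (lo c) = x /\ cmap c (hi c) = y.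

Section Metric.
Context {R : realType}.

(* [itv_partition u v s] says that u :: s is strictly increasing and ends at v *)
Definition curve_length (X : metricType R) (c : pcurve R X) : \bar R :=
  let pt s := nth (hi c) (lo c :: s) in
  ereal_sup [set (\sum_(0 <= i < size s)
                    mdist (cmap c (pt s i)) (cmap c (pt s i.+1)))%:E
            | s in itv_partition (lo c) (hi c)].

(* As mdist x y is a real number, the equation entails that x and y are joined
   by some curve of finite length (the infimum would be +oo otherwise). *)
Definition length_space (X : metricType R) : Prop :=
  forall x y : X,
    (mdist x y)%:E =
    ereal_inf [set curve_length c | c in [set c : pcurve R X |
      [/\ lo c < hi c, {within `[lo c, hi c], continuous (cmap c)}
        & joins c x y]]].

Definition hausdorff_dist (Z : metricType R) (A B : set Z) : \bar R :=
  ereal_inf [set r%:E | r in [set r : R |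
    [/\ 0 < r, (forall x, A x -> exists2 y, B y & mdist x y < r)
      & (forall y, B y -> exists2 x, A x & mdist y x < r)]]].

Definition isometric_embedding (X Z : metricType R) (i : X -> Z) : Prop :=
  forall x y, mdist (i x) (i y) = mdist x y.

Definition gh_dist (X Y : metricType R) : \bar R :=
  ereal_inf [set r : \bar R |
    exists (Z : metricType R) (i : X -> Z) (j : Y -> Z),
      [/\ isometric_embedding i, isometric_embedding j
        & r = hausdorff_dist (range i) (range j)]].

Definition abs_continuous (X : metricType R) (u v : R) (g : R -> X) : Prop :=
  forall e : R, 0 < e -> exists2 d : R, 0 < d &
    forall (n : nat) (s t : 'I_n -> R),
      (forall i, [/\ u <= s i, s i <= t i & t i <= v]) ->
      trivIset [set: 'I_n] (fun i => `]s i, t i[%classic) ->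
      \sum_(i < n) (t i - s i) < d ->
      \sum_(i < n) mdist (g (s i)) (g (t i)) < e.

(* For an absolutely continuous g the limit exists almost everywhere; elsewhere
   the value is arbitrary. *)
Definition metric_derivative (X : metricType R) (g : R -> X) (s : R) : R :=
  lim (mdist (g (s + h)) (g s) / `|h| @[h --> 0^']).

End Metric.

(* The data (Y, D, <<, <=, rho); D is the distance of the metricType Y. *)
Record lorentz_data (R : realType) := LorentzData {
  lspace :> metricType R;
  chron : lspace -> lspace -> Prop;
  caus : lspace -> lspace -> Prop;
  tsep : lspace -> lspace -> \bar R }.

Section TimelikeCurvature.
Context {R : realType}.

Definition locally_lipschitz (X : metricType R) (c : pcurve R X) : Prop :=
  forall s, s \in `[lo c, hi c] -> exists e k : R, 0 < e /\
    forall u v, u \in `[lo c, hi c] -> v \in `[lo c, hi c] ->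
      `|u - s| < e -> `|v - s| < e ->
      mdist (cmap c u) (cmap c v) <= k * `|u - v|.

Definition causal_curve (Y : lorentz_data R) (c : pcurve R Y) : Prop :=
  [/\ lo c < hi c,
      locally_lipschitz c,
      (forall s t, lo c <= s -> s < t -> t <= hi c ->
        ~ exists y, forall u, u \in `[s, t] -> cmap c u = y)
    & (forall s t, lo c <= s -> s < t -> t <= hi c ->
        caus (cmap c s) (cmap c t))].

Definition tsep_length (Y : lorentz_data R) (c : pcurve R Y) : \bar R :=
  let pt s := nth (hi c) (lo c :: s) in
  ereal_inf [set (\sum_(0 <= i < size s)
                    tsep (cmap c (pt s i)) (cmap c (pt s i.+1)))%E
            | s in itv_partition (lo c) (hi c)].

Definition maximal_curve (Y : lorentz_data R) (c : pcurve R Y) : Prop :=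
  causal_curve c /\ tsep_length c = tsep (cmap c (lo c)) (cmap c (hi c)).

Record triangle (Y : lorentz_data R) := Triangle {
  vx : Y;
  vy : Y;
  vz : Y;
  sxy : pcurve R Y;
  syz : pcurve R Y;
  sxz : pcurve R Y;
  chron_xy : chron vx vy;
  chron_yz : chron vy vz;
  tsep_xz_fin : (tsep vx vz < +oo)%E;
  sxyP : maximal_curve sxy /\ joins sxy vx vy;
  syzP : maximal_curve syz /\ joins syz vy vz;
  sxzP : maximal_curve sxz /\ joins sxz vx vz }.

Definition triangle_in (Y : lorentz_data R) (U : set Y) (T : triangle Y) : Prop :=
  [/\ trace (sxy T) `<=` U, trace (syz T) `<=` U & trace (sxz T) `<=` U].

Definition comparison_triangle (Y Y' : lorentz_data R)
    (T : triangle Y) (T' : triangle Y') : Prop :=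
  [/\ tsep (vx T') (vy T') = tsep (vx T) (vy T),
      tsep (vy T') (vz T') = tsep (vy T) (vz T)
    & tsep (vx T') (vz T') = tsep (vx T) (vz T)].

Definition corresponding_on (Y Y' : lorentz_data R)
    (c : pcurve R Y) (c' : pcurve R Y') (p : Y) (p' : Y') : Prop :=
  [/\ trace c p, trace c' p',
      tsep (cmap c (lo c)) p = tsep (cmap c' (lo c')) p'
    & tsep p (cmap c (hi c)) = tsep p' (cmap c' (hi c'))].

Definition corresponding (Y Y' : lorentz_data R)
    (T : triangle Y) (T' : triangle Y') (p : Y) (p' : Y') : Prop :=
  [\/ corresponding_on (sxy T) (sxy T') p p',
      corresponding_on (syz T) (syz T') p p'
    | corresponding_on (sxz T) (sxz T') p p'].

End TimelikeCurvature.

Definition mink_plane (R : realType) : Type := (R * R)%type.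

Section MinkowskiPlane.
Context {R : realType}.

HB.instance Definition _ := Choice.copy (mink_plane R) (R * R)%type.

Definition mink_dist (p q : mink_plane R) : R :=
  `|p.1 - q.1| + `|p.2 - q.2|.

Lemma mink_distxx p : mink_dist p p = 0.
Proof. by rewrite /mink_dist !subrr normr0 addr0. Qed.

Lemma mink_dist_positivity p q : mink_dist p q = 0 -> p = q.
Proof.
move=> /eqP; rewrite paddr_eq0 ?normr_ge0// !normr_eq0 !subr_eq0.
by case: p q => [p1 p2] [q1 q2] /= /andP[/eqP -> /eqP ->].
Qed.

Lemma mink_dist_sym p q : mink_dist p q = mink_dist q p.
Proof. by congr (_ + _); rewrite distrC. Qed.

Lemma mink_dist_triangle q p r :
  mink_dist p r <= mink_dist p q + mink_dist q r.
Proof. by rewrite /mink_dist addrACA lerD// ler_distD. Qed.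

HB.instance Definition _ := isMetric.Build R (mink_plane R)
  mink_distxx mink_dist_positivity mink_dist_sym mink_dist_triangle.

Definition mink_chron (p q : mink_plane R) : Prop := `|q.2 - p.2| < q.1 - p.1.

Definition mink_caus (p q : mink_plane R) : Prop := `|q.2 - p.2| <= q.1 - p.1.

Definition mink_tsep (p q : mink_plane R) : \bar R :=
  if `[< mink_caus p q >]
  then (Num.sqrt ((q.1 - p.1) ^+ 2 - (q.2 - p.2) ^+ 2))%:E else 0%E.

End MinkowskiPlane.

Definition minkowski2 (R : realType) : lorentz_data R :=
  @LorentzData R (mink_plane R) mink_chron mink_caus mink_tsep.

Definition timelike_curvature_ge0 (R : realType) (Y : lorentz_data R) : Prop :=
  forall o : Y, exists U : set Y,
    [/\ nbhs o U,
        (forall x y, U x -> U y -> tsep x y \is a fin_num) /\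
          {within U `*` U, continuous (fun xy : Y * Y => tsep xy.1 xy.2)},
        (forall x y, U x -> U y -> chron x y ->
          exists c : pcurve R Y,
            [/\ maximal_curve c, trace c `<=` U & joins c x y])
      & (forall (T : triangle Y) (T' : triangle (minkowski2 R)),
          triangle_in U T -> comparison_triangle T T' ->
          forall (p q : Y) (p' q' : minkowski2 R),
            corresponding T T' p p' -> corresponding T T' q q' ->
            (tsep p q <= tsep p' q')%E)].

Definition cone_space (R : realType) (I : set R) (X : metricType R) : Type :=
  (set_type I * X)%type.

Section GeneralizedCone.
Context {R : realType} (I : set R) (X : metricType R).

HB.instance Definition _ := Choice.copy (cone_space I X) (set_type I * X)%type.

Implicit Types p q r : cone_space I X.

Definition cone_dist p q : R := `|\val p.1 - \val q.1| + mdist p.2 q.2.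

Lemma cone_distxx p : cone_dist p p = 0.
Proof. by rewrite /cone_dist subrr normr0 mdistxx addr0. Qed.

Lemma cone_dist_positivity p q : cone_dist p q = 0 -> p = q.
Proof.
move=> /eqP; rewrite paddr_eq0 ?normr_ge0 ?mdist_ge0// normr_eq0 subr_eq0.
case: p q => [p1 p2] [q1 q2] /= /andP[/eqP/val_inj -> /eqP].
by move=> /mdist_positivity ->.
Qed.

Lemma cone_dist_sym p q : cone_dist p q = cone_dist q p.
Proof. by rewrite /cone_dist distrC metric_sym. Qed.

Lemma cone_dist_triangle q p r :
  cone_dist p r <= cone_dist p q + cone_dist q r.
Proof.
by rewrite /cone_dist addrACA lerD// ?ler_distD// metric_triangle.
Qed.

HB.instance Definition _ := isMetric.Build R (cone_space I X)
  cone_distxx cone_dist_positivity cone_dist_sym cone_dist_triangle.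

Variable f : R -> R.

Definition cone_t (c : pcurve R (cone_space I X)) (s : R) : R :=
  \val (cmap c s).1.

Definition cone_x (c : pcurve R (cone_space I X)) (s : R) : X := (cmap c s).2.

(* minus the warped-product Lorentzian square norm of the velocity *)
Definition cone_speed2 (c : pcurve R (cone_space I X)) (s : R) : R :=
  derive1 (cone_t c) s ^+ 2
  - f (cone_t c s) ^+ 2 * metric_derivative (cone_x c) s ^+ 2.

(* future directed curves of the cone, not yet subject to causality *)
Definition cone_fd_curve (c : pcurve R (cone_space I X)) : Prop :=
  [/\ lo c < hi c,
      abs_continuous (lo c) (hi c) (cone_t c : R -> R^o),
      abs_continuous (lo c) (hi c) (cone_x c),
      {in `[lo c, hi c] &, {homo cone_t c : s t / s < t}} \/
      {in `[lo c, hi c] &, {homo cone_t c : s t /~ s < t}}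
    & {ae @lebesgue_measure R, forall s,
        s \in `[lo c, hi c] -> 0 < derive1 (cone_t c) s}].

Definition cone_fd_causal (c : pcurve R (cone_space I X)) : Prop :=
  cone_fd_curve c /\
  {ae @lebesgue_measure R, forall s,
    s \in `[lo c, hi c] -> - cone_speed2 c s <= 0}.

Definition cone_fd_timelike (c : pcurve R (cone_space I X)) : Prop :=
  cone_fd_curve c /\
  {ae @lebesgue_measure R, forall s,
    s \in `[lo c, hi c] -> - cone_speed2 c s < 0}.

Definition cone_length (c : pcurve R (cone_space I X)) : \bar R :=
  (\int[@lebesgue_measure R]_(s in `[lo c, hi c])
     (Num.sqrt (cone_speed2 c s))%:E)%E.

Definition cone_caus p q : Prop :=
  p = q \/ exists2 c, cone_fd_causal c & joins c p q.

Definition cone_chron p q : Prop :=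
  exists2 c, cone_fd_timelike c & joins c p q.

Definition cone_tsep p q : \bar R :=
  if `[< exists2 c, cone_fd_causal c & joins c p q >]
  then ereal_sup [set cone_length c | c in
         [set c | cone_fd_causal c /\ joins c p q]]
  else 0%E.

Definition generalized_cone : lorentz_data R :=
  @LorentzData R (cone_space I X) cone_chron cone_caus cone_tsep.

End GeneralizedCone.

Definition lorentz_product (R : realType) (I : set R) (X : metricType R) :
    lorentz_data R :=
  generalized_cone I X (fun=> 1).

(* Main.v *)
(* A metric space [X] has nonnegative curvature in the sense of Alexandrov when
   Stewart's theorem holds in it as an inequality.  For a geodesic space [X] this is
   equivalent to nonnegative timelike curvature of [I x_1 X]: the time separation of
   [(t, x)] and [(t', x')] is [sqrt ((t' - t)^2 - d(x, x')^2)], because the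
   distance of the end points of an absolutely continuous curve is at most the
   integral of its metric derivative, so that Stewart's inequality in [X] is the comparison of a point on a side with the
   opposite vertex in [I x_1 X].  Conversely the curvature bound on [I x_1 X] only
   concerns small triangles; by compactness of [X] these have a uniform size, and the
   resulting local inequality is globalized as in Toponogov's theorem, by induction on
   the size of hinges.  The global Stewart inequality and the existence of geodesics
   pass to Gromov-Hausdorff limits: a point between [x] and [y] in [X] corresponds
   to a point almost between two points of [X_n], which by Stewart's inequality is
   close to a geodesic of [X_n]. *)

Require Import Defs.
From HB Require Import structures.
From mathcomp Require Import all_boot all_order all_algebra finmap.
From mathcomp Require Import all_classical all_reals all_analysis measurable_realfun.
From mathcomp Require Import lra ring.

Set Implicit Arguments.
Unset Strict Implicit.
Unset Printing Implicit Defensive.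

Import Order.TTheory GRing.Theory Num.Theory.
Import numFieldNormedType.Exports.

Local Open Scope classical_set_scope.
Local Open Scope ring_scope.

(** * Absolutely continuous curves *)

(** The neighbourhoods in the curvature bound of [I x_1 X_n] may shrink as [n] grows, so no local
    inequality survives the limit: each [X_n] is globalized first, and only the global inequality
    [stewart] is carried to [X]. The whole product then serves as the neighbourhood of each of its
    points.

    The time separation is a supremum of integrals of derivatives that exist only almost everywhere.
    Bounding it from above takes the fundamental theorem of calculus for absolutely continuous
    curves in a metric space: the variation of the curve is an absolutely continuous function, its
    Stieltjes measure has a density by Radon-Nikodym, and Lebesgue differentiation identifies the
    density.

    In triangles, squares [sqsep] are compared rather than separations: Stewart's theorem in the
    Minkowski plane is an exact identity between them, and two applications of Stewart's inequality
    compare any two points on the sides. The price is that [sqsep] forgets the time order, which is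
    recovered separately. *)

Section Variation.
Context {R : realType} (X : metricType R).
Implicit Types (g : R -> X) (p : seq R) (x y z : R).

Fixpoint chain_length g x p : R :=
  if p is y :: p' then mdist (g x) (g y) + chain_length g y p' else 0.

(** Trivial steps are allowed ([<=], not [<]), so that degenerate intervals are no special case;
    [chain_strict] later removes the repetitions, as [itv_partition] is strict. *)
Definition chain x y p := path <=%R x p && (last x p == y).

Definition var_set g x y : set R := [set chain_length g x p | p in chain x y].

(** A real supremum, hence a junk value when the variation is infinite; this is why [has_ubound]
    accompanies it. *)
Definition variation_on g x y : R := sup (var_set g x y).

Lemma chain_length_ge0 g x p : 0 <= chain_length g x p.
Proof. by elim: p x => //= y p IH x; rewrite addr_ge0 ?mdist_ge0. Qed.

Lemma chain_length_cat g x p q :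
  chain_length g x (p ++ q) = chain_length g x p + chain_length g (last x p) q.
Proof. by elim: p x => [|y p IH] x /=; rewrite ?add0r// IH addrA. Qed.

Lemma chain_cat x y z p q : chain x y p -> chain y z q -> chain x z (p ++ q).
Proof.
move=> /andP[px /eqP lx] /andP[py /eqP ly].
by rewrite /chain cat_path last_cat px lx py ly eqxx.
Qed.

Lemma chain1 x y : x <= y -> chain x y [:: y].
Proof. by move=> xy; rewrite /chain /= xy eqxx. Qed.

(** Inserting [y] into the chain can only lengthen it, by the triangle inequality; this makes the
    variation additive. *)
Lemma chain_split g x y z p : x <= y -> y <= z -> chain x z p ->
  exists p1 p2, [/\ chain x y p1, chain y z p2 &
    chain_length g x p <= chain_length g x p1 + chain_length g y p2].
Proof.
elim: p x => [|w p IH] x xy yz.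
  move=> cxz; exists [:: y], [:: z].
  by rewrite !chain1// addr_ge0// ?chain_length_ge0.
move=> /andP[/= /andP[xw pw] lw].
have [wy|yw] := leP w y.
  have [|p1 [p2 [c1 c2 le12]]] := IH w wy yz; first by rewrite /chain pw.
  exists (w :: p1), p2; split => //=; last by rewrite -addrA lerD2l.
  by move: c1; rewrite /chain /= xw.
exists [:: y], (w :: p); rewrite chain1//; split => //.
  by rewrite /chain /= (ltW yw) pw.
by rewrite /= addr0 addrA lerD2r metric_triangle.
Qed.

Lemma var_set_neq0 g x y : x <= y -> var_set g x y !=set0.
Proof.
by move=> xy; exists (mdist (g x) (g y)), [:: y]; [exact: chain1|rewrite /= addr0].
Qed.

Lemma var_set_ubD g x y z : x <= y -> y <= z ->
  has_ubound (var_set g x y) -> has_ubound (var_set g y z) ->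
  has_ubound (var_set g x z).
Proof.
move=> xy yz [M1 H1] [M2 H2]; exists (M1 + M2) => _ [p /= cp <-].
have [p1 [p2 [c1 c2 /le_trans->//]]] := chain_split g xy yz cp.
by apply: lerD; [apply: H1; exists p1|apply: H2; exists p2].
Qed.

Lemma var_set_ubS g a b x y : a <= x -> x <= y -> y <= b ->
  has_ubound (var_set g a b) -> has_ubound (var_set g x y).
Proof.
move=> ax xy yb [M HM]; exists M => _ [p /= cp <-].
apply: (@le_trans _ _ (chain_length g a (x :: p ++ [:: b]))); last first.
  by apply: HM; eexists => //; exact: (chain_cat (chain1 ax) (chain_cat cp (chain1 yb))).
rewrite /= chain_length_cat addrCA lerDl addr_ge0 ?mdist_ge0//=.
by rewrite addr0 mdist_ge0.
Qed.

Lemma variation_onD g x y z : x <= y -> y <= z ->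
  has_ubound (var_set g x z) ->
  variation_on g x z = variation_on g x y + variation_on g y z.
Proof.
move=> xy yz ub.
have ub1 := var_set_ubS (lexx x) xy yz ub.
have ub2 := var_set_ubS xy yz (lexx z) ub.
have s1 : has_sup (var_set g x y) by split => //; exact: var_set_neq0.
have s2 : has_sup (var_set g y z) by split => //; exact: var_set_neq0.
apply/eqP; rewrite eq_le; apply/andP; split.
  apply: ge_sup; first exact/var_set_neq0/(le_trans xy yz).
  move=> _ [p /= cp <-].
  have [p1 [p2 [c1 c2 /le_trans->//]]] := chain_split g xy yz cp.
  by apply: lerD; apply: sup_upper_bound => //; [exists p1|exists p2].
rewrite /variation_on -sup_sumE//; apply: ge_sup.
  have [[a Aa] _] := s1; have [[b Bb] _] := s2.
  by exists (a + b), a => //; exists b.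
move=> _ [_ [p cp <-] [_ [q cq <-] <-]]; apply: sup_upper_bound.
  by split => //; exact/var_set_neq0/(le_trans xy yz).
exists (p ++ q); first exact: chain_cat cp cq.
by rewrite chain_length_cat; case/andP: cp => _ /eqP ->.
Qed.

Lemma mdist_le_variation g x y : x <= y -> has_ubound (var_set g x y) ->
  mdist (g x) (g y) <= variation_on g x y.
Proof.
move=> xy ub; apply: sup_upper_bound; first by split=> //; exact: var_set_neq0.
by exists [:: y]; [exact: chain1|rewrite /= addr0].
Qed.

Lemma variation_on_adherent g x y e : 0 < e -> x <= y ->
  has_ubound (var_set g x y) ->
  exists2 p, chain x y p & variation_on g x y - e < chain_length g x p.
Proof.
move=> e0 xy ub; have [|_ [p cp <-] h] := @sup_adherent _ (var_set g x y) _ e0.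
  by split => //; exact: var_set_neq0.
by exists p.
Qed.

(** Absolute continuity of an interval function [W]: a distance, a variation, or the increment of a
    monotone function. The index type is any finite one because the families below are indexed by
    pairs or by finite sets of intervals. *)
Definition ac_itv (u v : R) (W : R -> R -> R) := forall e : R, 0 < e ->
  exists2 d : R, 0 < d & forall (I : finType) (s t : I -> R),
    (forall i, [/\ u <= s i, s i <= t i & t i <= v]) ->
    trivIset [set: I] (fun i => `]s i, t i[%classic) ->
    \sum_i (t i - s i) < d -> \sum_i W (s i) (t i) <= e.

Lemma abs_continuous_ac_itv u v g : abs_continuous u v g ->
  ac_itv u v (fun s t => mdist (g s) (g t)).
Proof.
move=> ac e e0; have [d d0 H] := ac e e0; exists d => // I s t st tr sd.
have eI : forall F : I -> R, \sum_i F i = \sum_(j < #|I|) F (enum_val j).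
  move=> F; rewrite (reindex (@enum_val I predT))//=.
  by apply: onW_bij; exact: enum_val_bij.
rewrite eI; apply/ltW/H => [i|i j _ _ ij|]; first exact: st.
- by apply: enum_val_inj; exact: tr ij.
- by rewrite -(eI (fun i => t i - s i)).
Qed.

Lemma chain_lengthE g x p : chain_length g x p =
  \sum_(i < size p) mdist (g (nth 0 (x :: p) i)) (g (nth 0 p i)).
Proof.
elim: p x => [|y p IH] x /=; first by rewrite big_ord0.
by rewrite big_ord_recl IH.
Qed.

Lemma chain_nth_le x y p i j : chain x y p -> (i <= j <= size p)%N ->
  nth 0 (x :: p) i <= nth 0 (x :: p) j.
Proof.
move=> /andP[cp _] /andP[ij jp].
apply: (@le_sorted_leq_nth _ _ 0 (x :: p) cp) => //; rewrite inE/= ltnS//.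
exact: leq_trans jp.
Qed.

Lemma chain_nth_ge x y p i : chain x y p -> (i <= size p)%N ->
  x <= nth 0 (x :: p) i.
Proof. by move=> cp ip; exact: (@chain_nth_le _ _ _ 0%N i cp). Qed.

Lemma chain_nth_le_last x y p i : chain x y p -> (i <= size p)%N ->
  nth 0 (x :: p) i <= y.
Proof.
move=> cp ip; case/andP: (cp) => _ /eqP <-.
have -> : last x p = nth 0 (x :: p) (size p)
  by exact: esym (nth_last 0 (x :: p)).
by apply: chain_nth_le cp _; rewrite ip leqnn.
Qed.

(** Each interval is replaced by the steps of a chain that nearly realizes its variation: these form
    a disjoint family again, of the same total length. *)
Lemma ac_itv_variation u v g : (forall x y, u <= x -> x <= y -> y <= v ->
    has_ubound (var_set g x y)) ->
  ac_itv u v (fun s t => mdist (g s) (g t)) -> ac_itv u v (variation_on g).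
Proof.
move=> ub ac e e0; have e20 : 0 < e / 2 by rewrite divr_gt0.
have [d d0 H] := ac _ e20; exists d => // I s t st tr sd.
(* The error allowed to each interval; the errors add up to at most [e / 2], and [.+1] covers the
   empty family. *)
pose e' := e / 2 / (#|I|.+1)%:R.
have e'0 : 0 < e' by rewrite !divr_gt0.
have /choice[p Hp] : forall i, exists p, chain (s i) (t i) p /\
    variation_on g (s i) (t i) - e' < chain_length g (s i) p.
  move=> i; have [si sti ti] := st i.
  by have [p] := variation_on_adherent e'0 sti (ub _ _ si sti ti); exists p.
apply: (@le_trans _ _ (\sum_i (chain_length g (s i) (p i) + e'))).
  apply: ler_sum => i _; rewrite -lerBlDr ltW//; exact: (Hp i).2.
rewrite big_split/= sumr_const (splitr e) lerD//; last first.
  rewrite -(mulr_natr e') /e' mulrAC ler_pdivrMr// ler_wpM2l ?ltW//.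
  by rewrite ltr_nat.
under eq_bigr do rewrite chain_lengthE.
rewrite (@sig_big_dep _ _ _ I (fun i => 'I_(size (p i))) predT (fun _ => predT)
  (fun i j => mdist (g (nth 0 (s i :: p i) j)) (g (nth 0 (p i) j))))/=.
apply: (H _ (fun k : {i : I & 'I_(size (p i))} => nth 0 (s (tag k) :: p (tag k)) (tagged k))
            (fun k => nth 0 (p (tag k)) (tagged k))).
- move=> [i j] /=; have [si sti ti] := st i; have [c _] := Hp i; split.
  + by rewrite (le_trans si)// (chain_nth_ge c)// ltnW.
  + by apply: (@chain_nth_le _ _ _ j j.+1 c); rewrite leqnSn ltn_ord.
  + by rewrite (le_trans _ ti)//; apply: (@chain_nth_le_last _ _ _ j.+1 c).
- move=> [i j] [i' j'] _ _ /= [z []] /=; rewrite !in_itv/=.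
  move=> /andP[z1 z2] /andP[z3 z4].
  (* A common point of two steps lies in both ambient intervals, which forces [i = i']; within one
     chain the steps are ordered. *)
  have ii' : i = i'.
    apply: tr => //; exists z; split; rewrite /= in_itv/=; apply/andP; split.
    + by rewrite (le_lt_trans _ z1)// (chain_nth_ge (Hp i).1)// ltnW.
    + by rewrite (lt_le_trans z2)//; apply: (@chain_nth_le_last _ _ _ j.+1 (Hp i).1).
    + by rewrite (le_lt_trans _ z3)// (chain_nth_ge (Hp i').1)// ltnW.
    + by rewrite (lt_le_trans z4)//; apply: (@chain_nth_le_last _ _ _ j'.+1 (Hp i').1).
  move: j' z3 z4; rewrite -ii' => j' z3 z4.
  suff -> : j = j' by [].
  apply: ord_inj; apply/eqP; rewrite eqn_leq /= leqNgt [X in _ && X]leqNgt; apply/andP; split.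
  + apply/negP => jj; have := lt_trans z3 z2; rewrite ltNge => /negP; apply.
    have hh : (j'.+1 <= j <= size (p i))%N by rewrite jj ltnW.
    have := lt_trans z1 z4; rewrite ltNge => /negP; case.
    exact: (chain_nth_le (Hp i).1 hh).
  + apply/negP => jj.
    have hh : (j.+1 <= j' <= size (p i))%N by rewrite jj ltnW.
    have := lt_trans z3 z2; rewrite ltNge => /negP; case.
    exact: (chain_nth_le (Hp i).1 hh).
- apply: le_lt_trans sd.
  rewrite -(@sig_big_dep _ _ _ I (fun i => 'I_(size (p i))) predT (fun _ => predT)
    (fun i j => nth 0 (p i) j - nth 0 (s i :: p i) j))/=.
  apply: ler_sum => i _.
  have [_ /andP[_ /eqP lp]] := conj (Hp i).2 (Hp i).1.
  rewrite -lp; elim: (p i) (s i) => [|y q IH] x /=.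
    by rewrite big_ord0 subrr.
  rewrite big_ord_recl/=; apply: le_trans (lerD (lexx _) (IH _)) _.
  by rewrite addrC subrKA.
Qed.

(** On an interval shorter than [d] the steps of a chain form an admissible family, which bounds the
    variation by 1; a longer interval is exhausted by pieces of length [d / 4]. *)
Lemma ac_itv_var_bounded u v g : ac_itv u v (fun s t => mdist (g s) (g t)) ->
  forall x y, u <= x -> x <= y -> y <= v -> has_ubound (var_set g x y).
Proof.
move=> ac; have [d d0 H] := ac 1 ltr01.
suff S : forall n x y, u <= x -> x <= y -> y <= v -> y - x < d / 4 *+ n.+1 ->
    has_ubound (var_set g x y).
  move=> x y ux xy yv; have d20 : 0 < d / 4 by rewrite divr_gt0.
  apply: (S (Num.bound ((y - x) / (d / 4)))) => //.
  have yx : 0 <= (y - x) / (d / 4) by rewrite divr_ge0// ?subr_ge0// ltW.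
  rewrite -mulr_natr mulrC -ltr_pdivrMr//.
  by rewrite (lt_trans (archi_boundP yx))// ltr_nat.
have H1 x y : u <= x -> x <= y -> y <= v -> y - x < d / 2 ->
    has_ubound (var_set g x y).
  move=> ux xy yv yxd; exists 1 => _ [p cp <-]; rewrite chain_lengthE.
  apply: (H 'I_(size p) (fun i => nth 0 (x :: p) i) (fun i => nth 0 p i)).
  - move=> i; split.
    + by rewrite (le_trans ux)// (chain_nth_ge cp)// ltnW.
    + by apply: (@chain_nth_le _ _ _ i i.+1 cp); rewrite leqnSn ltn_ord.
    + by rewrite (le_trans _ yv)//; apply: (@chain_nth_le_last _ _ _ i.+1 cp).
  - move=> j j' _ _ /= [z []] /=; rewrite !in_itv/= => /andP[z1 z2] /andP[z3 z4].
    apply: ord_inj; apply/eqP; rewrite eqn_leq /= leqNgt [X in _ && X]leqNgt; apply/andP; split.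
    + apply/negP => jj; have hh : (j'.+1 <= j <= size p)%N by rewrite jj ltnW.
      have := lt_trans z1 z4; rewrite ltNge => /negP; case.
      exact: (chain_nth_le cp hh).
    + apply/negP => jj; have hh : (j.+1 <= j' <= size p)%N by rewrite jj ltnW.
      have := lt_trans z3 z2; rewrite ltNge => /negP; case.
      exact: (chain_nth_le cp hh).
  - have -> : \sum_(i < size p) (nth 0 p i - nth 0 (x :: p) i) = y - x.
      move/andP: cp => [_ /eqP <-]; elim: (p) (x) => [|w q IHq] x0 /=.
        by rewrite big_ord0 subrr.
      by rewrite big_ord_recl/= (IHq w) addrC subrKA.
    by rewrite (lt_trans yxd)// ltr_pdivrMr// ltr_pMr// ltr1n.
elim => [|n IH] x y ux xy yv yxd.
  by apply: H1 => //; rewrite (lt_trans yxd)// mulr1n; lra.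
have [yxd2|yxd2] := ltP (y - x) (d / 2); first exact: (H1 _ _ ux xy yv).
pose w := x + d / 4.
have d2 : d / 2 = d / 4 + d / 4 by lra.
have xw : x <= w by rewrite /w lerDl divr_ge0// ltW.
have wy : w <= y by rewrite /w; lra.
apply: (var_set_ubD xw wy).
  by apply: (H1 _ _ ux xw (le_trans wy yv)); rewrite /w; lra.
apply: IH => //; first exact: le_trans xw.
move: yxd; rewrite mulrS /w; set K := _ *+ _.+1; lra.
Qed.
End Variation.

(** * Densities of absolutely continuous functions *)

Section Density.
Context {R : realType}.
Local Notation mu := (@lebesgue_measure R).
Variables (V : R -> R) (u v : R).
Hypothesis ndV : {homo V : x y / x <= y}.
Hypothesis acV : ac_itv u v (fun s t => V t - V s).
Hypothesis V_left : forall t, t <= u -> V t = V u.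
Hypothesis V_right : forall t, v <= t -> V t = V v.
Hypothesis uv : u <= v.

Lemma ac_itv_continuous : continuous V.
Proof.
move=> t; apply/cvgrPdist_le => e e0.
have [d d0 H] := acV e0; exists d => //= s sd.
(* Projection to [[u, v]] leaves [V] unchanged and does not lengthen intervals, so that [acV]
   controls increments on the whole line. *)
pose cl x := Order.max u (Order.min x v).
have clV x : V (cl x) = V x.
  rewrite /cl; case: (leP x v) => xv.
    by case: (leP u x) => // /ltW /V_left ->.
  by rewrite (max_idPr uv)// V_right// ltW.
have clI x : u <= cl x <= v.
  by rewrite /cl le_max lexx /= ge_max uv ge_min lexx orbT.
have cll x y : x <= y -> cl x <= cl y /\ cl y - cl x <= y - x.
  by rewrite /cl => xy; split; rewrite /Order.max /Order.min; repeat case: ifP; lra.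
have W x y : x <= y -> y - x < d -> V y - V x <= e.
  move=> xy xyd; have [c1 c2] := cll _ _ xy; rewrite -(clV x) -(clV y).
  have := H unit (fun=> cl x) (fun=> cl y); rewrite !big_const card_unit /= !addr0.
  apply; last exact: le_lt_trans xyd.
    by move=> _; have /andP[? _] := clI x; have /andP[_ ?] := clI y.
  by move=> [] [].
have [st|ts] := leP s t.
  rewrite ger0_norm ?subr_ge0 ?ndV//; apply: W => //.
  by move: sd; rewrite /= ger0_norm ?subr_ge0.
rewrite ler0_norm ?subr_le0 ?ndV ?(ltW ts)// opprB.
apply: W; first exact: ltW.
by move: sd; rewrite /= ler0_norm ?subr_le0 ?opprB// ltW.
Qed.

Let V_rc : right_continuous V := right_continuousW ac_itv_continuous.
Let VV : cumulative R R := HB.pack V (isCumulative.Build R _ R V ndV V_rc).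
Let nu0 : {measure set (measurableTypeR R) -> \bar R} := lebesgue_stieltjes_measure VV.
Let D : set (measurableTypeR R) := `]u, v]%classic.

Lemma stieltjes_ocitv (f : cumulative R R) s t : s <= t ->
  lebesgue_stieltjes_measure f `]s, t]%classic = (f t - f s)%:E.
Proof.
move=> st; rewrite /lebesgue_stieltjes_measure /measure_extension.
rewrite measurable_mu_extE/=; last exact: is_ocitv.
by rewrite wlength_itv_bnd.
Qed.

Let mD : measurable D.
Proof. by apply: sub_sigma_algebra; exact: is_ocitv. Qed.

Let nuD : (nu0 D < +oo)%E.
Proof. by rewrite /nu0/= stieltjes_ocitv// ltry. Qed.

Let nu : {finite_measure set (measurableTypeR R) -> \bar R} := mfrestr mD nuD.

Lemma sub_ocitv (B : set R) : ocitv B -> B `<=` `]u, v]%classic ->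
  exists xy : R * R, [/\ u <= xy.1, xy.1 <= xy.2, xy.2 <= v &
    B = `]xy.1, xy.2]%classic].
Proof.
move=> /ocitvP[-> _|[[x y] /= xy ->] sub].
  by exists (u, u); split => //=; rewrite set_itv_ge// bnd_simp ltxx.
have ly : y \in `]x, y] by rewrite in_itv/= xy lexx.
have yuv := sub _ ly; move: yuv; rewrite /= in_itv/= => /andP[uy yv].
exists (x, y); split => //=; last exact: ltW.
rewrite leNgt; apply/negP => xu.
have : `]x, y]%classic u by rewrite /= in_itv/= xu ltW.
by move=> /sub; rewrite /= in_itv/= ltxx.
Qed.

(** A set of the ring is a finite disjoint union of half-open intervals, on which both measures are
    sums of increments; the claim is then [acV] itself. *)
Lemma stieltjes_ring_le e : 0 < e -> exists2 d : R, 0 < d &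
  forall U : set (measurableTypeR R), R.-ocitv.-ring.-measurable U ->
    U `<=` D -> (mu U < d%:E)%E -> (nu0 U <= e%:E)%E.
Proof.
move=> e0; have [d d0 H] := acV e0; exists d => // U.
rewrite SetRing.ring_measurableE => -[F [-> Fm Ffin Ftriv]] FD.
have FDb B : F B -> B `<=` D by move=> FB z Bz; apply: FD; exists B.
have mF B : F B -> measurable (B : set (measurableTypeR R)).
  by move=> FB; apply: sub_sigma_algebra; exact: Fm.
have FP (B : fset_set F) : F (\val B).
  by have := valP B; rewrite in_fset_set// inE.
have /choice[xy Hxy] : forall B : fset_set F, exists xy : R * R,
    [/\ u <= xy.1, xy.1 <= xy.2, xy.2 <= v & \val B = `]xy.1, xy.2]%classic].
  by move=> B; apply: sub_ocitv; [exact/Fm/FP|exact/FDb/FP].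
have muE B : mu (\val B) = ((xy B).2 - (xy B).1)%:E.
  by have [_ ? _ ->] := Hxy B; rewrite /lebesgue_measure stieltjes_ocitv.
have nuE B : nu0 (\val B) = (V (xy B).2 - V (xy B).1)%:E.
  by have [_ ? _ ->] := Hxy B; rewrite /nu0/= stieltjes_ocitv.
have -> : mu (\bigcup_(X in F) X) = (\sum_(B : fset_set F) ((xy B).2 - (xy B).1))%:E.
  rewrite measure_fin_bigcup// fsbig_finite//= big_seq_fsetE/= -sumEFin.
  by apply: eq_bigr => B _; exact: muE.
have -> : nu0 (\bigcup_(X in F) X) = (\sum_(B : fset_set F) (V (xy B).2 - V (xy B).1))%:E.
  rewrite measure_fin_bigcup// fsbig_finite//= big_seq_fsetE/= -sumEFin.
  by apply: eq_bigr => B _; exact: nuE.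
rewrite lte_fin lee_fin => sd.
apply: (H _ (fun B => (xy B).1) (fun B => (xy B).2)) => //.
  by move=> B; have [] := Hxy B.
move=> B B' _ _ [z [z1 z2]]; apply: val_inj; apply: Ftriv; try exact: FP.
exists z; split.
  by have [_ _ _ ->] := Hxy B; move: z1; rewrite /= !in_itv/= => /andP[-> /ltW].
by have [_ _ _ ->] := Hxy B'; move: z2; rewrite /= !in_itv/= => /andP[-> /ltW].
Qed.

(** A null set is covered by half-open intervals of total length below [d]. Finite unions of their
    traces on []u, v]] lie in the ring and have [nu0]-measure at most [e]; hence so has their
    increasing union. *)
Lemma stieltjes_dominates : nu `<< mu.
Proof.
move=> N N0 A mA AN; have muA := N0 _ mA AN.
apply/eqP; rewrite eq_le measure_ge0 andbT; apply/lee_addgt0Pr => e e0.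
rewrite add0e /nu /mfrestr/= /mrestr.
have [d d0 H] := stieltjes_ring_le e0.
have /ereal_inf_lt[_ [/= M [Mo AM] <-] Md] : (mu A < d%:E)%E.
  by rewrite muA lte_fin.
have oM k : ocitv (M k) by have := Mo k.
have muM k : wlength idfun (M k) = mu (M k).
  rewrite /mu /lebesgue_measure /lebesgue_stieltjes_measure /measure_extension.
  by rewrite measurable_mu_extE.
have mM k : measurable (M k : set (measurableTypeR R)) by apply: sub_sigma_algebra.
pose B k := M k `&` D.
have oB k : ocitv (B k) := ocitvI (oM k) (is_ocitv u v).
pose U n : set (measurableTypeR R) := \big[setU/set0]_(i < n) B i.
have mB k : measurable (B k : set (measurableTypeR R)) by apply: sub_sigma_algebra; exact: oB.
have mU n : measurable (U n) by apply: bigsetU_measurable.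
have Ue n : (nu0 (U n) <= e%:E)%E.
  apply: H.
  - apply: (@bigsetU_measurable _ (SetRing.type (ocitv_type R))) => i _.
    by apply: SetRing.measurable_subring; exact: oB.
  - by rewrite /U -bigcup_mkord => x [k _ [_ ?]].
  - apply: le_lt_trans Md.
    apply: (@le_trans _ _ (mu (\bigcup_k M k))).
      apply: le_measure; rewrite ?inE//; first exact: bigcupT_measurable.
      by rewrite /U -bigcup_mkord => x [k _ [? _]]; exists k.
    under eq_eseriesr do rewrite muM.
    by apply: measure_sigma_subadditive => //; exact: bigcupT_measurable.
have cU : nu0 \o U @ \oo --> nu0 (\bigcup_n U n).
  apply: nondecreasing_cvg_mu => //; first exact: bigcupT_measurable.
  move=> m n mn; apply/subsetPset; rewrite /U -!bigcup_mkord.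
  by move=> x [k /= km Bx]; exists k => //=; exact: leq_trans mn.
apply: (@le_trans _ _ (nu0 (\bigcup_n U n))).
  apply: le_measure; rewrite ?inE//; first exact: measurableI.
    exact: bigcupT_measurable.
  move=> x [/AM [k _ Mx] Dx]; exists k.+1 => //.
  by rewrite /U -bigcup_mkord; exists k => //=.
rewrite -(cvg_lim _ cU)//; apply: lime_le; first by apply/cvg_ex; eexists; exact: cU.
by apply: nearW => n; exact: Ue.
Qed.

Lemma ac_density : exists f : R -> R, [/\ forall x, 0 <= f x,
  mu.-integrable [set: R] (EFin \o f) &
  forall s t, u <= s -> s <= t -> t <= v ->
    (V t - V s)%:E = (\int[mu]_(x in `]s, t]) (f x)%:E)%E].
Proof.
have [f [f0 ffin intf fE]] := radon_nikodym_sigma_finite stieltjes_dominates.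
have fK x : (fine (f x))%:E = f x by rewrite fineK.
exists (fine \o f); split => [x||s t us st tv].
- exact: fine_ge0.
- by apply: eq_integrable intf => //= x _; rewrite /= fK.
under eq_integral do rewrite /= fK.
rewrite -fE; last by apply: sub_sigma_algebra; exact: is_ocitv.
change ((V t - V s)%:E = nu0 (`]s, t]%classic `&` D)).
rewrite setIidl; last by apply: subset_itv; rewrite bnd_simp.
by rewrite /nu0/= stieltjes_ocitv.
Qed.

End Density.

Section RealDensity.
Context {R : realType}.
Local Notation mu := (@lebesgue_measure R).

Lemma derivable_cvg (F : R -> R) (s l : R) : derivable F s 1 -> derive1 F s = l ->
  (h^-1 * (F (s + h) - F s)) @[h --> 0^'] --> l.
Proof.
move=> dF <-; rewrite derive1E.
have /cvg_ex[/= k Fk] := dF.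
have -> : 'D_1 F s = k by apply/cvg_lim => //; exact: Rhausdorff.
apply: cvg_trans Fk; apply: near_eq_cvg; apply: nearW => h.
by rewrite [h *: 1]mulr1 [h + s]addrC.
Qed.

Lemma cvg_dnbhs_itv (P : R -> Prop) (u v s : R) : u < s -> s < v ->
  (forall h, u <= s + h -> s + h <= v -> h != 0 -> P h) ->
  \forall h \near (0:R)^', P h.
Proof.
move=> us sv HP; have d0 : 0 < Num.min (s - u) (v - s) by rewrite lt_min !subr_gt0 us.
exists (Num.min (s - u) (v - s)) => //= h; rewrite /= sub0r normrN lt_min => /andP[h1 h2] h0.
move: h1 h2; rewrite !ltr_norml => /andP[h1 h2] /andP[h3 h4].
by apply: HP => //; lra.
Qed.

Lemma integrable_itv (f : R -> R) (i : interval R) :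
  mu.-integrable setT (EFin \o f) -> mu.-integrable [set` i] (EFin \o f).
Proof. by move=> intf; apply: integrableS intf. Qed.

Lemma Rintegral_NyB (f : R -> R) s t : mu.-integrable setT (EFin \o f) -> s <= t ->
  \int[mu]_(x in `]-oo, t]) f x - \int[mu]_(x in `]-oo, s]) f x =
  \int[mu]_(x in `]s, t]) f x.
Proof. by move=> intf st; rewrite Rintegral_itvB//; exact: integrable_itv. Qed.

Lemma primitive_cvg (f : R -> R) : mu.-integrable setT (EFin \o f) ->
  {ae mu, forall s, (h^-1 * (\int[mu]_(x in `]-oo, s + h]) f x
                            - \int[mu]_(x in `]-oo, s]) f x)) @[h --> 0^'] --> f s}.
Proof.
move=> intf.
have lf : locally_integrable setT f by apply: open_integrable_locally => //; exact: openT.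
have := @FTC1Ny R f (fun y => integrable_itv _ intf) lf.
apply: filterS; first exact: (ae_filter_ringOfSetsType mu).
move=> s [dF eF].
exact: (derivable_cvg dF eF).
Qed.

(** Between [u] and [v], [phi] differs from the primitive of [f] by a constant, so Lebesgue
    differentiation applies to it. *)
Lemma density_cvg (f phi : R -> R) u v : mu.-integrable setT (EFin \o f) ->
  (forall s t, u <= s -> s <= t -> t <= v ->
    phi t - phi s = \int[mu]_(x in `]s, t]) f x) ->
  {ae mu, forall s, u < s -> s < v ->
     (h^-1 * (phi (s + h) - phi s)) @[h --> 0^'] --> f s}.
Proof.
move=> intf H; have := primitive_cvg intf.
apply: filterS; first exact: (ae_filter_ringOfSetsType mu).
move=> s cF us sv.
apply: cvg_trans cF; apply: near_eq_cvg; apply: (cvg_dnbhs_itv us sv) => h uh hv h0.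
congr (_ * _); have [hge0|hlt0] := leP 0 h.
  by rewrite Rintegral_NyB ?lerDl// -H// ?lerDl// ltW.
have sh : s + h <= s by rewrite gerDl ltW.
by rewrite -opprB Rintegral_NyB// -H ?opprB// ltW.
Qed.

End RealDensity.

Lemma ac_Rdensity {R : realType} (V : R -> R) (u v : R) :
  {homo V : x y / x <= y} -> ac_itv u v (fun s t => V t - V s) ->
  (forall t, t <= u -> V t = V u) -> (forall t, v <= t -> V t = V v) -> u <= v ->
  exists f : R -> R, [/\ forall x, 0 <= f x,
  (@lebesgue_measure R).-integrable [set: R] (EFin \o f) &
  forall s t, u <= s -> s <= t -> t <= v ->
    V t - V s = \int[@lebesgue_measure R]_(x in `]s, t]) f x].
Proof.
move=> ndV acV V_left V_right uv.
have [f [f0 intf fE]] := ac_density ndV acV V_left V_right uv.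
by exists f; split => // s t us st tv; rewrite /Rintegral -fE.
Qed.

(** Jordan decomposition: [V + phi] and [V] are both nondecreasing and absolutely continuous, and
    the density of [phi] is the difference of theirs. *)
Lemma dominated_density {R : realType} (V phi : R -> R) (u v : R) :
  {homo V : x y / x <= y} -> ac_itv u v (fun s t => V t - V s) ->
  (forall t, t <= u -> V t = V u) -> (forall t, v <= t -> V t = V v) -> u <= v ->
  (forall s t, u <= s -> s <= t -> t <= v -> `|phi t - phi s| <= V t - V s) ->
  exists f : R -> R,
  (@lebesgue_measure R).-integrable [set: R] (EFin \o f) /\
  forall s t, u <= s -> s <= t -> t <= v ->
    phi t - phi s = \int[@lebesgue_measure R]_(x in `]s, t]) f x.
Proof.
move=> ndV acV Vl Vr uv phiV.
pose cl x := Order.max u (Order.min x v).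
have clI x : u <= cl x <= v.
  by rewrite /cl le_max lexx /= ge_max uv ge_min lexx orbT.
have cll x y : x <= y -> cl x <= cl y.
  by rewrite /cl => xy; rewrite /Order.max /Order.min; repeat case: ifP; lra.
have cl_id x : u <= x -> x <= v -> cl x = x.
  by move=> ux xv; rewrite /cl (min_idPl xv) (max_idPr ux).
have clV x : V (cl x) = V x.
  rewrite /cl; case: (leP x v) => xv.
    by case: (leP u x) => // /ltW /Vl ->.
  by rewrite (max_idPr uv)// Vr// ltW.
pose W x := V x + phi (cl x).
have WB x y : x <= y -> `|phi (cl y) - phi (cl x)| <= V y - V x.
  move=> xy; have /andP[a b] := clI x; have /andP[c d] := clI y.
  by rewrite -(clV x) -(clV y) phiV// cll.
have ndW : {homo W : x y / x <= y}.
  move=> x y xy; have := WB _ _ xy; rewrite ler_norml /W => /andP[].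
  lra.
have acW : ac_itv u v (fun s t => W t - W s).
  move=> e e0; have [|d d0 H] := acV (e / 2); first by rewrite divr_gt0.
  exists d => // I s t st tr sd.
  apply: (@le_trans _ _ (\sum_i 2 * (V (t i) - V (s i)))).
    apply: ler_sum => i _; have [_ sti _] := st i.
    by have := WB _ _ sti; rewrite ler_norml /W => /andP[]; lra.
  by rewrite -mulr_sumr -ler_pdivlMl// mulrC; exact: H tr sd.
have Wl t : t <= u -> W t = W u.
  move=> tu; rewrite /W (Vl _ tu); congr (_ + phi _).
  rewrite /cl (min_idPl uv) (min_idPl (le_trans tu uv)).
  by rewrite maxxx; apply/max_idPl.
have Wr t : v <= t -> W t = W v.
  by move=> vt; rewrite /W (Vr _ vt) /cl (min_idPr vt) minxx.
have [f [f0 intf fE]] := ac_Rdensity ndV acV Vl Vr uv.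
have [w [w0 intw wE]] := ac_Rdensity ndW acW Wl Wr uv.
exists (fun x => w x - f x); split.
  by apply: eq_integrable (integrableB measurableT intw intf).
move=> s t us st tv; rewrite RintegralB//; try exact: integrable_itv.
rewrite -fE// -wE// /W !cl_id//; last 2 first.
- exact: le_trans st tv.
- exact: le_trans us st.
lra.
Qed.

Section ClampedVariation.
Context {R : realType} (X : metricType R).
Variables (u v : R) (g : R -> X).
Hypothesis uv : u <= v.
Hypothesis acg : abs_continuous u v g.

Definition clamp x := Order.max u (Order.min x v).

Lemma clamp_itv x : u <= clamp x <= v.
Proof. by rewrite /clamp le_max lexx /= ge_max uv ge_min lexx orbT. Qed.

Lemma clamp_le x y : x <= y -> clamp x <= clamp y.
Proof.
by rewrite /clamp => xy; rewrite /Order.max /Order.min; repeat case: ifP; lra.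
Qed.

Lemma clamp_id x : u <= x -> x <= v -> clamp x = x.
Proof. by move=> ux xv; rewrite /clamp (min_idPl xv) (max_idPr ux). Qed.

Lemma clamp_left x : x <= u -> clamp x = u.
Proof.
by move=> xu; rewrite /clamp (min_idPl (le_trans xu uv)); apply/max_idPl.
Qed.

Lemma clamp_right x : v <= x -> clamp x = v.
Proof. by move=> vx; rewrite /clamp (min_idPr vx) (max_idPr uv). Qed.

(** The variation from [u], extended by constants to the line, as the density results expect of
    [V]. *)
Definition clamped_variation x := variation_on g u (clamp x).
Local Notation V := clamped_variation.

Let acd := abs_continuous_ac_itv acg.
Let ub := ac_itv_var_bounded acd.

Lemma clamped_variationB x y : u <= x -> x <= y -> y <= v ->
  V y - V x = variation_on g x y.
Proof.
move=> ux xy yv; rewrite /V !clamp_id//; try lra.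
have -> : variation_on g u y = variation_on g u x + variation_on g x y.
  by apply: variation_onD => //; apply: (ub (lexx u) (le_trans ux xy) yv).
by rewrite addrAC subrr add0r.
Qed.

Lemma mdist_le_clamped_variation x y : u <= x -> x <= y -> y <= v ->
  mdist (g x) (g y) <= V y - V x.
Proof.
move=> ux xy yv; rewrite clamped_variationB//.
by apply: mdist_le_variation => //; exact: ub.
Qed.

Lemma clamped_variation_nd : {homo V : x y / x <= y}.
Proof.
move=> x y xy; have /andP[ux xv] := clamp_itv x; have /andP[uy yv] := clamp_itv y.
have -> : V y = V x + variation_on g (clamp x) (clamp y).
  by apply: variation_onD => //; [exact: clamp_le|apply: (ub (lexx u) uy yv)].
rewrite lerDl (le_trans (mdist_ge0 (g (clamp x)) (g (clamp y))))//.
by apply: mdist_le_variation; [exact: clamp_le|apply: ub => //; exact: clamp_le].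
Qed.

Lemma clamped_variation_ac : ac_itv u v (fun s t => V t - V s).
Proof.
move=> e e0; have [d d0 H] := ac_itv_variation ub acd e0; exists d => // I s t st tr sd.
under eq_bigr => i _.
  have [a b c] := st i; rewrite clamped_variationB//; over.
exact: H.
Qed.

Lemma clamped_variation_left t : t <= u -> V t = V u.
Proof. by move=> tu; rewrite /V !clamp_left. Qed.

Lemma clamped_variation_right t : v <= t -> V t = V v.
Proof. by move=> vt; rewrite /V !clamp_right. Qed.

End ClampedVariation.

Section MetricSpeed.
Context {R : realType} (X : metricType R).
Local Notation mu := (@lebesgue_measure R).

Lemma real_ac_density (u v : R) (g : R -> R) : u <= v ->
  abs_continuous u v (g : R -> R^o) ->
  exists f : R -> R, [/\ mu.-integrable [set: R] (EFin \o f),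
    forall s t, u <= s -> s <= t -> t <= v ->
      g t - g s = \int[mu]_(x in `]s, t]) f x &
    {ae mu, forall s, u < s -> s < v -> derive1 g s = f s}].
Proof.
move=> uv ac.
have [f [intf fE]] : exists f : R -> R,
    mu.-integrable [set: R] (EFin \o f) /\
    forall s t, u <= s -> s <= t -> t <= v ->
      g t - g s = \int[mu]_(x in `]s, t]) f x.
  apply: (@dominated_density R (clamped_variation u v (g : R -> R^o))) => //.
  - exact: clamped_variation_nd.
  - exact: clamped_variation_ac.
  - exact: clamped_variation_left.
  - exact: clamped_variation_right.
  - exact: (@mdist_le_clamped_variation R R^o).
exists f; split => //.
have := density_cvg intf fE; apply: filterS.
  exact: (ae_filter_ringOfSetsType mu).
move=> s H us sv; apply/cvg_lim; first exact: Rhausdorff.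
apply: cvg_trans (H us sv); apply: near_eq_cvg; apply: nearW => h.
by rewrite [h + s]addrC.
Qed.

(* The speed is the supremum of the densities of [t |-> d(g q, g t)], where [q] runs
   through a countable dense set of parameters. *)
Theorem metric_speed (u v : R) (g : R -> X) : u < v -> abs_continuous u v g ->
  exists m : R -> R, [/\ forall x, 0 <= m x, mu.-integrable [set: R] (EFin \o m),
    forall s t, u <= s -> s <= t -> t <= v ->
      mdist (g s) (g t) <= \int[mu]_(x in `]s, t]) m x &
    {ae mu, forall s, u < s -> s < v -> metric_derivative g s = m s}].
Proof.
move=> ltuv ac; have uv := ltW ltuv.
pose V := clamped_variation u v g.
have ndV : {homo V : x y / x <= y}  by exact: clamped_variation_nd.
have acV : ac_itv u v (fun s t => V t - V s) by exact: clamped_variation_ac.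
have Vl := clamped_variation_left g uv.
have Vr := clamped_variation_right g uv.
have gV : forall x y, u <= x -> x <= y -> y <= v -> mdist (g x) (g y) <= V y - V x.
  by move=> x y; exact: mdist_le_clamped_variation.
have [fV [fV0 intV VE]] := ac_Rdensity ndV acV Vl Vr uv.
(* The rationals, clamped to [[u, v]], are the dense set of parameters; an index that codes no
   rational gives the clamp of 0. *)
pose q n : R := clamp u v (if (choice.unpickle n : option rat) is Some r then ratr r else 0).
pose phi n t := mdist (g (q n)) (g t).
have phiV n s t : u <= s -> s <= t -> t <= v -> `|phi n t - phi n s| <= V t - V s.
  move=> us st tv; apply: le_trans (gV _ _ us st tv).
  rewrite ler_norml /phi; have := metric_triangle (g (q n)) (g s) (g t).
  have := metric_triangle (g (q n)) (g t) (g s); rewrite (metric_sym (g t) (g s)).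
  lra.
have /choice[f Hf] n : exists f : R -> R, mu.-integrable [set: R] (EFin \o f) /\
    forall s t, u <= s -> s <= t -> t <= v ->
    phi n t - phi n s = \int[mu]_(x in `]s, t]) f x.
  exact: dominated_density ndV acV Vl Vr uv (phiV n).
have AE : {ae mu, forall s, u < s -> s < v ->
    (h^-1 * (V (s + h) - V s)) @[h --> 0^'] --> fV s /\
    forall n, (h^-1 * (phi n (s + h) - phi n s)) @[h --> 0^'] --> f n s}.
  have AE1 := density_cvg intV VE.
  have AE2 : {ae mu, forall s n, u < s -> s < v ->
    (h^-1 * (phi n (s + h) - phi n s)) @[h --> 0^'] --> f n s}.
    by apply/ae_foralln => n; have [intf fE] := Hf n; exact: density_cvg intf fE.
  move: AE1 AE2; apply: filterS2; first exact: (ae_filter_ringOfSetsType mu).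
  by move=> s H1 H2 us sv; split => [|n]; [exact: H1|exact: H2].
have ltuvE (s : R) : u < s -> s < v -> u <= s <= v by move=> /ltW -> /ltW ->.
have fle s : u < s -> s < v ->
    (h^-1 * (V (s + h) - V s)) @[h --> 0^'] --> fV s ->
    (forall n, (h^-1 * (phi n (s + h) - phi n s)) @[h --> 0^'] --> f n s) ->
    forall n, `|f n s| <= fV s.
  move=> us sv cV cphi n.
  have cN : (`|h^-1 * (phi n (s + h) - phi n s)|) @[h --> 0^'] --> `|f n s|.
    by apply: (@cvg_norm _ R^o); exact: cphi.
  apply: (ler_cvg_to cN cV); apply: (cvg_dnbhs_itv us sv) => h uh hv h0.
  rewrite normrM; have [hge|hlt] := leP 0 h.
    rewrite ger0_norm ?invr_ge0// ler_wpM2l ?invr_ge0//.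
    by apply: phiV => //; [exact: ltW|rewrite lerDl].
  have hi : h^-1 <= 0 by rewrite invr_le0 ltW.
  rewrite (ler0_norm hi) mulNr -mulrN -subr_ge0 -mulrBr mulr_le0//.
  rewrite subr_le0 lerNr opprB distrC; apply: phiV => //; [by rewrite gerDl ltW|exact: ltW].
have [N [mN N0 NE]] := AE.
pose A : set R := `]u, v[%classic `\` N.
have mA : measurable A by apply: measurableD.
(* Cut off outside a set of full measure in [[u, v]], so that [|F n| <= fV] holds at every point and
   the supremum [m] is finite everywhere. *)
pose F n x := f n x * \1_A x.
have FV n x : `|F n x| <= fV x.
  rewrite /F indicE; case: (boolP (x \in A)) => [|_]; last by rewrite mulr0 normr0.
  rewrite inE mulr1 => -[/=]; rewrite in_itv/= => /andP[ux xv] xN.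
  have [c1 c2] : (h^-1 * (V (x + h) - V x)) @[h --> 0^'] --> fV x /\
      forall n, (h^-1 * (phi n (x + h) - phi n x)) @[h --> 0^'] --> f n x.
    by apply: contrapT => H; apply: xN; apply: NE => /= H'; apply/H/H'.
  exact: fle c2 n.
have mf n : measurable_fun setT (f n).
  by have [intf _] := Hf n; apply/measurable_EFinP; exact: measurable_int intf.
have mF n : measurable_fun setT (F n).
  by apply: measurable_funM; [exact: mf|exact: measurable_indic].
have intF n : mu.-integrable setT (EFin \o F n).
  apply: le_integrable intV => //; first by apply/measurable_EFinP; exact: mF.
  by move=> x _ /=; rewrite lee_fin (ger0_norm (fV0 x)); exact: FV.
pose m x := sups (fun n => `|F n x|) 0.
have Fub x : has_ubound (range (fun n => `|F n x|)).
  by exists (fV x) => _ [n _ <-]; exact: FV.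
have Fm n x : `|F n x| <= m x.
  by apply: ub_le_sup; [apply: subset_has_ubound (Fub x) => _ [k _ <-]; exists k|exists n].
have m0 x : 0 <= m x := le_trans (normr_ge0 _) (Fm 0%N x).
have mV x : m x <= fV x.
  apply: ge_sup; first by exists `|F 0%N x|, 0%N.
  by move=> _ [n _ <-]; exact: FV.
have mm : measurable_fun setT m.
  apply: measurable_fun_sups => [x _|n]; first exact: Fub.
  by apply: measurableT_comp => //; exact: mF.
have intm : mu.-integrable setT (EFin \o m).
  apply: le_integrable intV => //; first by apply/measurable_EFinP.
  by move=> x _ /=; rewrite lee_fin !ger0_norm.
have fF n s t : u <= s -> s <= t -> t <= v ->
    \int[mu]_(x in `]s, t]) f n x = \int[mu]_(x in `]s, t]) F n x.
  move=> us st tv; congr fine; apply: ae_eq_integral => //.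
  - by apply/measurable_EFinP; apply: measurable_funTS; exact: mf.
  - by apply/measurable_EFinP; apply: measurable_funTS; exact: mF.
  exists (N `|` [set v]); split.
  - exact: measurableU.
  - by rewrite null_set_setU//= ?lebesgue_measure_set1.
  move=> x /= /not_implyP[]; rewrite in_itv/= => /andP[sx xt] Fx.
  have [->|xv] := eqVneq x v; [by right|left].
  apply: contrapT => xN; apply: Fx; congr EFin.
  rewrite /F indicE mem_set ?mulr1//; split => //=.
  rewrite in_itv/= (le_lt_trans us sx)/= lt_neqAle xv; exact: le_trans tv.
have phim n s t : u <= s -> s <= t -> t <= v ->
    `|phi n t - phi n s| <= \int[mu]_(x in `]s, t]) m x.
  move=> us st tv; have [_ ->//] := Hf n; rewrite fF//.
  apply: le_trans (le_normr_Rintegral _ _) _ => //; first exact: integrable_itv.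
  apply: le_Rintegral => //; try exact: integrable_itv.
  apply: integrable_itv; apply: le_integrable intV => //.
    by apply/measurable_EFinP; apply: measurableT_comp => //; exact: mF.
  by move=> x _ /=; rewrite lee_fin normr_id (ger0_norm (fV0 x)); exact: FV.
have qdense t e : u <= t -> t <= v -> 0 < e -> exists n, mdist (g (q n)) (g t) <= e.
  move=> ut tv e0.
  have /cvgrPdist_le/(_ e e0)[d /= d0 Hd] := ac_itv_continuous ndV acV Vl Vr uv (x := t).
  have [|r] := @rat_in_itvoo R (t - d) (t + d); first by lra.
  rewrite in_itv/= => /andP[r1 r2].
  exists (choice.pickle r); rewrite /q choice.pickleK.
  have : `|V t - V (ratr r)| <= e by apply: Hd; rewrite /ball_/= ltr_norml; lra.
  have -> : V (ratr r) = V (clamp u v (ratr r)).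
    by rewrite /V /clamped_variation [in RHS]clamp_id//; have /andP[] := clamp_itv uv (ratr r).
  have /andP[uc cv] := clamp_itv uv (ratr r); apply: le_trans.
  have [tc|ct] := leP t (clamp u v (ratr r)).
    rewrite metric_sym; apply: le_trans (gV _ _ ut tc cv) _.
    by rewrite distrC ler_norm.
  by apply: le_trans (gV _ _ uc (ltW ct) tv) _; exact: ler_norm.
(* With [g (q n)] within [e / 2] of [g t], the function [phi n] drops by at least
   [mdist (g s) (g t) - e] from [s] to [t]. *)
have gm s t : u <= s -> s <= t -> t <= v ->
    mdist (g s) (g t) <= \int[mu]_(x in `]s, t]) m x.
  move=> us st tv; apply/ler_addgt0Pr => e e0.
  have [|n Hn] := qdense t (e / 2) (le_trans us st) tv; first by rewrite divr_gt0.
  have := phim n _ _ us st tv; rewrite ler_norml /phi => /andP[+ _].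
  have := metric_triangle (g s) (g (q n)) (g t); rewrite (metric_sym (g s) (g (q n))).
  lra.
exists m; split => //.
have notN : {ae mu, forall s, ~ N s} by exists N; split => // x /= /contrapT.
move: (primitive_cvg intm) notN; apply: filterS2; first exact: (ae_filter_ringOfSetsType mu).
move=> s cm sN us sv.
have [_ c2] : (h^-1 * (V (s + h) - V s)) @[h --> 0^'] --> fV s /\
    forall n, (h^-1 * (phi n (s + h) - phi n s)) @[h --> 0^'] --> f n s.
  by apply: contrapT => H; apply: sN; apply: NE => /= H'; apply/H/H'.
have sA : s \in A by rewrite inE; split => //=; rewrite in_itv/= us.
have Ff n : F n s = f n s by rewrite /F indicE sA mulr1.
(* The metric difference quotient lies above the absolute difference quotient of every [phi n] and
   below that of the primitive of [m]. The latter tends to [m s], and the limits [|f n s|] of the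
   former have supremum [m s]. *)
have up : \forall h \near (0:R)^', mdist (g (s + h)) (g s) / `|h| <=
    h^-1 * (\int[mu]_(x in `]-oo, s + h]) m x - \int[mu]_(x in `]-oo, s]) m x).
  apply: (cvg_dnbhs_itv us sv) => h uh hv h0.
  have [hge|hlt] := leP 0 h.
    rewrite (ger0_norm hge) mulrC ler_wpM2l ?invr_ge0// Rintegral_NyB ?lerDl//.
    by rewrite metric_sym; apply: gm; rewrite ?lerDl// ltW.
  rewrite (ltr0_norm hlt) invrN mulrN -mulNr mulrC -opprB mulrN -mulrN.
  have hi : 0 <= - h^-1 by rewrite oppr_ge0 invr_le0 ltW.
  rewrite mulrN -mulNr mulrN -mulNr ler_wpM2l//.
  have sh : s + h <= s by rewrite gerDl ltW.
  by rewrite Rintegral_NyB//; apply: gm => //; exact: ltW.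
have low n : \forall h \near (0:R)^', `|h^-1 * (phi n (s + h) - phi n s)| <=
    mdist (g (s + h)) (g s) / `|h|.
  apply: nearW => h; rewrite normrM normfV mulrC ler_wpM2r ?invr_ge0//.
  rewrite ler_norml /phi; have := metric_triangle (g (q n)) (g s) (g (s + h)).
  have := metric_triangle (g (q n)) (g (s + h)) (g s).
  rewrite (metric_sym (g s) (g (s + h))); lra.
apply/cvg_lim; first exact: Rhausdorff.
apply/cvgrPdist_le => e e0.
have [_ [k _ <-] mk] : exists2 x, range (fun n => `|F n s|) x & m s - e / 2 < x.
  have hs : has_sup (sdrop (fun n => `|F n s|) 0).
    split; first by exists `|F 0%N s|, 0%N.
    by apply: subset_has_ubound (Fub s) => _ [k _ <-]; exists k.
  have e20 : 0 < e / 2 by rewrite divr_gt0.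
  have [_ [k _ <-] Hk] := sup_adherent e20 hs.
  by exists `|F k s| => //; exists k.
have cphi : (`|h^-1 * (phi k (s + h) - phi k s)|) @[h --> 0^'] --> `|f k s|.
  by apply: (@cvg_norm _ R^o); exact: c2.
have e20 : 0 < e / 2 by rewrite divr_gt0.
move/cvgrPdist_le : cphi => /(_ _ e20) Hphi.
move/cvgrPdist_le : cm => /(_ _ e0) Hm.
near=> h.
have H1 : `| `|f k s| - `|h^-1 * (phi k (s + h) - phi k s)| | <= e / 2.
  by near: h; exact: Hphi.
have H2 : `|m s - h^-1 * (\int[mu]_(x in `]-oo, s + h]) m x
                          - \int[mu]_(x in `]-oo, s]) m x)| <= e.
  by near: h; exact: Hm.
have H3 : mdist (g (s + h)) (g s) / `|h| <=
    h^-1 * (\int[mu]_(x in `]-oo, s + h]) m x - \int[mu]_(x in `]-oo, s]) m x).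
  by near: h; exact: up.
have H4 : `|h^-1 * (phi k (s + h) - phi k s)| <= mdist (g (s + h)) (g s) / `|h|.
  by near: h; exact: low.
move: H1 H2 mk; rewrite !ler_norml Ff => /andP[a1 a2] /andP[b1 b2] mk.
move: H3 H4; set Q := mdist _ _ / _; set P := `|h^-1 * _| in a1 a2 *.
set M := h^-1 * _ in b1 b2 *; move=> H3 H4; apply/andP; split; lra.
Unshelve. all: by end_near. Qed.

End MetricSpeed.

(** * Length of causal curves *)

Section ConeLength.
Context {R : realType}.
Local Notation mu := (@lebesgue_measure R).

(** Holds without measurability, the integral being a supremum over simple functions below the
    integrand; the speed of a curve, arbitrary on a null set, can thus be estimated as it stands. *)
Lemma le_integral_ge0 (D : set R) (f g : R -> \bar R) :
  (forall x, D x -> 0 <= f x)%E -> (forall x, D x -> f x <= g x)%E ->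
  (\int[mu]_(x in D) f x <= \int[mu]_(x in D) g x)%E.
Proof.
move=> f0 fg; rewrite integral_mkcond [X in (_ <= X)%E]integral_mkcond.
have f0' x : (0 <= (f \_ D) x)%E by rewrite patchE; case: ifPn => //; rewrite inE; exact: f0.
have g0' x : (0 <= (g \_ D) x)%E.
  rewrite patchE; case: ifPn => //; rewrite inE => Dx.
  by apply: le_trans (fg _ Dx); exact: f0.
rewrite !ge0_integralTE//; apply: ereal_sup_le => _ [h hf <-] /=.
exists h => //= x; apply: le_trans (hf x) _.
by rewrite !patchE; case: ifPn => //; rewrite inE; exact: fg.
Qed.

Lemma sqrtr_le (x y : R) : 0 <= y -> x <= y ^+ 2 -> Num.sqrt x <= y.
Proof. by move=> y0 xy; rewrite -(ger0_norm y0) -sqrtr_sqr ler_wsqrtr. Qed.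

(** AM-GM for [t * (a - m)] and [(a + m) / t]. The bound is linear in [(a, m)], so it can be
    integrated along a curve and [t] chosen afterwards; this takes the place of a concavity
    argument. *)
Lemma sqrt_sqrB_le_AGM (a m t : R) : 0 <= m -> m <= a -> 0 < t ->
  Num.sqrt (a ^+ 2 - m ^+ 2) <= (t * (a - m) + t^-1 * (a + m)) / 2.
Proof.
move=> m0 ma t0; have ti : 0 < t^-1 by rewrite invr_gt0.
have x0 : 0 <= t * (a - m) by rewrite mulr_ge0 ?subr_ge0// ltW.
have y0 : 0 <= t^-1 * (a + m) by apply: mulr_ge0; [exact: ltW|lra].
apply: sqrtr_le; first by rewrite divr_ge0// addr_ge0.
have -> : a ^+ 2 - m ^+ 2 = (t * (a - m)) * (t^-1 * (a + m)).
  by field; rewrite gt_eqF.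
move: x0 y0; set x := t * _; set y := t^-1 * _ => x0 y0.
have := sqr_ge0 (x - y); rewrite !expr2; lra.
Qed.

Section Bound.
Variables (I : set R) (X : metricType R) (c : pcurve R (cone_space I X)).
Variables (p q : cone_space I X).
Hypothesis cc : cone_fd_causal (fun=> 1) c.
Hypothesis cj : joins c p q.
Local Notation T := (\val q.1 - \val p.1).
Local Notation D := (mdist p.2 q.2).

(** No causal curve is longer than a straight one with the same end points: the linear bound
    [sqrt_sqrB_le_AGM] is integrated with one [t] for the whole curve. *)
Lemma fd_causal_bounds : [/\ 0 < T, D <= T &
  (cone_length (fun=> 1%R) c <= (Num.sqrt (T ^+ 2 - D ^+ 2))%:E)%E].
Proof.
have [[lohi act acx tmono tpos] caus] := cc; have lh := ltW lohi.
have [a [inta aE ader]] := real_ac_density lh act.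
have [m [m0 intm mE mder]] := metric_speed lohi acx.
have [N [mN N0 NE]] : {ae mu, forall s, lo c < s -> s < hi c ->
    [/\ derive1 (cone_t c) s = a s, metric_derivative (cone_x c) s = m s,
        0 < a s & m s <= a s]}.
  have aeF := ae_filter_ringOfSetsType mu.
  have H2 := @filterI _ _ aeF _ _ ader mder; have H3 := @filterI _ _ aeF _ _ tpos caus.
  move: H2 H3; apply: filterS2.
  move=> s [h1 h2] [h3 h4] ls sh.
  have s_in : s \in `[lo c, hi c] by rewrite in_itv/= !ltW.
  rewrite -(h1 ls sh); have := h4 s_in; have := h3 s_in.
  rewrite /cone_speed2 expr1n mul1r (h2 ls sh) oppr_le0 subr_ge0 => a0.
  by rewrite ler_sqr ?nnegrE// ?ltW.
pose A : set R := `]lo c, hi c[%classic `\` N.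
have mA : measurable A by apply: measurableD.
pose a' x := a x * \1_A x; pose m' x := m x * \1_A x.
have AP s : s \in A -> [/\ derive1 (cone_t c) s = a s,
     metric_derivative (cone_x c) s = m s, 0 < a s & m s <= a s].
  rewrite inE => -[/=]; rewrite in_itv/= => /andP[ls sh] sN.
  by apply: contrapT => H; apply: sN; apply: NE => /= H'; apply/H/H'.
have m'0 x : 0 <= m' x by rewrite mulr_ge0// indicE ler0n.
have ma' x : m' x <= a' x.
  rewrite /m' /a' !indicE; case: (boolP (x \in A)) => [/AP[_ _ _]|_].
    by rewrite !mulr1.
  by rewrite !mulr0.
have AN s : `]lo c, hi c]%classic s -> ~ A s -> (N `|` [set hi c]) s.
  rewrite /= in_itv/= => /andP[ls sh] nA.
  have [->|shi] := eqVneq s (hi c); [by right|left].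
  apply: contrapT => sN; apply: nA; split => //=.
  by rewrite in_itv/= ls lt_neqAle shi.
have null1 : mu (N `|` [set hi c]) = 0%E.
  by rewrite null_set_setU//= ?lebesgue_measure_set1.
have intind f : mu.-integrable setT (EFin \o f) ->
    mu.-integrable setT (EFin \o (fun x => f x * \1_A x)) /\
    \int[mu]_(x in `]lo c, hi c]) f x = \int[mu]_(x in `]lo c, hi c]) (f x * \1_A x).
  move=> intf.
  have mf : measurable_fun setT f by apply/measurable_EFinP; exact: measurable_int intf.
  have mfA : measurable_fun setT (fun x => f x * \1_A x).
    by apply: measurable_funM => //; exact: measurable_indic.
  split.
    apply: le_integrable intf => //; first by apply/measurable_EFinP.
    move=> x _ /=; rewrite lee_fin normrM indicE ler_piMr//.
    by case: (x \in A); rewrite ?normr1 ?normr0.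
  congr fine; apply: ae_eq_integral => //.
  - by apply/measurable_EFinP; exact: measurable_funTS.
  - by apply/measurable_EFinP; exact: measurable_funTS.
  exists (N `|` [set hi c]); split => //; first exact: measurableU.
  move=> x /= /not_implyP[xin Fx]; apply: AN => // Ax; apply: Fx.
  by rewrite indicE mem_set// mulr1.
have [inta' Ea] := intind _ inta; have [intm' Em] := intind _ intm.
have TE : T = \int[mu]_(x in `]lo c, hi c]) a' x.
  rewrite -Ea -aE//; have [<- <-] := cj; by [].
pose M := \int[mu]_(x in `]lo c, hi c]) m' x.
have DM : D <= M.
  by rewrite /M -Em; have [<- <-] := cj; apply: mE.
have MT : M <= T by rewrite TE; apply: le_Rintegral => //; exact: integrable_itv.
have D0 : 0 <= D by exact: mdist_ge0.
have lolo : lo c \in `[lo c, hi c] by rewrite in_itv/= lexx.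
have hihi : hi c \in `[lo c, hi c] by rewrite in_itv/= lexx lh.
(* Strict monotonicity, of either kind, gives [T != 0]; the sign comes from [D <= M <= T]. *)
have T0 : 0 < T.
  rewrite lt_neqAle eq_sym (le_trans D0 (le_trans DM MT)) andbT subr_eq0.
  have [<- <-] := cj; case: tmono => H.
    by have := H _ _ lolo hihi lohi; rewrite /cone_t => /gt_eqF ->.
  by have := H _ _ hihi lolo lohi; rewrite /cone_t => /lt_eqF ->.
split => //; first exact: le_trans MT.
pose S := Num.sqrt (T ^+ 2 - D ^+ 2).
have S2 : S ^+ 2 = T ^+ 2 - D ^+ 2.
  rewrite sqr_sqrtr// subr_ge0 ler_sqr ?nnegrE ?(ltW T0)//.
  exact: le_trans MT.
have S0 : 0 <= S by exact: sqrtr_ge0.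
apply/lee_addgt0Pr => e e0; rewrite -EFinD -/S.
pose r := S + e; have r0 : 0 < r by rewrite /r; lra.
(* The optimum is [(T + M) / sqrt (T^2 - M^2)]. Its denominator is replaced by the larger [r], which
   is positive even for lightlike displacements, where [S = 0]. *)
pose t := (T + M) / r.
have t0 : 0 < t by rewrite divr_gt0//; lra.
pose G x := (t * (a' x - m' x) + t^-1 * (a' x + m' x)) / 2.
have G0 x : 0 <= G x.
  by apply: le_trans (sqrt_sqrB_le_AGM (m'0 x) (ma' x) t0); exact: sqrtr_ge0.
have GE : G = (fun x => (t + t^-1) / 2 * a' x + (t^-1 - t) / 2 * m' x).
  by apply/funext => x; rewrite /G; field; rewrite gt_eqF.
have ia : mu.-integrable setT (EFin \o (fun x => (t + t^-1) / 2 * a' x)).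
  by apply: eq_integrable (integrableZl measurableT ((t + t^-1) / 2) inta').
have im : mu.-integrable setT (EFin \o (fun x => (t^-1 - t) / 2 * m' x)).
  by apply: eq_integrable (integrableZl measurableT ((t^-1 - t) / 2) intm').
have iG : mu.-integrable setT (EFin \o G).
  by rewrite GE; apply: eq_integrable (integrableD measurableT ia im).
have IG : \int[mu]_(x in `]lo c, hi c]) G x = (t * (T - M) + t^-1 * (T + M)) / 2.
  rewrite GE RintegralD//; [|exact: integrable_itv|exact: integrable_itv].
  rewrite !RintegralZl//; [|exact: integrable_itv|exact: integrable_itv].
  by rewrite -TE -/M; field; rewrite gt_eqF.
apply: (@le_trans _ _ (\int[mu]_(x in `]lo c, hi c]) (G x)%:E)%E); last first.
  rewrite -[X in (X <= _)%E]fineK; last exact: integrable_fin_num (integrable_itv _ iG).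
  rewrite lee_fin -[fine _]/(\int[mu]_(x in `]lo c, hi c]) G x) IG -/r.
  have -> : t^-1 * (T + M) = r by rewrite /t; field; rewrite !gt_eqF//; lra.
  rewrite ler_pdivrMr// (_ : r * 2 = r + r); last by ring.
  rewrite lerD2r /t mulrAC ler_pdivrMr// -expr2.
  apply: (@le_trans _ _ (S ^+ 2)); last by rewrite ler_sqr ?nnegrE /r; lra.
  rewrite S2 -(mulrC (T - M)) -subr_sqr lerD2l lerN2 ler_sqr ?nnegrE//.
  exact: le_trans DM.
pose B : set R := N `|` [set lo c; hi c].
have mlh : measurable ([set lo c; hi c] : set R).
  by apply: measurableU; exact: measurable_set1.
have mB : measurable B by apply: measurableU.
have muB : mu B = 0%E.
  rewrite /B null_set_setU//= null_set_setU//= ?lebesgue_measure_set1//.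
have mG : measurable_fun setT (EFin \o G) by exact: measurable_int iG.
(* Infinite on the null set [B], where the speed is unknown, so that the integrands compare at every
   point. *)
pose G' x : \bar R := if x \in B then +oo%E else (G x)%:E.
have mG' : measurable_fun setT G'.
  apply: measurable_fun_ifT => //; apply: (measurable_fun_bool true).
  by rewrite setTI preimage_mem_true.
apply: (@le_trans _ _ (\int[mu]_(x in `[lo c, hi c]) G' x)%E).
  apply: le_integral_ge0 => x /=; first by rewrite lee_fin sqrtr_ge0.
  rewrite in_itv/= /G' => /andP[lx xh]; case: ifPn => [_|/negP]; first exact: leey.
  rewrite inE => xB.
  have xA : x \in A.
    rewrite inE; split => /=; last by move=> Nx; apply: xB; left.
    rewrite in_itv/= !lt_neqAle lx xh !andbT; apply/andP; split.
      by apply/negP => /eqP E; apply: xB; right; left; rewrite /= E.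
    by apply/negP => /eqP E; apply: xB; right; right; rewrite /= E.
  have [h1 h2 _ _] := AP _ xA; rewrite lee_fin.
  have aa : a x = a' x by rewrite /a' indicE xA mulr1.
  have mm : m x = m' x by rewrite /m' indicE xA mulr1.
  by rewrite /cone_speed2 h1 h2 expr1n mul1r aa mm; exact: sqrt_sqrB_le_AGM.
rewrite le_eqVlt; apply/orP; left; apply/eqP.
rewrite -(@integral_itv_obnd_cbnd _ (lo c) (BRight (hi c)) G'); last exact: measurable_funTS.
apply: ae_eq_integral => //.
- exact: measurable_funTS.
- exact: measurable_funTS.
exists B; split => // x /= /not_implyP[_]; rewrite /G'.
by case: ifPn => [|/negP _ //]; rewrite inE.
Qed.

End Bound.
End ConeLength.

(** * Time separation of Lorentzian products *)

Definition geodesic (R : realType) (X : metricType R) (x y : X) (g : R -> X) :=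
  [/\ g 0 = x, g (mdist x y) = y &
    forall s t, 0 <= s -> s <= t -> t <= mdist x y -> mdist (g s) (g t) = t - s].

Definition geodesic_space (R : realType) (X : metricType R) :=
  forall x y : X, exists g, geodesic x y g.

(** [Num.sqrt] vanishes on negative numbers and [Num.max] handles reversed time, so that one
    continuous formula also covers causally unrelated points. *)
Definition minkowski_sep (R : realType) (T D : R) :=
  Num.sqrt (Num.max 0 T ^+ 2 - D ^+ 2).

Lemma minkowski_sep_ge (R : realType) (T D : R) : 0 <= D -> D <= T ->
  minkowski_sep T D = Num.sqrt (T ^+ 2 - D ^+ 2).
Proof. by move=> D0 DT; rewrite /minkowski_sep (max_idPr (le_trans D0 DT)). Qed.

Lemma minkowski_sep_eq0 (R : realType) (T D : R) : 0 <= D -> T <= D ->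
  minkowski_sep T D = 0.
Proof.
move=> D0 TD; apply: ler0_sqrtr; rewrite subr_le0 ler_sqr ?nnegrE// ?le_max ?lexx//.
by rewrite ge_max D0.
Qed.

Section StraightCurve.
Context {R : realType} (a b : R) (X : metricType R).
Local Notation I := `[a, b]%classic.
Local Notation mu := (@lebesgue_measure R).
Variables (p q : cone_space I X) (g : R -> X).
Hypothesis geo : geodesic p.2 q.2 g.
Local Notation T := (\val q.1 - \val p.1).
Local Notation D := (mdist p.2 q.2).
Hypothesis T0 : 0 < T.
Hypothesis DT : D <= T.
Local Notation k := (D / T).

(** Curves are total functions on the line: times outside [[a, b]] are sent to the default [x0]. *)
Definition to_itv (x0 : set_type I) (s : R) : set_type I := insubd x0 s.

Lemma to_itvK x0 s : a <= s -> s <= b -> \val (to_itv x0 s) = s.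
Proof.
move=> h1 h2; rewrite /to_itv insubdK//.
by change (s \in I : Prop); apply/mem_set; rewrite /= in_itv/= h1.
Qed.

Definition straight_curve : pcurve R (cone_space I X) :=
  PCurve (\val p.1) (\val q.1)
    (fun s => (to_itv p.1 s, g ((s - \val p.1) * k))).
Local Notation c := straight_curve.

Lemma val_itv (x : set_type I) : a <= \val x /\ \val x <= b.
Proof. by have := valP x; rewrite inE/= in_itv/= => /andP[]. Qed.

Lemma straight_t s : \val p.1 <= s -> s <= \val q.1 -> cone_t c s = s.
Proof.
move=> ps sq; rewrite /cone_t/= to_itvK//.
  by apply: le_trans ps; have [] := val_itv p.1.
by apply: le_trans sq _; have [] := val_itv q.1.
Qed.

Let k0 : 0 <= k. Proof. by rewrite divr_ge0 ?mdist_ge0// ltW. Qed.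
Let k1 : k <= 1. Proof. by rewrite ler_pdivrMr// mul1r. Qed.

Lemma straight_x s t : \val p.1 <= s -> s <= t -> t <= \val q.1 ->
  mdist (cone_x c s) (cone_x c t) = k * (t - s).
Proof.
move=> ps st tq; rewrite /cone_x/=; have [_ _ ->] := geo.
- ring.
- by rewrite mulr_ge0 ?subr_ge0.
- by rewrite ler_wpM2r// lerD2r.
- by rewrite mulrA ler_pdivrMr// mulrC ler_wpM2l ?mdist_ge0// lerD2r.
Qed.

Lemma straight_joins : joins c p q.
Proof.
have [gp gq _] := geo; split; rewrite /=.
  rewrite subrr mul0r gp; case: (p) => p1 p2 /=; congr pair.
  by apply: val_inj; rewrite to_itvK//; have [] := val_itv p1.
rewrite mulrC mulfVK ?gt_eqF// gq; case: (q) (p) => q1 q2 [p1 p2] /=; congr pair.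
by apply: val_inj; rewrite to_itvK//; have [] := val_itv q1.
Qed.

Lemma straight_derivatives s : \val p.1 < s -> s < \val q.1 ->
  derive1 (cone_t c) s = 1 /\ metric_derivative (cone_x c) s = k.
Proof.
move=> ps sq; split; (apply/cvg_lim; first exact: Rhausdorff).
  have c1 : (1 : R) @[h --> (0:R)^'] --> (1 : R) by exact: cvg_cst.
  apply: cvg_trans c1; apply: near_eq_cvg; apply: (cvg_dnbhs_itv ps sq) => h h1 h2 h0.
  rewrite [h + s]addrC !straight_t ?(ltW ps) ?(ltW sq)//.
  by rewrite -[RHS]/(h^-1 * (s + h - s)) addrAC subrr add0r mulVf.
have c1 : k @[h --> (0:R)^'] --> k by exact: cvg_cst.
apply: cvg_trans c1; apply: near_eq_cvg; apply: (cvg_dnbhs_itv ps sq) => h h1 h2 h0.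
have [hge|hlt] := leP 0 h.
  rewrite (metric_sym (cone_x c (s + h))) straight_x ?lerDl// ?(ltW ps)//.
  by rewrite addrAC subrr add0r ger0_norm// mulfK.
rewrite straight_x ?(ltW sq)//; last by rewrite gerDl ltW.
by rewrite opprD addNKr ltr0_norm// mulfK// oppr_eq0.
Qed.

Lemma straight_ae (P : R -> Prop) :
  (forall s, \val p.1 < s -> s < \val q.1 -> P s) ->
  {ae mu, forall s, s \in `[\val p.1, \val q.1] -> P s}.
Proof.
move=> HP; exists ([set \val p.1] `|` [set \val q.1]); split.
- by apply: measurableU; exact: measurable_set1.
- by rewrite null_set_setU//= ?lebesgue_measure_set1.
move=> s /= /not_implyP[]; rewrite in_itv/= => /andP[ps sq] nP.
have [->|h1] := eqVneq s (\val p.1); first by left.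
have [->|h2] := eqVneq s (\val q.1); first by right.
by exfalso; apply: nP; apply: HP; rewrite lt_neqAle ?ps ?sq ?h2// eq_sym h1.
Qed.

Lemma straight_fd : cone_fd_curve c.
Proof.
have pq : \val p.1 < \val q.1 by rewrite -subr_gt0.
split => //=.
- move=> e e0; exists e => // n s t st _ sd.
  apply: le_lt_trans sd; apply: ler_sum => i _; have [h1 h2 h3] := st i.
  rewrite !straight_t//; last 2 first.
  + exact: le_trans h1 h2.
  + exact: le_trans h2 h3.
  by rewrite /mdist/= ger0_norm ?subr_ge0.
- move=> e e0; exists e => // n s t st _ sd.
  apply: le_lt_trans sd; apply: ler_sum => i _; have [h1 h2 h3] := st i.
  by rewrite straight_x// ler_piMl// subr_ge0.
- left => s t; rewrite !in_itv/= => /andP[h1 h2] /andP[h3 h4] st.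
  by rewrite !straight_t.
- apply: straight_ae => s ps sq.
  by have [-> _] := straight_derivatives ps sq.
Qed.

Lemma straight_speed2 s : \val p.1 < s -> s < \val q.1 ->
  cone_speed2 (fun=> 1) c s = 1 - k ^+ 2.
Proof.
move=> ps sq; have [h1 h2] := straight_derivatives ps sq.
by rewrite /cone_speed2 h1 h2 !expr1n mul1r.
Qed.

Lemma straight_causal : cone_fd_causal (fun=> 1) c.
Proof.
split; first exact: straight_fd.
apply: straight_ae => s ps sq; rewrite straight_speed2// oppr_le0 subr_ge0.
by rewrite exprn_ile1.
Qed.

Lemma straight_timelike : D < T -> cone_fd_timelike (fun=> 1) c.
Proof.
move=> ltDT; split; first exact: straight_fd.
apply: straight_ae => s ps sq; rewrite straight_speed2// oppr_lt0 subr_gt0.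
by rewrite exprn_ilt1// ltr_pdivrMr// mul1r.
Qed.

Lemma straight_length :
  ((Num.sqrt (T ^+ 2 - D ^+ 2))%:E <= cone_length (fun=> 1%R) c)%E.
Proof.
have pq : \val p.1 < \val q.1 by rewrite -subr_gt0.
set K := Num.sqrt (1 - k ^+ 2).
have -> : Num.sqrt (T ^+ 2 - D ^+ 2) = K * T.
  rewrite /K -[X in _ * X](ger0_norm (ltW T0)) -sqrtr_sqr -sqrtrM.
    by congr Num.sqrt; field; rewrite gt_eqF.
  by rewrite subr_ge0 exprn_ile1.
have KE : (\int[mu]_(x in `[\val p.1, \val q.1]) ((cst K%:E)
    \_ `]\val p.1, \val q.1[%classic) x)%E = (K * T)%:E.
  rewrite -integral_mkcondr setIidr; last exact: subset_itv_oo_cc.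
  by rewrite integral_cst//= lebesgue_measure_itv/= lte_fin pq -EFinM.
rewrite -KE; apply: le_integral_ge0 => x /=; rewrite in_itv/= => /andP[px xq].
  by rewrite patchE; case: ifP => // _; rewrite lee_fin sqrtr_ge0.
rewrite patchE; case: ifPn => [|_]; last by rewrite lee_fin sqrtr_ge0.
by rewrite inE/= in_itv/= => /andP[h1 h2]; rewrite straight_speed2.
Qed.

End StraightCurve.

(* [(tau, pos)] exhibit [Y] as a part of the Lorentzian product of the line with
   [Z]; this covers both [I x_1 X] and the Minkowski plane. *)
Record lorentz_coordinates (R : realType) (Y : lorentz_data R) (Z : metricType R)
    (tau : Y -> R) (pos : Y -> Z) : Prop := LorentzCoordinates {
  coord_dist : forall p q,
    mdist p q = `|tau p - tau q| + mdist (pos p) (pos q);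
  coord_caus : forall p q,
    caus p q <-> mdist (pos p) (pos q) <= tau q - tau p;
  coord_tsep : forall p q, tsep p q =
    (minkowski_sep (tau q - tau p) (mdist (pos p) (pos q)))%:E }.

Section ConeCoordinates.
Context {R : realType} (a b : R) (X : metricType R).
Hypothesis geoX : geodesic_space X.
Local Notation Y := (lorentz_product `[a, b]%classic X).
Implicit Types p q : Y.

Lemma cone_chron_lt p q : mdist p.2 q.2 < \val q.1 - \val p.1 -> chron p q.
Proof.
move=> DT; have [g geo] := geoX p.2 q.2.
exists (straight_curve p q g); last exact: straight_joins geo (le_lt_trans (mdist_ge0 _ _) DT).
exact: straight_timelike geo (le_lt_trans (mdist_ge0 _ _) DT) (ltW DT) DT.
Qed.

Lemma cone_causal_exists p q : 0 < \val q.1 - \val p.1 ->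
  mdist p.2 q.2 <= \val q.1 - \val p.1 ->
  exists2 c, (cone_fd_causal (fun=> 1) c /\ joins c p q) &
    ((minkowski_sep (\val q.1 - \val p.1) (mdist p.2 q.2))%:E
      <= cone_length (fun=> 1%R) c)%E.
Proof.
move=> T0 DT; have [g geo] := geoX p.2 q.2.
exists (straight_curve p q g).
  split; [exact: straight_causal geo T0 DT|exact: straight_joins geo T0].
by rewrite minkowski_sep_ge ?mdist_ge0//; exact: straight_length geo T0 DT.
Qed.

(** [fd_causal_bounds] bounds the length of every causal curve, and the straight curve over a
    geodesic attains the bound. *)
Lemma cone_coordinates :
  @lorentz_coordinates R Y X (fun p => \val p.1) (fun p => p.2).
Proof.
split=> [//|p q|p q].
  split=> [[->|[c cc cj]]|DT].
  - by rewrite mdistxx subrr.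
  - by have [_ ? _] := fd_causal_bounds cc cj.
  - have [T0|T0] := ltP 0 (\val q.1 - \val p.1).
      by have [c [cc cj] _] := cone_causal_exists T0 DT; right; exists c.
    (* Nonpositive elapsed time together with [DT] forces [p = q], the reflexive case of [caus]. *)
    left; have TD0 : mdist p.2 q.2 = 0.
      by apply/eqP; rewrite eq_le mdist_ge0 andbT (le_trans DT).
    have T00 : \val q.1 - \val p.1 = 0.
      by apply/eqP; rewrite eq_le T0/= -TD0.
    case: p q TD0 T00 {T0 DT} => [p1 p2] [q1 q2] /= /mdist_positivity -> /eqP.
    by rewrite subr_eq0 => /eqP/val_inj ->.
rewrite /tsep/= /cone_tsep; case: ifPn => [/asboolP[c0 cc0 cj0]|/asboolPn nex].
  have [T0 DT _] := fd_causal_bounds cc0 cj0.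
  apply/eqP; rewrite eq_le; apply/andP; split.
    apply: ge_ereal_sup => _ [c [cc cj] <-].
    by rewrite minkowski_sep_ge ?mdist_ge0//; have [] := fd_causal_bounds cc cj.
  have [c ccj Lc] := cone_causal_exists T0 DT.
  by apply: le_trans Lc _; apply: ereal_sup_ubound; exists c.
have [T0|T0] := ltP 0 (\val q.1 - \val p.1); last first.
  by rewrite minkowski_sep_eq0 ?mdist_ge0 ?(le_trans T0) ?mdist_ge0.
have [DT|TD] := leP (mdist p.2 q.2) (\val q.1 - \val p.1); last first.
  by rewrite minkowski_sep_eq0 ?mdist_ge0// ltW.
by exfalso; have [c [cc cj] _] := cone_causal_exists T0 DT; apply: nex; exists c.
Qed.

End ConeCoordinates.

Section MinkowskiCoordinates.
Context {R : realType}.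

Lemma mink_coordinates : @lorentz_coordinates R (minkowski2 R) R^o
  (fun p : mink_plane R => p.1) (fun p : mink_plane R => p.2).
Proof.
split=> [p q|//|p q].
  by congr (_ + _); rewrite [RHS]distrC.
rewrite /tsep/= /mink_tsep; case: ifPn => /asboolP; rewrite /mink_caus => H.
  by rewrite minkowski_sep_ge ?mdist_ge0// /mdist/= real_normK ?num_real.
by rewrite minkowski_sep_eq0 ?mdist_ge0//; apply: ltW; rewrite ltNge; apply/negP.
Qed.

End MinkowskiCoordinates.

(** Reverse Cauchy-Schwarz inequality for causal vectors of the plane: the squares of the two sides
    differ by [(T1 * D2 - T2 * D1) ^+ 2]. *)
Lemma lorentz_cauchy_schwarz (R : realType) (T1 T2 D1 D2 t1 t2 : R) :
  0 <= D1 -> D1 <= T1 -> 0 <= D2 -> D2 <= T2 -> 0 <= t1 -> 0 <= t2 ->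
  t1 ^+ 2 = T1 ^+ 2 - D1 ^+ 2 -> t2 ^+ 2 = T2 ^+ 2 - D2 ^+ 2 ->
  t1 * t2 <= T1 * T2 - D1 * D2.
Proof.
move=> d1 h1 d2 h2 s1 s2 e1 e2.
have q0 : 0 <= T1 * T2 - D1 * D2 by rewrite subr_ge0 ler_pM.
rewrite -ler_sqr ?nnegrE ?mulr_ge0// exprMn e1 e2 -subr_ge0.
have := sqr_ge0 (T1 * D2 - T2 * D1) => /le_trans; apply.
by rewrite le_eqVlt; apply/orP; left; apply/eqP; ring.
Qed.

(** * Reverse triangle inequality and maximal curves *)

Section Coordinates.
Context {R : realType} (Y : lorentz_data R) (Z : metricType R).
Variables (tau : Y -> R) (pos : Y -> Z).
Hypothesis coordY : lorentz_coordinates tau pos.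
Implicit Types (c : pcurve R Y) (p q x y : Y).
Local Notation d p q := (mdist (pos p) (pos q)).

Definition sep p q : R := minkowski_sep (tau q - tau p) (d p q).

Lemma tsepE p q : tsep p q = (sep p q)%:E.
Proof. exact: coord_tsep. Qed.

Lemma sep_ge0 p q : 0 <= sep p q. Proof. exact: sqrtr_ge0. Qed.

Lemma sep_sqr p q : d p q <= tau q - tau p ->
  sep p q ^+ 2 = (tau q - tau p) ^+ 2 - d p q ^+ 2.
Proof.
move=> h; rewrite /sep minkowski_sep_ge ?mdist_ge0// sqr_sqrtr//.
by rewrite subr_ge0 ler_sqr ?nnegrE ?mdist_ge0// (le_trans (mdist_ge0 _ _) h).
Qed.

Lemma sep_gt0 p q : 0 < sep p q -> d p q < tau q - tau p.
Proof.
by move=> s0; rewrite ltNge; apply/negP => h; move: s0;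
  rewrite /sep minkowski_sep_eq0 ?mdist_ge0// ltxx.
Qed.

Lemma sep_pos p q : d p q < tau q - tau p -> 0 < sep p q.
Proof.
move=> h; rewrite /sep minkowski_sep_ge ?mdist_ge0 ?(ltW h)// sqrtr_gt0 subr_gt0.
by rewrite ltr_sqr ?nnegrE ?mdist_ge0// ltW// (le_lt_trans (mdist_ge0 _ _) h).
Qed.

(** The separation along such a curve is proportional to the parameter, so all partitions have the
    same sum. Serves for the straight curves of the product and for the segments of the Minkowski
    plane. *)
Lemma uniform_curve_maximal c h k : lo c < hi c -> 0 < h -> 0 <= k -> k <= h ->
  (forall s t, lo c <= s -> s <= t -> t <= hi c ->
     tau (cmap c t) - tau (cmap c s) = h * (t - s) /\
     d (cmap c s) (cmap c t) = k * (t - s)) ->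
  maximal_curve c.
Proof.
move=> lohi h0 k0 kh H.
have sepE s t : lo c <= s -> s <= t -> t <= hi c ->
    sep (cmap c s) (cmap c t) = Num.sqrt (h ^+ 2 - k ^+ 2) * (t - s).
  move=> ls st th; have [h1 h2] := H _ _ ls st th.
  rewrite /sep h1 h2 minkowski_sep_ge ?mulr_ge0 ?subr_ge0//; last first.
    by rewrite ler_wpM2r// subr_ge0.
  rewrite !exprMn -mulrBl sqrtrM ?sqrtr_sqr ?ger0_norm ?subr_ge0//.
  by rewrite ler_sqr ?nnegrE// ltW.
split; first split => //.
- move=> s _; exists 1, (h + k); split => // u v.
  rewrite !in_itv/= => /andP[lu uh] /andP[lv vh] _ _.
  rewrite (coord_dist coordY) mulrDl; have [uv|/ltW vu] := leP u v.
    have [h1 h2] := H _ _ lu uv vh.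
    rewrite h2 -normrN opprB h1 normrM (ger0_norm (ltW h0)).
    by rewrite (distrC u) (@ger0_norm _ (v - u))// subr_ge0.
  have [h1 h2] := H _ _ lv vu uh.
  rewrite metric_sym h2 h1 normrM (ger0_norm (ltW h0)).
  by rewrite (@ger0_norm _ (u - v))// subr_ge0.
- move=> s t ls st th [y Hy].
  have [h1 _] := H _ _ ls (ltW st) th.
  have Es : cmap c s = y by apply: Hy; rewrite in_itv/= lexx ltW.
  have Et : cmap c t = y by apply: Hy; rewrite in_itv/= lexx ltW.
  move: h1; rewrite Es Et subrr => /esym/eqP; rewrite mulf_eq0 subr_eq0.
  by rewrite (gt_eqF h0) (gt_eqF st).
- move=> s t ls st th; apply/(coord_caus coordY).
  have [-> ->] := H _ _ ls (ltW st) th.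
  by rewrite ler_wpM2r// subr_ge0 ltW.
have part s : itv_partition (lo c) (hi c) s ->
  (\sum_(0 <= i < size s) tsep (cmap c (nth (hi c) (lo c :: s) i))
     (cmap c (nth (hi c) (lo c :: s) i.+1)))%E =
  tsep (cmap c (lo c)) (cmap c (hi c)).
  move=> [ps /eqP ls].
  rewrite tsepE sepE ?lexx ?ltW//.
  have -> : hi c - lo c = \sum_(0 <= i < size s)
     (nth (hi c) (lo c :: s) i.+1 - nth (hi c) (lo c :: s) i).
    rewrite telescope_sumr//= -[size s]/(size (lo c :: s)).-1 nth_last/= ls.
    by [].
  rewrite mulr_sumr -sumEFin !big_nat; apply: eq_bigr => i /andP[_ iS].
  have srt : sorted <=%R (lo c :: s) by apply: sub_sorted (ps : sorted <%R (lo c :: s)) => u v /ltW.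
  have nl j k' : (j <= k')%N -> (k' <= size s)%N ->
     nth (hi c) (lo c :: s) j <= nth (hi c) (lo c :: s) k'.
    move=> jk ks; apply: (@le_sorted_leq_nth _ _ (hi c) _ srt) => //.
    by rewrite inE/= ltnS (leq_trans jk).
  rewrite tsepE sepE//.
  - exact: (nl 0%N i isT (ltnW iS)).
  - exact: (nl i i.+1 (leqnSn _) iS).
  - have := nl i.+1 (size s) iS (leqnn _).
    by rewrite -[size s in X in _ <= X -> _]/(size (lo c :: s)).-1 nth_last/= ls.
rewrite /tsep_length; set S := [set _ | _ in _].
have -> : S = [set tsep (cmap c (lo c)) (cmap c (hi c))].
  apply/seteqP; split => [_ [s ps <-]|_ ->]; first exact: part.
  exists [:: hi c]; last by apply: part; split => //=; rewrite ?lohi.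
  by split => //=; rewrite lohi.
by rewrite ereal_inf1.
Qed.

Lemma sep_triangle x p y : d x p <= tau p - tau x -> d p y <= tau y - tau p ->
  sep x p + sep p y <= sep x y.
Proof.
move=> h1 h2; have h3 := metric_triangle (pos x) (pos p) (pos y).
have h : d x y <= tau y - tau x by lra.
rewrite -ler_sqr ?nnegrE ?addr_ge0 ?sep_ge0// (sep_sqr h) sqrrD !sep_sqr//.
have d1 := mdist_ge0 (pos x) (pos p); have d2 := mdist_ge0 (pos p) (pos y).
have d3 := mdist_ge0 (pos x) (pos y).
have prod : sep x p * sep p y <=
    (tau p - tau x) * (tau y - tau p) - d x p * d p y.
  by apply: lorentz_cauchy_schwarz; rewrite ?sep_ge0 ?mdist_ge0 ?sep_sqr.
have : d x y ^+ 2 <= (d x p + d p y) ^+ 2 by rewrite ler_sqr ?nnegrE ?addr_ge0.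
by move: prod; rewrite !expr2; nra.
Qed.

(** The partition at [p] bounds the length from above by [sep x p + sep p y]; maximality and the
    reverse triangle inequality make this an equality. *)
Lemma maximal_curve_sep c p x y : maximal_curve c -> joins c x y -> trace c p ->
  [/\ d x p <= tau p - tau x, d p y <= tau y - tau p &
      sep x p + sep p y = sep x y].
Proof.
move=> [[lohi _ _ cc] Lc] [cx cy] [s /= + sp]; rewrite in_itv/= => /andP[ls sh].
have xx z : d z z <= tau z - tau z by rewrite mdistxx subrr.
have sep0 z : sep z z = 0 by rewrite /sep minkowski_sep_eq0 ?mdist_ge0// subrr mdistxx.
have caus_xy : d x y <= tau y - tau x.
  by rewrite -cx -cy; apply/(coord_caus coordY); exact: cc.
(* End points are treated apart, since partitions and the causal relation along a curve ask for
   strictly increasing parameters. *)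
have [ls_eq|ls_ne] := eqVneq (lo c) s.
  have -> : p = x by rewrite -sp -ls_eq cx.
  by rewrite sep0 add0r; split => //; exact: xx.
have [sh_eq|sh_ne] := eqVneq s (hi c).
  have -> : p = y by rewrite -sp sh_eq cy.
  by rewrite sep0 addr0; split => //; exact: xx.
have lts : lo c < s by rewrite lt_neqAle ls_ne.
have lth : s < hi c by rewrite lt_neqAle sh_ne.
have h1 : d x p <= tau p - tau x.
  by rewrite -cx -sp; apply/(coord_caus coordY); exact: cc.
have h2 : d p y <= tau y - tau p.
  by rewrite -sp -cy; apply/(coord_caus coordY); exact: cc.
split => //; apply/eqP; rewrite eq_le sep_triangle//=.
rewrite -lee_fin EFinD -!tsepE -cx -cy -Lc -sp; apply: ereal_inf_lbound.
exists [:: s; hi c]; first by split => //=; rewrite lts lth.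
by rewrite /= big_nat_recl// big_nat1.
Qed.

(** Position [l] on a straight segment from [x] to [y], expressed by distances since [Z] has no
    linear structure. *)
Definition affine_on x y l p := [/\ tau p = (1 - l) * tau x + l * tau y,
  d x p = l * d x y & d p y = (1 - l) * d x y].

(** Equality in the reverse triangle inequality forces equality in [lorentz_cauchy_schwarz] and in
    the triangle inequality of [Z]: the displacements [(T1, D1)] and [(T2, D2)] are parallel ([par])
    and [pos p] lies between [pos x] and [pos y]. *)
Lemma sep_triangle_eq x p y : d x p <= tau p - tau x -> d p y <= tau y - tau p ->
  0 < sep x y -> sep x p + sep p y = sep x y ->
  affine_on x y (sep x p / sep x y) p.
Proof.
move=> h1 h2 s0 se; have h3 := metric_triangle (pos x) (pos p) (pos y).
have h : d x y <= tau y - tau x by lra.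
have d1 := mdist_ge0 (pos x) (pos p); have d2 := mdist_ge0 (pos p) (pos y).
have d3 := mdist_ge0 (pos x) (pos y).
have s1 := sep_ge0 x p; have s2 := sep_ge0 p y.
have e1 := sep_sqr h1; have e2 := sep_sqr h2; have e3 := sep_sqr h.
rewrite /affine_on.
set l := sep x p / sep x y.
have le : sep x p = l * sep x y by rewrite /l divfK// gt_eqF.
move: h1 h2 h3 h s0 se d1 d2 d3 s1 s2 e1 e2 e3 le.
set T1 := tau p - tau x; set T2 := tau y - tau p.
have -> : tau y - tau x = T1 + T2 by rewrite /T1 /T2; lra.
have -> : tau p = tau x + T1 by rewrite /T1; lra.
have -> : tau y = tau x + (T1 + T2) by rewrite /T1 /T2; lra.
move: (d x p) (d p y) (d x y) (sep x p) (sep p y) (sep x y) T1 T2 l (tau x).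
move=> D1 D2 D t1 t2 t T1 T2 l tx h1 h2 h3 h s0 se d1 d2 d3 s1 s2 e1 e2 e3 le.
have x0 : t1 * t2 <= T1 * T2 - D1 * D2 by exact: lorentz_cauchy_schwarz.
(* The square of [se]. The last term is nonnegative by [x0], while [D <= D1 + D2]; so both
   inequalities are equalities. *)
have DE2 : D ^+ 2 = (D1 + D2) ^+ 2 + 2 * (T1 * T2 - D1 * D2 - t1 * t2).
  have : (t1 + t2) ^+ 2 = t ^+ 2 by rewrite se.
  rewrite e3 sqrrD e1 e2 => ee.
  by rewrite -[D ^+ 2]opprK -(addKr ((T1 + T2) ^+ 2) (- D ^+ 2)) -ee; ring.
have D12 : D ^+ 2 <= (D1 + D2) ^+ 2 by rewrite ler_sqr ?nnegrE ?addr_ge0.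
have xE : t1 * t2 = T1 * T2 - D1 * D2 by lra.
have DE : D = D1 + D2.
  apply/eqP; rewrite -(@eqrXn2 _ 2)// ?addr_ge0//; apply/eqP; lra.
have par : T1 * D2 = T2 * D1.
  apply/eqP; rewrite -subr_eq0 -sqrf_eq0; apply/eqP.
  have : (t1 * t2) ^+ 2 = (T1 * T2 - D1 * D2) ^+ 2 by rewrite xE.
  rewrite exprMn e1 e2 => ee.
  transitivity ((T1 * T2 - D1 * D2) ^+ 2 - (T1 ^+ 2 - D1 ^+ 2) * (T2 ^+ 2 - D2 ^+ 2)).
    by ring.
  by rewrite ee subrr.
have T0 : 0 < T1 + T2.
  rewrite lt_neqAle eq_sym (le_trans d3 h) andbT; apply/eqP => T00.
  have D00 : D = 0 by apply/eqP; rewrite eq_le d3 andbT -T00.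
  by have : 0 < t ^+ 2; [rewrite exprn_gt0|rewrite e3 T00 D00 subrr ltxx].
have D1T : D1 * (T1 + T2) = T1 * D by rewrite DE !mulrDr par; ring.
have T1E : T1 = l * (T1 + T2).
  apply/eqP; rewrite -(inj_eq (mulIf (lt0r_neq0 s0))); apply/eqP.
  rewrite mulrAC -le.
  have T10 : 0 <= T1 := le_trans d1 h1.
  apply/eqP; rewrite -(@eqrXn2 _ 2) ?mulr_ge0 ?(ltW T0) ?(ltW s0)//; apply/eqP.
  rewrite !exprMn e1 e3 mulrBr mulrBl; congr (_ - _).
  by rewrite -!exprMn D1T.
have D1E : D1 = l * D.
  apply: (mulIf (lt0r_neq0 T0)); rewrite D1T {1}T1E; ring.
by split; [lra|exact: D1E|lra].
Qed.

(** Unlike [sep], polynomial in the coordinates, symmetric, and informative also for spacelike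
    pairs, where it is negative. *)
Definition sqsep p q := (tau q - tau p) ^+ 2 - d p q ^+ 2.

Lemma sqsepC p q : sqsep p q = sqsep q p.
Proof. by rewrite /sqsep (metric_sym (pos p)) -(sqrrN (tau q - tau p)) opprB. Qed.

Lemma sqsepxx p : sqsep p p = 0.
Proof. by rewrite /sqsep mdistxx !subrr. Qed.

End Coordinates.

Section StraightMaximal.
Context {R : realType} (a b : R) (X : metricType R).
Hypothesis geoX : geodesic_space X.
Local Notation Y := (lorentz_product `[a, b]%classic X).
Local Notation tau := (fun p : Y => \val p.1).
Local Notation pos := (fun p : Y => p.2).
Let coordY : @lorentz_coordinates R Y X tau pos := cone_coordinates a b geoX.

Lemma straight_maximal (p q : Y) g : geodesic p.2 q.2 g ->
  0 < \val q.1 - \val p.1 -> mdist p.2 q.2 <= \val q.1 - \val p.1 ->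
  @maximal_curve R Y (straight_curve p q g).
Proof.
move=> geo T0 DT.
apply: (uniform_curve_maximal coordY (h := 1)
  (k := mdist p.2 q.2 / (\val q.1 - \val p.1))) => //=.
- by rewrite -subr_gt0.
- by rewrite divr_ge0 ?mdist_ge0// ltW.
- by rewrite ler_pdivrMr// mul1r.
- move=> s t ps st tq; split; last exact: (straight_x geo T0 ps st tq).
  rewrite mul1r; have := @straight_t R a b X p q g; rewrite /cone_t /= => H.
  by rewrite !H//; [exact: le_trans st tq|exact: le_trans ps st].
Qed.

Lemma straight_trace (p q z : Y) g : geodesic p.2 q.2 g -> 0 < \val q.1 - \val p.1 ->
  trace (straight_curve p q g) z ->
  [/\ \val p.1 <= \val z.1, \val z.1 <= \val q.1 & mdist p.2 z.2 <= mdist p.2 q.2].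
Proof.
move=> geo T0 [s /= + <-]; rewrite in_itv/= => /andP[ps sq].
have e := @straight_t R a b X p q g s ps sq; rewrite /cone_t/= in e; rewrite /= e.
split => //; have [g0 _ _] := geo.
have := straight_x geo T0 (lexx _) ps sq; rewrite /cone_x/= subrr mul0r g0 => ->.
by rewrite mulrAC ler_pdivrMr// ler_wpM2l ?mdist_ge0// lerD2r.
Qed.

Lemma straight_point (p q : Y) g l : geodesic p.2 q.2 g ->
  0 < \val q.1 - \val p.1 -> 0 <= l -> l <= 1 ->
  exists2 z, trace (straight_curve p q g) z &
    \val z.1 = \val p.1 + l * (\val q.1 - \val p.1) /\ z.2 = g (l * mdist p.2 q.2).
Proof.
move=> geo T0 l0 l1; set t := \val p.1 + _.
have pt : \val p.1 <= t by rewrite lerDl mulr_ge0// ltW.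
have tq : t <= \val q.1 by rewrite -lerBrDl ler_piMl// ltW.
exists (cmap (straight_curve p q g) t); first by exists t => //=; rewrite in_itv/= pt.
split; first exact: (straight_t g pt tq).
rewrite /=; congr g; rewrite /t addrAC subrr add0r -mulrA; congr (_ * _).
by rewrite mulrCA divff ?mulr1// gt_eqF.
Qed.

End StraightMaximal.

(** * From Stewart's inequality to timelike curvature *)

(* Stewart's theorem as an inequality: comparison of a point on a side with the
   opposite vertex in nonnegative curvature. *)
Definition stewart (R : realType) (Z : metricType R) := forall x y z m : Z,
  mdist x m + mdist m y = mdist x y ->
  mdist m y * mdist z x ^+ 2 + mdist x m * mdist z y ^+ 2 <=
  mdist x y * (mdist z m ^+ 2 + mdist x m * mdist m y).

Lemma ler_ofB (R : numDomainType) (a b c d : R) :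
  b - a = d - c -> a <= b -> c <= d.
Proof. by move=> e; rewrite -subr_ge0 e subr_ge0. Qed.

Section StewartSep.
Context {R : realType} (Y : lorentz_data R) (Z : metricType R).
Variables (tau : Y -> R) (pos : Y -> Z).
Hypothesis stZ : stewart Z.
Local Notation Q := (sqsep tau pos).

(** Times are affine along the segment and satisfy Stewart's theorem as an identity; squared
    distances enter with a minus sign, which reverses Stewart's inequality of [Z]. *)
Lemma stewart_sqsep (x y z m : Y) l : 0 <= l -> l <= 1 ->
  affine_on tau pos x y l m ->
  Q z m <= (1 - l) * Q z x + l * Q z y - l * (1 - l) * Q x y.
Proof.
move=> l0 l1 [tm dxm dmy].
suff h : (1 - l) * mdist (pos z) (pos x) ^+ 2 + l * mdist (pos z) (pos y) ^+ 2 <=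
    mdist (pos z) (pos m) ^+ 2 + l * (1 - l) * mdist (pos x) (pos y) ^+ 2.
  by apply: (ler_ofB _ h); rewrite /sqsep tm; ring.
(* Stewart's inequality carries a common factor [mdist (pos x) (pos y)], which is cancelled in the
   main case. *)
have [D0|D0] := eqVneq (mdist (pos x) (pos y)) 0.
  have xm : pos x = pos m by apply: mdist_positivity; rewrite dxm D0 mulr0.
  have my : pos m = pos y by apply: mdist_positivity; rewrite dmy D0 mulr0.
  by rewrite xm my mdistxx expr0n/= mulr0 addr0 -mulrDl subrK mul1r.
have Dp : 0 < mdist (pos x) (pos y) by rewrite lt_neqAle eq_sym D0 mdist_ge0.
have := @stZ (pos x) (pos y) (pos z) (pos m).
rewrite dxm dmy -mulrDl addrCA subrr addr0 mul1r => /(_ erefl) h.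
rewrite -(ler_pM2l Dp); apply: (ler_ofB _ h); ring.
Qed.
End StewartSep.

Section MinkowskiStewart.
Context {R : realType}.
Local Notation tau := (fun p : mink_plane R => p.1).
Local Notation pos := (fun p : mink_plane R => p.2 : R^o).
Local Notation Q := (@sqsep R (minkowski2 R) R^o tau pos).

Lemma real_affine (x y m l : R) : 0 <= l -> l <= 1 ->
  `|m - x| = l * `|y - x| -> `|y - m| = (1 - l) * `|y - x| ->
  m = (1 - l) * x + l * y.
Proof.
move=> l0 l1; have [xy|yx] := leP x y.
  rewrite (@ger0_norm _ (y - x)) ?subr_ge0// => h1 h2.
  have : m - x = l * (y - x) by case: (ler0P (m - x)) h1; case: (ler0P (y - m)) h2; nra.
  lra.
rewrite (@ltr0_norm _ (y - x)) ?subr_lt0// => h1 h2.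
have : m - x = l * (y - x) by case: (ler0P (m - x)) h1; case: (ler0P (y - m)) h2; nra.
lra.
Qed.

Lemma mink_sqsep (x y z m : mink_plane R) l : 0 <= l -> l <= 1 ->
  @affine_on R (minkowski2 R) R^o tau pos x y l m ->
  Q z m = (1 - l) * Q z x + l * Q z y - l * (1 - l) * Q x y.
Proof.
move=> l0 l1 [tm dxm dmy]; have pm := real_affine l0 l1 dxm dmy.
by rewrite /sqsep tm /mdist/= !real_normK ?num_real// pm; ring.
Qed.
End MinkowskiStewart.

(** * Comparison of triangles with the Minkowski plane *)

Section ComparisonTransfer.
Context {R : realType} (Y : lorentz_data R) (Z : metricType R).
Variables (tau : Y -> R) (pos : Y -> Z).
Hypothesis coordY : lorentz_coordinates tau pos.
Hypothesis stZ : stewart Z.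
Local Notation M := (minkowski2 R).
Local Notation tauM := (fun p : mink_plane R => p.1).
Local Notation posM := (fun p : mink_plane R => p.2 : R^o).
Local Notation Q := (sqsep tau pos).
Local Notation QM := (@sqsep R M R^o tauM posM).
Local Notation s := (sep tau pos).
Local Notation sM := (@sep R M R^o tauM posM).
Local Notation le p q := (mdist (pos p) (pos q) <= tau q - tau p).
Local Notation leM p q := (mdist (posM p) (posM q) <= tauM q - tauM p).
Let coordM : @lorentz_coordinates R M R^o tauM posM := mink_coordinates.

(** What the correspondence of [p] and [p'] yields. The common parameter [l] lets Stewart's
    relations in [Y] and in the plane be compared term by term. *)
Record side_pair (A B p : Y) (A' B' p' : M) : Prop := SidePair {
  sp_Ap : le A p; sp_pB : le p B;
  sp_Ap' : leM A' p'; sp_pB' : leM p' B';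
  sp_eqA : s A p = sM A' p'; sp_eqB : s p B = sM p' B';
  sp_lam : exists l, [/\ 0 <= l, l <= 1, affine_on tau pos A B l p
                       & @affine_on R M R^o tauM posM A' B' l p'] }.

(** A point of a maximal curve is affine with parameter [s A p / s A B], a ratio of separations,
    hence the same for [p']. *)
Lemma corresponding_side_pair (c : pcurve R Y) (c' : pcurve R M) A B A' B' p p' :
  maximal_curve c -> joins c A B -> maximal_curve c' -> joins c' A' B' ->
  tsep A B = tsep A' B' -> 0 < sM A' B' ->
  corresponding_on c c' p p' -> side_pair A B p A' B' p'.
Proof.
move=> mc jc mc' jc' + s0 [tp tp']; rewrite (tsepE coordY) (tsepE coordM) => -[sAB].
have [-> ->] := jc; have [-> ->] := jc'.
rewrite !(tsepE coordY) !(tsepE coordM) => -[sAp] [spB].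
have [h1 h2 e1] := maximal_curve_sep coordY mc jc tp.
have [h1' h2' e1'] := maximal_curve_sep coordM mc' jc' tp'.
split => //; exists (s A p / s A B); split.
- by rewrite divr_ge0 ?sep_ge0.
- by rewrite ler_pdivrMr ?mul1r ?sAB// -sAB -e1 lerDl sep_ge0.
- by apply: sep_triangle_eq => //; rewrite sAB.
- by rewrite sAp sAB; apply: sep_triangle_eq.
Qed.

(** Stewart's inequality is used for [p] on [A B], seen from [C] and [D], then for [q] on [C D],
    seen from [p]; in the Minkowski plane the same steps are identities. *)
Lemma side_pair_sqsep A B p A' B' p' C D q C' D' q' :
  side_pair A B p A' B' p' -> side_pair C D q C' D' q' ->
  Q A B = QM A' B' -> Q C D = QM C' D' ->
  Q A C = QM A' C' -> Q A D = QM A' D' -> Q B C = QM B' C' -> Q B D = QM B' D' ->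
  Q p q <= QM p' q'.
Proof.
move=> [_ _ _ _ _ _ [l [l0 l1 al al']]] [_ _ _ _ _ _ [k [k0 k1 ak ak']]].
move=> eAB eCD eAC eAD eBC eBD.
have h1 := stewart_sqsep stZ p k0 k1 ak.
have h2 := stewart_sqsep stZ C l0 l1 al.
have h3 := stewart_sqsep stZ D l0 l1 al.
have g1 := mink_sqsep p' k0 k1 ak'.
have g2 := mink_sqsep C' l0 l1 al'.
have g3 := mink_sqsep D' l0 l1 al'.
have hC : Q p C <= QM p' C'.
  rewrite (sqsepC _ _ p) (@sqsepC _ M _ _ _ p') g2.
  rewrite (@sqsepC _ M _ _ _ C' A') (@sqsepC _ M _ _ _ C' B') -eAB -eAC -eBC.
  by rewrite -(sqsepC _ _ C A) -(sqsepC _ _ C B).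
have hD : Q p D <= QM p' D'.
  rewrite (sqsepC _ _ p) (@sqsepC _ M _ _ _ p') g3.
  rewrite (@sqsepC _ M _ _ _ D' A') (@sqsepC _ M _ _ _ D' B') -eAB -eAD -eBD.
  by rewrite -(sqsepC _ _ D A) -(sqsepC _ _ D B).
apply: le_trans h1 _; rewrite g1 -eCD lerD2r lerD// ler_wpM2l ?subr_ge0//.
Qed.

End ComparisonTransfer.

Section ForwardCurvature.
Context {R : realType} (Y : lorentz_data R) (Z : metricType R).
Variables (tau : Y -> R) (pos : Y -> Z).
Hypothesis coordY : lorentz_coordinates tau pos.
Hypothesis stZ : stewart Z.
Local Notation M := (minkowski2 R).
Local Notation tauM := (fun p : mink_plane R => p.1).
Local Notation posM := (fun p : mink_plane R => p.2 : R^o).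
Local Notation Q := (sqsep tau pos).
Local Notation QM := (@sqsep R M R^o tauM posM).
Local Notation s := (sep tau pos).
Local Notation sM := (@sep R M R^o tauM posM).
Local Notation le p q := (mdist (pos p) (pos q) <= tau q - tau p).
Local Notation leM p q := (mdist (posM p) (posM q) <= tauM q - tauM p).
Let coordM : @lorentz_coordinates R M R^o tauM posM := mink_coordinates.

Lemma sep_eq_sqsep (A B : Y) (A' B' : M) : s A B = sM A' B' -> 0 < sM A' B' ->
  Q A B = QM A' B'.
Proof.
move=> e s0; rewrite /sqsep -!sep_sqr ?e//; first exact/ltW/sep_gt0.
by apply/ltW/sep_gt0; rewrite e.
Qed.

(** A positive [sqsep] does not tell which of [p'] and [q'] comes first, whence the second
    hypothesis. *)
Lemma sqsep_sep (p q : Y) (p' q' : M) : Q p q <= QM p' q' ->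
  (0 < s p q -> 0 <= tauM q' - tauM p') -> s p q <= sM p' q'.
Proof.
move=> QQ H; have [s0|s0] := ltP 0 (s p q); last first.
  by apply: le_trans s0 _; exact: sep_ge0.
have lt1 := sep_gt0 s0; have T0 := H s0.
have Q0 : 0 < QM p' q'.
  apply: lt_le_trans QQ; rewrite /sqsep subr_gt0 ltr_sqr ?nnegrE ?mdist_ge0//.
  by apply: ltW; apply: le_lt_trans lt1; exact: mdist_ge0.
have le' : leM p' q'.
  rewrite -ler_sqr ?nnegrE ?mdist_ge0// -subr_ge0; exact: ltW.
rewrite -ler_sqr ?nnegrE ?sep_ge0// (sep_sqr (ltW lt1)) (@sep_sqr _ M _ _ _ _ _ le').
exact: QQ.
Qed.

(* If [q'] preceded [p'], the reverse triangle inequality from the common vertex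
   would contradict [p << q]. *)
Lemma sqsep_pos_order (p q : Y) (p' q' : M) : 0 < s p q -> Q p q <= QM p' q' ->
  (exists A A', [/\ le A p, leM A' q', s A p = sM A' p' & s A q = sM A' q']) \/
  (exists B B', [/\ le q B, leM p' B', s p B = sM p' B' & s q B = sM q' B']) ->
  0 <= tauM q' - tauM p'.
Proof.
move=> s0 QQ H; rewrite leNgt; apply/negP => T0.
have lt1 := sep_gt0 s0.
have Q0 : 0 < QM q' p'.
  rewrite sqsepC; apply: lt_le_trans QQ; rewrite /sqsep subr_gt0 ltr_sqr ?nnegrE ?mdist_ge0//.
  by apply: ltW; apply: le_lt_trans lt1; exact: mdist_ge0.
have le' : leM q' p'.
  have T0' : 0 <= tauM p' - tauM q' by move: T0 => /=; lra.
  by rewrite -ler_sqr ?nnegrE ?mdist_ge0// -subr_ge0; exact: ltW.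
have sM0 := @sep_ge0 R M _ tauM posM q' p'.
case: H => [[A [A' [h1 h2 e1 e2]]]|[B [B' [h1 h2 e1 e2]]]].
  have := sep_triangle h1 (ltW lt1).
  have := @sep_triangle R M _ tauM posM _ _ _ h2 le'.
  rewrite e1 e2; lra.
have := sep_triangle (ltW lt1) h1.
have := @sep_triangle R M _ tauM posM _ _ _ le' h2.
rewrite e1 e2; lra.
Qed.

Lemma triangle_comparison (T : triangle Y) (T' : triangle M) :
  comparison_triangle T T' -> forall (p q : Y) (p' q' : M),
  corresponding T T' p p' -> corresponding T T' q q' ->
  (tsep p q <= tsep p' q')%E.
Proof.
move=> [exy eyz exz] p q p' q' cp cq.
rewrite (tsepE coordY) (tsepE coordM) lee_fin.
(* Vertices are numbered in time order: a side is a pair [i < j], and the nine positions of [p] and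
   [q] reduce to coincidences of indices. *)
pose v n := match n with 0%N => vx T | 1%N => vy T | _ => vz T end.
pose v' n := match n with 0%N => vx T' | 1%N => vy T' | _ => vz T' end.
have lt01 : mdist (posM (v' 0%N)) (posM (v' 1%N)) < tauM (v' 1%N) - tauM (v' 0%N).
  exact: chron_xy T'.
have lt12 : mdist (posM (v' 1%N)) (posM (v' 2%N)) < tauM (v' 2%N) - tauM (v' 1%N).
  exact: chron_yz T'.
have lt02 : mdist (posM (v' 0%N)) (posM (v' 2%N)) < tauM (v' 2%N) - tauM (v' 0%N).
  have := metric_triangle (posM (v' 0%N)) (posM (v' 1%N)) (posM (v' 2%N)); lra.
have sM01 := @sep_pos R M _ tauM posM _ _ lt01.
have sM12 := @sep_pos R M _ tauM posM _ _ lt12.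
have sM02 := @sep_pos R M _ tauM posM _ _ lt02.
have toS (A B : Y) (A' B' : M) : tsep A' B' = tsep A B -> s A B = sM A' B'.
  by rewrite (tsepE coordY) (tsepE coordM) => -[].
have Q01 := sep_eq_sqsep (toS _ _ _ _ exy) sM01.
have Q12 := sep_eq_sqsep (toS _ _ _ _ eyz) sM12.
have Q02 := sep_eq_sqsep (toS _ _ _ _ exz) sM02.
have QE i j : Q (v i) (v j) = QM (v' i) (v' j).
  by move: i j => [|[|i]] [|[|j]]; rewrite ?sqsepxx ?(@sqsepxx R M)//;
     rewrite sqsepC (@sqsepC R M).
have side r r' : corresponding T T' r r' -> exists ij : nat * nat,
    [/\ (ij.1 < ij.2)%N, (ij.2 <= 2)%N &
      side_pair tau pos (v ij.1) (v ij.2) r (v' ij.1) (v' ij.2) r'].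
  have [mxy jxy] := sxyP T; have [myz jyz] := syzP T; have [mxz jxz] := sxzP T.
  have [mxy' jxy'] := sxyP T'; have [myz' jyz'] := syzP T'; have [mxz' jxz'] := sxzP T'.
  case=> cr; [exists (0%N, 1%N)|exists (1%N, 2%N)|exists (0%N, 2%N)]; split => //.
  - exact: corresponding_side_pair mxy jxy mxy' jxy' (esym exy) sM01 cr.
  - exact: corresponding_side_pair myz jyz myz' jyz' (esym eyz) sM12 cr.
  - exact: corresponding_side_pair mxz jxz mxz' jxz' (esym exz) sM02 cr.
have [[i j] /= [ij j2 Sp]] := side _ _ cp; have [[k l] /= [kl l2 Sq]] := side _ _ cq.
have QQ : Q p q <= QM p' q' by apply: side_pair_sqsep Sp Sq _ _ _ _ _ _.
apply: (sqsep_sep QQ) => s0.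
have lt1 := sep_gt0 s0.
have [p1 p2 p3 p4 p5 p6 _] := Sp; have [q1 q2 q3 q4 q5 q6 _] := Sq.
have [ik|ik] := eqVneq i k.
  apply: (sqsep_pos_order s0 QQ); left; exists (v i), (v' i).
  by split => //; rewrite ik.
have [jl|jl] := eqVneq j l.
  apply: (sqsep_pos_order s0 QQ); right; exists (v j), (v' j).
  by split => //; rewrite jl.
have [jk|jk] := eqVneq j k.
  rewrite -jk in q3; have := mdist_ge0 (posM p') (posM (v' j)).
  have := mdist_ge0 (posM (v' j)) (posM q'); move: q3 p4 => /=; lra.
(* There remain [p] on [y z] and [q] on [x y]; then [q] precedes [y], which precedes [p], against
   [p << q]. *)
have il : i = l.
  move: ij j2 kl l2 ik jl jk; clear.
  by move: i j k l => [|[|[|i]]] [|[|[|j]]] [|[|[|k]]] [|[|[|l]]].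
exfalso; rewrite il in p1; have := mdist_ge0 (pos p) (pos q).
have := mdist_ge0 (pos (v l)) (pos p); have := mdist_ge0 (pos q) (pos (v l)).
lra.
Qed.

End ForwardCurvature.

Section StewartCurvature.
Context {R : realType} (a b : R) (X : metricType R).
Hypothesis geoX : geodesic_space X.
Hypothesis stX : stewart X.
Local Notation Y := (lorentz_product `[a, b]%classic X).
Local Notation tau := (fun p : Y => \val p.1).
Local Notation pos := (fun p : Y => p.2).
Let coordY : @lorentz_coordinates R Y X tau pos := cone_coordinates a b geoX.

Lemma lipschitz_continuous2 (W : metricType R) (F : W * W -> R) :
  (forall x y x' y', `|F (x, y) - F (x', y')| <= mdist x x' + mdist y y') ->
  continuous F.
Proof.
move=> HF [x y]; apply/cvgrPdist_lt => e e0.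
have e20 : 0 < e / 2 by rewrite divr_gt0.
exists (ball x (e / 2), ball y (e / 2)); first by split; exact: nbhsx_ballx.
move=> [x' y'] [/=]; rewrite !ballEmdist/= => h1 h2.
by apply: le_lt_trans (HF _ _ _ _) _; rewrite (splitr e) ltrD.
Qed.

Lemma sep_continuous : continuous (fun xy : Y * Y => sep tau pos xy.1 xy.2).
Proof.
have cT : continuous (fun xy : Y * Y => (tau xy.2 - tau xy.1 : R)).
  apply: lipschitz_continuous2 => x y x' y' /=; rewrite !(coord_dist coordY).
  have := mdist_ge0 (pos x) (pos x'); have := mdist_ge0 (pos y) (pos y').
  have := ler_norm (tau x - tau x'); have := ler_norm (tau y - tau y').
  have := ler_norm (tau x' - tau x); have := ler_norm (tau y' - tau y).
  rewrite (distrC (tau x')) (distrC (tau y')) ler_norml /=; lra.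
have cD : continuous (fun xy : Y * Y => mdist (pos xy.1) (pos xy.2)).
  apply: lipschitz_continuous2 => x y x' y' /=; rewrite !(coord_dist coordY).
  have := normr_ge0 (tau x - tau x'); have := normr_ge0 (tau y - tau y').
  rewrite ler_norml.
  have := metric_triangle (pos x) (pos x') (pos y).
  have := metric_triangle (pos x') (pos y') (pos y).
  have := metric_triangle (pos x') (pos x) (pos y').
  have := metric_triangle (pos x) (pos y) (pos y').
  rewrite (metric_sym (pos x') (pos x)) (metric_sym (pos y') (pos y)); lra.
have cm : continuous (fun xy : Y * Y => Num.max 0 (tau xy.2 - tau xy.1) : R^o).
  have -> : (fun xy : Y * Y => Num.max 0 (tau xy.2 - tau xy.1) : R^o) =
      (fun=> 0 : R^o) \max (fun xy : Y * Y => tau xy.2 - tau xy.1) by [].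
  by move=> xy; apply: continuous_max; [exact: cvg_cst|exact: cT].
move=> xy; apply: (@cvg_comp _ _ _ (fun xy : Y * Y => Num.max 0 (tau xy.2 - tau xy.1) ^+ 2
   - mdist (pos xy.1) (pos xy.2) ^+ 2) Num.sqrt); last exact: sqrt_continuous.
apply: (@cvgB _ R^o); rewrite !expr2; apply: cvgM; try exact: cm; exact: cD.
Qed.

Theorem stewart_curvature : timelike_curvature_ge0 Y.
Proof.
(* Stewart's inequality has no size restriction, so the whole space is a suitable neighbourhood. *)
move=> o; exists setT; split; first exact: filterT.
- split; first by move=> x y _ _; rewrite (tsepE coordY).
  apply: continuous_subspaceT => xy.
  rewrite (_ : (fun xy : Y * Y => tsep xy.1 xy.2) =
    EFin \o (fun xy : Y * Y => sep tau pos xy.1 xy.2)).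
    by apply: cvg_EFin; [exact: nearW|exact: sep_continuous].
  by apply/funext => z; rewrite (tsepE coordY).
- move=> x y _ _ [c [cfd cae] cj].
  have cc : cone_fd_causal (fun=> 1) c.
    split => //; apply: (@filterS _ _ (ae_filter_ringOfSetsType (@lebesgue_measure R)) _ _ _ cae).
    by move=> s hs s_in; apply: ltW; exact: hs.
  have [T0 DT _] := fd_causal_bounds cc cj.
  have [g geo] := geoX x.2 y.2.
  exists (straight_curve x y g); split => //; last exact: straight_joins geo T0.
  exact: (straight_maximal geoX geo T0 DT).
- by move=> T T' _ cT p q p' q'; exact: (triangle_comparison coordY stX cT).
Qed.

End StewartCurvature.

(** * Globalization *)

Section Segments.
Context {R : realType} (X : metricType R).
Implicit Types (f g : R -> X) (x y z m : X).

Definition segment g a := forall s t, 0 <= s -> s <= t -> t <= a ->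
  mdist (g s) (g t) = t - s.

Lemma segmentS g a b : b <= a -> segment g a -> segment g b.
Proof. by move=> ba H s t s0 st tb; apply: H => //; exact: le_trans ba. Qed.

Lemma segment_shift g a u : 0 <= u -> segment g a ->
  segment (fun t => g (u + t)) (a - u).
Proof.
move=> u0 H s t s0 st ta; rewrite H ?addr_ge0 ?lerD2l//; first by ring.
by rewrite -lerBrDl.
Qed.

Lemma segment_rev g a u : u <= a -> segment g a -> segment (fun t => g (u - t)) u.
Proof.
move=> ua H s t s0 st tu; rewrite metric_sym H ?subr_ge0 ?lerD2l ?lerN2//.
  by ring.
by rewrite (le_trans _ ua)// gerBl.
Qed.

Lemma geodesic_segment x y g : geodesic x y g ->
  [/\ g 0 = x, g (mdist x y) = y & segment g (mdist x y)].
Proof. by []. Qed.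

(** A geodesic from [x] to [m] followed by one from [m] to [y]: a shortcut between two of its points
    would bring [x] and [y] closer. *)
Lemma geodesic_through x y m : geodesic_space X ->
  mdist x m + mdist m y = mdist x y ->
  exists2 g, geodesic x y g & g (mdist x m) = m.
Proof.
move=> geoX D; have [g1 [g10 g1m H1]] := geoX x m; have [g2 [g20 g2y H2]] := geoX m y.
have d1 := mdist_ge0 x m; have d2 := mdist_ge0 m y.
pose g t := if t <= mdist x m then g1 t else g2 (t - mdist x m).
exists g; last by rewrite /g lexx.
split.
- by rewrite /g d1.
- rewrite /g -D; case: ifPn => [|_]; last by rewrite addrC addKr.
  rewrite gerDl => my0; have my : mdist m y = 0 by apply/eqP; rewrite eq_le my0.
  by rewrite my addr0 g1m; exact: mdist_positivity.
move=> s t s0 st tD; rewrite /g; case: ifPn => [sm|].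
  case: ifPn => [tm|]; first exact: H1.
  rewrite -ltNge => mt; apply/eqP; rewrite eq_le; apply/andP; split.
    apply: le_trans (metric_triangle _ m _) _.
    have -> : mdist (g1 s) m = mdist x m - s by rewrite -{1}g1m H1.
    have -> : mdist m (g2 (t - mdist x m)) = t - mdist x m.
      by rewrite -{1}g20 H2 ?subr0//; lra.
    lra.
  have e1 : mdist x (g1 s) = s by rewrite -{1}g10 H1// subr0.
  have e2 : mdist (g2 (t - mdist x m)) y = mdist m y - (t - mdist x m).
    by rewrite -{1}g2y H2//; lra.
  have := metric_triangle x (g1 s) y.
  have := metric_triangle (g1 s) (g2 (t - mdist x m)) y; lra.
rewrite -ltNge => ms; rewrite ifN; last by rewrite -ltNge (lt_le_trans ms).
by rewrite H2; lra.
Qed.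

End Segments.

Section Globalization.
Context {R : realType} (X : metricType R).
Hypothesis geoX : geodesic_space X.
Implicit Types (f g : R -> X) (x y z m : X).

Definition stewart_below r := forall x y z m : X,
  mdist x m + mdist m y = mdist x y ->
  mdist x y < r -> mdist z x < r -> mdist z y < r ->
  mdist m y * mdist z x ^+ 2 + mdist x m * mdist z y ^+ 2 <=
  mdist x y * (mdist z m ^+ 2 + mdist x m * mdist m y).

Variable r : R.
Hypothesis r0 : 0 < r.
Hypothesis loc : stewart_below r.

(* The cosine of the Euclidean comparison angle at [f 0 = g 0]. *)
Definition comparison_cos f g s t :=
  (s ^+ 2 + t ^+ 2 - mdist (f s) (g t) ^+ 2) / (2 * s * t).
Local Notation q := comparison_cos.

Lemma comparison_cosC f g s t : q f g s t = q g f t s.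
Proof.
by rewrite /q (metric_sym (g t)) (addrC (t ^+ 2)) -(mulrA 2 t) (mulrC t) mulrA.
Qed.

(** Stewart's inequality for [f s'] on the segment from [f 0] to [f s], seen from [g t]: comparison
    angles do not increase with the size of the hinge. Sides below [r / 2] keep the triangle below
    [r]. *)
Lemma comparison_cos_le_l f g a b s' s t : segment f a -> segment g b -> f 0 = g 0 ->
  0 < s' -> s' <= s -> s <= a -> s < r / 2 -> 0 < t -> t <= b -> t < r / 2 ->
  q f g s' t <= q f g s t.
Proof.
move=> sf sg fg s'0 s's sa sr t0 tb tr.
have s0 : 0 < s := lt_le_trans s'0 s's.
have e1 : mdist (f 0) (f s') = s' by rewrite sf ?subr0//; [exact: ltW|exact: le_trans sa].
have e2 : mdist (f s') (f s) = s - s' by rewrite sf//; exact: ltW.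
have e3 : mdist (f 0) (f s) = s by rewrite sf ?subr0//; exact: ltW.
have e4 : mdist (g t) (f 0) = t by rewrite metric_sym fg sg ?subr0//; exact: ltW.
have := @loc (f 0) (f s) (g t) (f s').
have := metric_triangle (g t) (f 0) (f s).
rewrite e1 e2 e3 e4 => tri /(_ _ _ _ _) H.
have {H} : (s - s') * t ^+ 2 + s' * mdist (g t) (f s) ^+ 2 <=
    s * (mdist (g t) (f s') ^+ 2 + s' * (s - s')).
  by apply: H; lra.
rewrite /q (metric_sym (g t)) (metric_sym (g t)) => H.
rewrite ler_pdivrMr ?mulr_gt0// mulrAC ler_pdivlMr ?mulr_gt0//.
have -> : 2 * s * t = s * (2 * t) by ring.
have -> : 2 * s' * t = s' * (2 * t) by ring.
rewrite !(mulrA _ _ (2 * t)) ler_pM2r ?mulr_gt0//; apply: (ler_ofB _ H); ring.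
Qed.

Lemma comparison_cos_le f g a b s' s t' t :
  segment f a -> segment g b -> f 0 = g 0 ->
  0 < s' -> s' <= s -> s <= a -> s < r / 2 ->
  0 < t' -> t' <= t -> t <= b -> t < r / 2 ->
  q f g s' t' <= q f g s t.
Proof.
move=> sf sg fg s'0 s's sa sr t'0 t't tb tr.
have s0 : 0 < s := lt_le_trans s'0 s's.
apply: (@le_trans _ _ (q f g s t')).
  apply: (comparison_cos_le_l sf sg fg) => //; first exact: le_trans tb.
  exact: le_lt_trans tr.
rewrite !(comparison_cosC f).
exact: (comparison_cos_le_l sg sf (esym fg)).
Qed.

(** Comparison cosines being monotone, their limit at the vertex is an infimum; it is recorded as a
    lower bound near 0 together with its sharpness. *)
Definition is_angle_cos f g c := exists2 d : R, 0 < d &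
  (forall s t, 0 < s -> s < d -> 0 < t -> t < d -> c <= q f g s t) /\
  (forall e, 0 < e -> exists2 d', 0 < d' &
    forall s t, 0 < s -> s < d' -> 0 < t -> t < d' -> q f g s t <= c + e).

Lemma is_angle_cosC f g c : is_angle_cos f g c -> is_angle_cos g f c.
Proof.
move=> [d d0 [H1 H2]]; exists d => //; split.
  by move=> s t *; rewrite comparison_cosC; exact: H1.
move=> e /H2[d' d'0 H]; exists d' => // s t *.
by rewrite comparison_cosC; exact: H.
Qed.

Lemma is_angle_cos_le f g a b c s t : segment f a -> segment g b -> f 0 = g 0 ->
  is_angle_cos f g c -> 0 < s -> s <= a -> s < r / 2 -> 0 < t -> t <= b -> t < r / 2 ->
  c <= q f g s t.
Proof.
move=> sf sg fg [d d0 [H _]] s0 sa sr t0 tb tr.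
pose s' := Num.min s (d / 2); pose t' := Num.min t (d / 2).
have d20 : 0 < d / 2 by rewrite divr_gt0.
have dd : d / 2 < d by rewrite ltr_pdivrMr// ltr_pMr// ltr1n.
apply: (@le_trans _ _ (q f g s' t')).
  by apply: H; rewrite ?lt_min ?gt_min ?s0 ?t0 ?d20 ?dd ?orbT.
by apply: (comparison_cos_le sf sg fg); rewrite // ?lt_min ?s0 ?t0 ?ge_min ?lexx.
Qed.

Lemma angle_cos_exists f g a b : 0 < a -> 0 < b ->
  segment f a -> segment g b -> f 0 = g 0 -> exists c, is_angle_cos f g c.
Proof.
move=> a0 b0 sf sg fg.
pose d := Num.min (Num.min a b) (r / 4).
have d0 : 0 < d by rewrite !lt_min a0 b0 divr_gt0.
have da : d <= a by rewrite /d !ge_min lexx.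
have db : d <= b by rewrite /d !ge_min lexx orbT.
have dr : d < r / 2.
  have : d <= r / 4 by rewrite /d ge_min lexx orbT.
  lra.
pose A : set R := [set q f g st.1 st.2 | st in
  [set st : R * R | [/\ 0 < st.1, st.1 < d, 0 < st.2 & st.2 < d]]].
have A0 : A !=set0.
  exists (q f g (d / 2) (d / 2)), (d / 2, d / 2) => //=.
  by split; rewrite ?divr_gt0// ltr_pdivrMr// ltr_pMr// ltr1n.
have Alb : has_lbound A.
  exists (- 1) => _ [[s t] /= [s0 sd t0 td] <-].
  rewrite /q ler_pdivlMr ?mulr_gt0//.
  have e1 : mdist (f s) (f 0) = s.
    by rewrite metric_sym sf ?subr0//; [exact: ltW|exact: ltW (lt_le_trans sd da)].
  have e2 : mdist (g 0) (g t) = t.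
    by rewrite sg ?subr0//; [exact: ltW|exact: ltW (lt_le_trans td db)].
  have := metric_triangle (f s) (f 0) (g t); rewrite e1 fg e2 => tri.
  have : mdist (f s) (g t) ^+ 2 <= (s + t) ^+ 2.
    by rewrite ler_sqr ?nnegrE ?mdist_ge0// addr_ge0 ?ltW.
  rewrite sqrrD; lra.
have Ai : has_inf A by split.
exists (inf A), d => //; split.
  by move=> s t s0 sd t0 td; apply: ge_inf => //; exists (s, t).
move=> e e0; have [_ [[s t] /= [s0 sd t0 td] <-] He] := inf_adherent e0 Ai.
exists (Num.min s t); first by rewrite lt_min s0.
move=> s' t' s'0 s's t'0 t't; apply/ltW; apply: le_lt_trans He.
move: s's t't; rewrite !lt_min => /andP[s's _] /andP[_ t't].
apply: (comparison_cos_le sf sg fg) => //; try exact: ltW; try exact: lt_trans dr.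
- exact: ltW (lt_le_trans sd da).
- exact: ltW (lt_le_trans td db).
Qed.

(** Adjacent angles add up to at most a straight angle: Stewart's inequality for the midpoint [g u]
    of [g (u - t)] and [g (u + t)], seen from [f t], says that the two comparison cosines have
    nonnegative sum. *)
Lemma adjacent_angle_cos f g a b u c1 c2 : 0 < a -> 0 < u -> u < b ->
  segment f a -> segment g b -> f 0 = g u ->
  is_angle_cos f (fun t => g (u + t)) c1 -> is_angle_cos f (fun t => g (u - t)) c2 ->
  0 <= c1 + c2.
Proof.
move=> a0 u0 ub sf sg fg [_ _ [_ H1]] [_ _ [_ H2]].
rewrite -oppr_le0; apply/ler_addgt0Pr => e e0; rewrite add0r.
have e20 : 0 < e / 2 by rewrite divr_gt0.
have [d1 d10 {}H1] := H1 _ e20; have [d2 d20 {}H2] := H2 _ e20.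
pose t := Num.min (Num.min (Num.min d1 d2) (Num.min a u)) (Num.min (b - u) (r / 2)) / 2.
set mm := Num.min _ _ in t.
have mm0 : 0 < mm by rewrite !lt_min d10 d20 a0 u0 subr_gt0 ub divr_gt0.
have [m1 m2 m3 m4 [m5 m6]] : [/\ mm <= d1, mm <= d2, mm <= a, mm <= u & mm <= b - u /\ mm <= r / 2].
  by split; rewrite ?/mm ?ge_min ?lexx ?orbT//; split; rewrite ge_min ?lexx ?orbT.
have t0 : 0 < t by rewrite divr_gt0.
have tm : t < mm by rewrite /t ltr_pdivrMr// ltr_pMr// ltr1n.
have q1 := H1 t t t0 (lt_le_trans tm m1) t0 (lt_le_trans tm m1).
have q2 := H2 t t t0 (lt_le_trans tm m2) t0 (lt_le_trans tm m2).
suff : 0 <= q f (fun t => g (u + t)) t t + q f (fun t => g (u - t)) t t by lra.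
rewrite /q -mulrDl divr_ge0//; last by rewrite !mulr_ge0 ?ltW.
have e1 : mdist (g (u - t)) (g u) = t by rewrite sg; lra.
have e2 : mdist (g u) (g (u + t)) = t by rewrite sg; lra.
have e3 : mdist (g (u - t)) (g (u + t)) = t + t by rewrite sg; lra.
have e4 : mdist (f t) (g u) = t by rewrite metric_sym -fg sf ?subr0//; lra.
have := @loc (g (u - t)) (g (u + t)) (f t) (g u).
have := metric_triangle (f t) (g u) (g (u + t)).
have := metric_triangle (f t) (g u) (g (u - t)).
rewrite (metric_sym (g u) (g (u - t))) e1 e2 e3 e4 => tri1 tri2 H.
have {}H : t * mdist (f t) (g (u - t)) ^+ 2 + t * mdist (f t) (g (u + t)) ^+ 2 <=
    (t + t) * (t ^+ 2 + t * t) by apply: H; lra.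
by rewrite -(ler_pM2l t0) mulr0; apply: (ler_ofB _ H); ring.
Qed.

(** Toponogov's comparison with the Euclidean law of cosines. The size of a hinge is the sum [a + b]
    of its sides, the quantity that the induction decreases. *)
Definition hinge_below l := forall f g a b c, 0 < a -> 0 < b ->
  segment f a -> segment g b -> f 0 = g 0 -> is_angle_cos f g c -> a + b < l ->
  mdist (f a) (g b) ^+ 2 <= a ^+ 2 + b ^+ 2 - 2 * a * b * c.

Lemma hinge_below_small : hinge_below (r / 2).
Proof.
move=> f g a b c a0 b0 sf sg fg ac ab.
have : c <= q f g a b by apply: (is_angle_cos_le sf sg fg ac) => //; lra.
rewrite /q ler_pdivlMr ?mulr_gt0//; lra.
Qed.

(* Moving the vertex of a hinge along its long side neither increases the sum of
   the sides nor the third side of the Euclidean comparison hinge.  After finitely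
   many moves the hinge is small, or some move gains less than [e] in the sum of
   the sides, and then the angle at the vertex is nearly straight. *)
Lemma hinge_below_approx l e : hinge_below (2 / 3 * l) -> 0 < l -> 0 < e ->
  forall n f g a b c, 0 < a -> 0 < b ->
  segment f a -> segment g b -> f 0 = g 0 -> is_angle_cos f g c -> a + b < l ->
  a + b <= e *+ n ->
  mdist (f a) (g b) ^+ 2 <= a ^+ 2 + b ^+ 2 - 2 * a * b * c + 36 * l * e.
Proof.
move=> Hl l0 e0; elim=> [|n IH] f g a b c a0 b0 sf sg fg ac ab abn.
  by move: abn; rewrite mulr0n; lra.
have le0 : 0 <= 36 * l * e by rewrite !mulr_ge0// ltW.
have [small|large] := ltP (a + b) (2 / 3 * l).
  by have := Hl _ _ _ _ _ a0 b0 sf sg fg ac small; lra.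
wlog ble : f g a b a0 b0 sf sg fg ac ab abn large / a <= b.
  move=> W; have [//|ba] := leP a b; first exact: W.
  have := W g f b a b0 a0 sg sf (esym fg) (is_angle_cosC ac).
  rewrite (addrC b a) => /(_ ab abn large (ltW ba)).
  by rewrite metric_sym => /le_trans; apply; rewrite le_eqVlt; apply/orP; left; apply/eqP; ring.
(* Chosen so that the hinges with sides [a, u] and [A, u] stay below [2 / 3 * l], as
   [A + u <= a + 2 * u]; since [a < l / 2], also [u >= l / 18]. *)
pose u := (2 / 3 * l - a) / 3.
have u0 : 0 < u by rewrite /u; lra.
have ul : l / 18 <= u by rewrite /u; lra.
have ub : u < b by rewrite /u; lra.
have aul : a + 2 * u < 2 / 3 * l by rewrite /u; lra.
have sgu : segment g u by apply: segmentS sg; exact: ltW.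
set p := f a; set x' := g u; pose A := mdist p x'.
have S1 : A ^+ 2 <= a ^+ 2 + u ^+ 2 - 2 * a * u * c by apply: Hl => //; lra.
have A0 : 0 <= A := mdist_ge0 _ _.
have xp : mdist (f 0) p = a by rewrite sf ?subr0// ltW.
have xx' : mdist (f 0) x' = u by rewrite fg sg ?subr0// ltW.
have x'q : mdist x' (g b) = b - u by rewrite sg// ltW.
have Aau : A <= a + u.
  by have := metric_triangle p (f 0) x'; rewrite (metric_sym p (f 0)) xp xx'.
have pq : mdist p (g b) <= A + (b - u).
  by have := metric_triangle p x' (g b); rewrite x'q.
have aAu : a <= A + u.
  have := metric_triangle (f 0) x' p; rewrite xp xx' (metric_sym x').
  by rewrite -/A; lra.
(* Little gain: [A >= a + u - e] and [S1] make [c] close to -1, and the trivial bound [a + b] on the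
   third side suffices. The factor 36 is [2 * 18], from [u >= l / 18]. *)
have [dle|dgt] := leP (a + u - A) e.
  have h1 : mdist p (g b) ^+ 2 <= (a + b) ^+ 2.
    by rewrite ler_sqr ?nnegrE ?mdist_ge0//; lra.
  have h2 : 2 * a * u * c <= - (2 * a * u) + 2 * (a + u) * e.
    have : (a + u - e) * (a + u - e) <= A ^+ 2 \/ a + u - e <= 0.
      have [|pos] := leP (a + u - e) 0; [by right|left].
      by rewrite -expr2 ler_sqr ?nnegrE //; lra.
    case=> h.
      have : 0 <= e * e by rewrite mulr_ge0 ?ltW.
      by move: S1 h; rewrite !expr2; lra.
    have : 0 <= A ^+ 2 by exact: sqr_ge0.
    have : (a + u) * (a + u) <= (a + u) * e by rewrite ler_wpM2l//; lra.
    move: S1; rewrite !expr2.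
    have : 0 <= (a + u) * e by rewrite mulr_ge0//; lra.
    lra.
  have h3 : 2 * a * b * c <= - (2 * a * b) + 36 * l * e.
    rewrite -(ler_pM2l u0).
    have : b * (2 * a * u * c) <= b * (- (2 * a * u) + 2 * (a + u) * e).
      by rewrite ler_pM2l.
    have : b * (2 * (a + u) * e) <= u * (36 * l * e).
      have -> : b * (2 * (a + u) * e) = (2 * e) * (b * (a + u)) by ring.
      have -> : u * (36 * l * e) = (2 * e) * (18 * u * l) by ring.
      rewrite ler_pM2l ?mulr_gt0//.
      apply: (@le_trans _ _ (l * l)); first by apply: ler_pM; lra.
      by rewrite ler_pM2r//; lra.
    lra.
  by move: h1 h3; rewrite sqrrD; lra.
(* There is no direction from [x'] to [p] if they coincide; then [a = u], and [c <= 1] suffices. *)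
have [px'|px'] := eqVneq p x'.
  have Az : A = 0 by rewrite /A px' mdistxx.
  have au : a = u by apply/eqP; rewrite eq_le; apply/andP; split; move: xp xx'; rewrite px'; lra.
  have h1 : mdist p (g b) = b - a by rewrite px' x'q au.
  rewrite h1; have c1 : c <= 1.
    rewrite -(@ler_pM2l _ (2 * a * a)) ?mulr_gt0//.
    by move: S1; rewrite Az -au !expr2; lra.
  have : 2 * a * b * c <= 2 * a * b by rewrite ger_pMr ?mulr_gt0.
  by rewrite sqrrB; lra.
have Ap : 0 < A by rewrite mdist_gt0.
(* The new vertex [x'] sees [p] along [f'], whose angles with the forward part of [g] ([c1]) and the
   backward part ([c2]) are adjacent. *)
have [f' geo'] := geoX x' p.
have [f'0 f'A sf'] := geodesic_segment geo'.
rewrite (metric_sym x' p) -/A in f'A sf'.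
have sgp : segment (fun t => g (u + t)) (b - u) by apply: segment_shift sg; exact: ltW.
have sgm : segment (fun t => g (u - t)) u by apply: segment_rev sg; exact: ltW.
have bu0 : 0 < b - u by rewrite subr_gt0.
have f'gp : f' 0 = g (u + 0) by rewrite addr0.
have f'gm : f' 0 = g (u - 0) by rewrite subr0.
have [c1 ac1] := angle_cos_exists Ap bu0 sf' sgp f'gp.
have [c2 ac2] := angle_cos_exists Ap u0 sf' sgm f'gm.
have c12 := adjacent_angle_cos Ap u0 ub sf' sg f'0 ac1 ac2.
(* The small hinge back to the old vertex bounds [c2] from above, hence [c1 >= - c2] from below; the
   gain of [e] puts the forward hinge under the induction hypothesis. *)
have S2 : a ^+ 2 <= A ^+ 2 + u ^+ 2 - 2 * A * u * c2.
  have := Hl _ _ _ _ _ Ap u0 sf' sgm f'gm ac2.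
  rewrite f'A subrr -fg (metric_sym p) xp; apply; lra.
have S3 := IH _ _ _ _ _ Ap bu0 sf' sgp f'gp ac1.
have ubE : u + (b - u) = b by ring.
rewrite f'A ubE in S3.
have {}S3 : mdist p (g b) ^+ 2 <= A ^+ 2 + (b - u) ^+ 2 - 2 * A * (b - u) * c1 + 36 * l * e.
  apply: S3; first by lra.
  by move: abn; rewrite mulrSr; lra.
apply: le_trans S3 _; rewrite lerD2r -(ler_pM2l u0).
(* Stewart's identity in the plane: the bounds on [c1 + c2], [c2] and [A], weighted by [u], [b - u]
   and [b], eliminate these quantities. *)
have t1 : 0 <= u * (2 * A * (b - u) * (c1 + c2)).
  apply: mulr_ge0; first exact: ltW.
  apply: mulr_ge0; last exact: c12.
  by apply: mulr_ge0; [apply: mulr_ge0|exact: ltW].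
have t2 : (b - u) * (2 * A * u * c2) <= (b - u) * (A ^+ 2 + u ^+ 2 - a ^+ 2).
  by rewrite ler_pM2l//; lra.
have t3 : b * A ^+ 2 <= b * (a ^+ 2 + u ^+ 2 - 2 * a * u * c) by rewrite ler_pM2l.
move: t1 t2 t3; rewrite !expr2; lra.
Qed.

Lemma hinge_below_step l : 0 < l -> hinge_below (2 / 3 * l) -> hinge_below l.
Proof.
move=> l0 Hl f g a b c a0 b0 sf sg fg ac ab.
apply/ler_addgt0Pr => e e0; pose e' := e / (36 * l).
have e'0 : 0 < e' by rewrite divr_gt0// mulr_gt0.
have -> : e = 36 * l * e' by rewrite /e'; field; rewrite gt_eqF.
have ab0 : 0 <= (a + b) / e' by rewrite divr_ge0 ?addr_ge0// ltW.
apply: (hinge_below_approx Hl l0 e'0 (n := Num.bound ((a + b) / e'))) => //.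
by rewrite -mulr_natr mulrC -ler_pdivrMr// ltW// archi_boundP.
Qed.

(** Each step enlarges the admissible size by the factor [3 / 2]; Bernoulli's inequality [bern]
    shows that every [l] is reached. *)
Lemma hinge_all l : hinge_below l.
Proof.
have H n : hinge_below (r / 2 * (3 / 2) ^+ n).
  elim: n => [|n IH]; first by rewrite expr0 mulr1; exact: hinge_below_small.
  apply: hinge_below_step; first by rewrite mulr_gt0 ?exprn_gt0 ?divr_gt0.
  suff -> : 2 / 3 * (r / 2 * (3 / 2) ^+ n.+1) = r / 2 * (3 / 2) ^+ n :> R by [].
  by rewrite exprS; field.
move=> f g a b c a0 b0 sf sg fg ac ab.
pose n := Num.bound (4 * l / r).
have l0 : 0 < l by apply: (lt_trans _ ab); rewrite addr_gt0.
apply: (H n f g a b c) => //; apply: (lt_le_trans ab).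
have nb : 4 * l / r < n%:R by apply: archi_boundP; rewrite divr_ge0 ?mulr_ge0// ltW.
have bern k : 1 + k%:R / 2 <= (3 / 2) ^+ k :> R.
  elim: k => [|k IHk]; first by rewrite mul0r addr0 expr0.
  rewrite exprS -natr1; have : 0 <= k%:R :> R by []; lra.
apply: (@le_trans _ _ (r / 2 * (n%:R / 2))).
  by move: nb; rewrite ltr_pdivrMr// => nb; lra.
by rewrite ler_pM2l ?divr_gt0//; apply: le_trans (bern n); lra.
Qed.

(** The hinges at [m] towards [x] and [y] share the side [m z]. With their comparisons weighted by
    [mdist m y] and [mdist x m], the cosines combine into a multiple of [c1 + c2 >= 0]. *)
Theorem stewart_globalization : stewart X.
Proof.
move=> x y z m D.
have a0 := mdist_ge0 x m; have b0 := mdist_ge0 m y; have s0 := mdist_ge0 z m.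
have [xm|xm] := eqVneq x m.
  by rewrite -xm mdistxx !mul0r !addr0.
have [my|my] := eqVneq m y.
  by rewrite -my mdistxx mulr0 mul0r addr0 add0r.
have [zm|zm] := eqVneq z m.
  rewrite zm mdistxx -D (metric_sym m x) expr0n/= add0r le_eqVlt; apply/orP; left.
  by apply/eqP; ring.
have [g geo gm] := geodesic_through geoX D.
have [g0 gy sg] := geodesic_segment geo.
have [f geof] := geoX m z; have [f0 fz sf] := geodesic_segment geof.
have ap : 0 < mdist x m by rewrite mdist_gt0.
have bp : 0 < mdist m y by rewrite mdist_gt0.
have sp : 0 < mdist m z by rewrite mdist_gt0 eq_sym.
have sgp : segment (fun t => g (mdist x m + t)) (mdist m y).
  have -> : mdist m y = mdist x y - mdist x m by rewrite -D; ring.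
  by apply: segment_shift sg.
have aD : mdist x m < mdist x y by rewrite -D ltrDl.
have sgm : segment (fun t => g (mdist x m - t)) (mdist x m).
  by apply: segment_rev sg; exact: ltW.
have fgp : f 0 = g (mdist x m + 0) by rewrite addr0 f0 gm.
have fgm : f 0 = g (mdist x m - 0) by rewrite subr0 f0 gm.
have [c1 ac1] := angle_cos_exists sp bp sf sgp fgp.
have [c2 ac2] := angle_cos_exists sp ap sf sgm fgm.
have fgx : f 0 = g (mdist x m) by rewrite f0 gm.
have c12 := adjacent_angle_cos sp ap aD sf sg fgx ac1 ac2.
have h1 : mdist z y ^+ 2 <= mdist m z ^+ 2 + mdist m y ^+ 2
    - 2 * mdist m z * mdist m y * c1.
  have := @hinge_all (mdist m z + mdist m y + 1) _ _ _ _ _ sp bp sf sgp fgp ac1.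
  by rewrite fz D gy; apply; lra.
have h2 : mdist z x ^+ 2 <= mdist m z ^+ 2 + mdist x m ^+ 2
    - 2 * mdist m z * mdist x m * c2.
  have := @hinge_all (mdist m z + mdist x m + 1) _ _ _ _ _ sp ap sf sgm fgm ac2.
  by rewrite fz subrr g0; apply; lra.
have t1 : 0 <= mdist x m * mdist m y * mdist m z * (c1 + c2).
  by rewrite !mulr_ge0// ltW.
have t2 : mdist m y * mdist z x ^+ 2 <= mdist m y * (mdist m z ^+ 2 + mdist x m ^+ 2
    - 2 * mdist m z * mdist x m * c2) by rewrite ler_pM2l.
have t3 : mdist x m * mdist z y ^+ 2 <= mdist x m * (mdist m z ^+ 2 + mdist m y ^+ 2
    - 2 * mdist m z * mdist m y * c1) by rewrite ler_pM2l.
rewrite -D (metric_sym z m); move: t1 t2 t3; rewrite !expr2; lra.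
Qed.

End Globalization.

(** * Gromov-Hausdorff limits *)

Section CompactGeodesics.
Context {R : realType} (X : metricType R).

(* A cluster point, for pointwise convergence, of ever better approximate
   geodesics; these need not be continuous. *)
Lemma compact_geodesic (x y : X) : compact [set: X] ->
  (forall e : R, 0 < e -> exists h : R -> X,
    [/\ mdist (h 0) x <= e, mdist (h (mdist x y)) y <= e &
     forall s t, 0 <= s -> s <= t -> t <= mdist x y ->
       `|mdist (h s) (h t) - (t - s)| <= e]) ->
  exists g, geodesic x y g.
Proof.
move=> cX happ.
have /choice[h Hh] n : exists h : R -> X,
    [/\ mdist (h 0) x <= n.+1%:R^-1, mdist (h (mdist x y)) y <= n.+1%:R^-1 &
     forall s t, 0 <= s -> s <= t -> t <= mdist x y ->
       `|mdist (h s) (h t) - (t - s)| <= n.+1%:R^-1].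
  by apply: happ; rewrite invr_gt0.
(* In the power of [X] over the whole line a basic neighbourhood constrains finitely many
   parameters; constraining two at a time suffices. *)
have cP := @tychonoff R (fun=> X) (fun=> setT) (fun=> cX).
pose F : set_system (prod_topology (fun _ : R => X)) :=
  (h : nat -> prod_topology (fun _ : R => X)) @ \oo.
have [|g [_ gF]] := cP F _; first by apply: filterE.
pose gg : R -> X := g.
have near_g (s t e : R) : 0 < e -> exists n, [/\ mdist (gg s) (h n s) < e,
    mdist (gg t) (h n t) < e & n.+1%:R^-1 < e].
  move=> e0.
  pose V : set (prod_topology (fun _ : R => X)) :=
    [set f | mdist (g s) (f s) < e] `&` [set f | mdist (g t) (f t) < e].
  have Vg : nbhs g V.
    have P u : nbhs g [set f : prod_topology (fun _ : R => X) | mdist (g u) (f u) < e].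
      have := @proj_continuous R (fun=> X) u g.
      by move/metricType_numDomainType.cvgrPdist_lt => H; exact: (H (nbhs_filter g) e e0).
    by apply: filterI; exact: P.
  pose N := Num.bound e^-1.
  have FN : F [set f | exists2 n, (N <= n)%N & f = h n].
    by exists N => //= n Nn; exists n.
  have [f [[n Nn ->] [h1 h2]]] := gF _ _ FN Vg.
  exists n; split => //.
  rewrite invf_plt ?posrE//; apply: lt_le_trans (_ : N%:R <= _).
    by apply: archi_boundP; rewrite invr_ge0 ltW.
  by rewrite ler_nat; exact: leqW.
exists gg; split.
- apply/mdist_positivity/eqP; rewrite eq_le mdist_ge0 andbT; apply/ler_addgt0Pr => e e0.
  have [|n [h1 _ h2]] := near_g 0 0 (e / 2); first by rewrite divr_gt0.
  have [h3 _ _] := Hh n; have := metric_triangle (gg 0) (h n 0) x.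
  by move: (n.+1%:R^-1) h2 h3 => w h2 h3; lra.
- apply/mdist_positivity/eqP; rewrite eq_le mdist_ge0 andbT; apply/ler_addgt0Pr => e e0.
  have [|n [h1 _ h2]] := near_g (mdist x y) 0 (e / 2); first by rewrite divr_gt0.
  have [_ h3 _] := Hh n; have := metric_triangle (gg (mdist x y)) (h n (mdist x y)) y.
  by move: (n.+1%:R^-1) h2 h3 => w h2 h3; lra.
move=> s t s0 st tD; apply/eqP; rewrite -subr_eq0 -normr_le0; apply/ler_addgt0Pr => e e0.
have [|n [h1 h2 h3]] := near_g s t (e / 3); first by rewrite divr_gt0.
have [_ _ /(_ s t s0 st tD)] := Hh n; rewrite !ler_norml => /andP[].
move: (n.+1%:R^-1) h3 => w h3 h4 h5.
have := metric_triangle (gg s) (h n s) (gg t).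
have := metric_triangle (h n s) (h n t) (gg t).
have := metric_triangle (h n s) (gg s) (h n t).
have := metric_triangle (gg s) (gg t) (h n t).
rewrite (metric_sym (h n s) (gg s)) (metric_sym (h n t) (gg t)).
by move=> *; apply/andP; split; lra.
Qed.

Lemma chain_strict (c : R -> X) x y p : chain x y p -> exists p',
  [/\ path <%R x p', last x p' == y & chain_length c x p = chain_length c x p'].
Proof.
elim: p x => [|z p IH] x /=; first by exists [::]; case/andP: H.
move=> /andP[/= /andP[xz pz] lz].
have [|p' [pp' lp' e]] := IH z; first by rewrite /chain pz.
have [xz_eq|xz_ne] := eqVneq x z.
  by exists p'; rewrite xz_eq mdistxx add0r.
by exists (z :: p') => /=; rewrite lt_neqAle xz_ne xz pp' lp' e.
Qed.

Lemma chain_length_le_curve_length (c : pcurve R X) p : chain (lo c) (hi c) p ->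
  ((chain_length (cmap c) (lo c) p)%:E <= curve_length c)%E.
Proof.
move=> /(chain_strict (cmap c))[p' [pp lp ->]].
apply: ereal_sup_ubound; exists p' => //; congr EFin.
rewrite big_mkord; elim: p' (lo c) {pp lp} => [|y p' IH] x /=.
  by rewrite big_ord0.
by rewrite big_ord_recl IH.
Qed.

Lemma within_continuous_dist (A : set R) (c : R -> X) s :
  {within A, continuous c} -> A s -> forall e, 0 < e ->
  exists2 d, 0 < d & forall t, A t -> `|t - s| < d -> mdist (c s) (c t) < e.
Proof.
move=> /subspace_continuousP cc As e e0.
have /metricType_numDomainType.cvgrPdist_lt/(_ _ e0) [d /= d0 Hd] := cc _ As.
by exists d => // t At ts; apply: Hd => //=; rewrite /ball_/= distrC.
Qed.

(** Lets a nearly shortest curve be reparametrized by the distance from its start, in place of arc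
    length. *)
Lemma first_hitting (c : pcurve R X) (x : X) r : lo c <= hi c ->
  {within `[lo c, hi c], continuous (cmap c)} ->
  mdist x (cmap c (lo c)) <= r -> r <= mdist x (cmap c (hi c)) ->
  let A := [set s | lo c <= s <= hi c /\ r <= mdist x (cmap c s)] in
  [/\ lo c <= inf A, inf A <= hi c & mdist x (cmap c (inf A)) = r].
Proof.
move=> lh cc rl rh A; set s0 := inf A.
have Ahi : A (hi c) by rewrite /A/= lexx lh.
have Alb : has_lbound A by exists (lo c) => s [/andP[]].
have Ai : has_inf A by split => //; exists (hi c).
have ls0 : lo c <= s0 by apply: lb_le_inf; [exists (hi c)|move=> s [/andP[]]].
have s0h : s0 <= hi c by exact: ge_inf.
split => //.
have As0 : `[lo c, hi c]%classic s0 by rewrite /= in_itv/= ls0.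
(* A distance below [r] at the infimum contradicts the points of [A] nearby; one above [r] yields,
   by the intermediate value theorem, an earlier time at distance exactly [r]. *)
apply/eqP; rewrite eq_le; apply/andP; split; rewrite leNgt; apply/negP => H; last first.
  have e1 : 0 < r - mdist x (cmap c s0) by rewrite subr_gt0.
  have [d d0 Hd] := within_continuous_dist cc As0 e1.
  have [s [/andP[ls sh] rs] sd] := inf_adherent d0 Ai.
  have s0s : s0 <= s by apply: ge_inf => //; split => //; rewrite ls.
  have := Hd s; rewrite /= in_itv/= ls sh => /(_ isT).
  rewrite ger0_norm ?subr_ge0// ltrBlDl => /(_ sd).
  have := metric_triangle x (cmap c s0) (cmap c s); lra.
have cphi : {within `[lo c, s0], continuous (fun s => mdist x (cmap c s))}.
  apply/subspace_continuousP => s; rewrite /= in_itv/= => /andP[ls ss0].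
  apply/cvgrPdist_lt => e e0.
  have Is : `[lo c, hi c]%classic s by rewrite /= in_itv/= ls (le_trans ss0).
  have [d d0 Hd] := within_continuous_dist cc Is e0.
  exists d => //= t; rewrite /ball_/= distrC => ts; rewrite in_itv/= => /andP[lt ts0].
  have /Hd/(_ ts) : `[lo c, hi c]%classic t by rewrite /= in_itv/= lt (le_trans ts0).
  have := metric_triangle x (cmap c s) (cmap c t).
  have := metric_triangle x (cmap c t) (cmap c s).
  by rewrite (metric_sym (cmap c t)) ltr_norml /from_subspace /= => *; apply/andP; split; lra.
have [|s] := IVT ls0 cphi (v := r).
  by rewrite ge_min rl le_max (ltW H) orbT.
rewrite in_itv/= => /andP[ls ss0] es.
have : s0 <= s by apply: ge_inf => //; rewrite /A/= ls (le_trans ss0)// es.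
move=> s0s; have E : s = s0 by apply/eqP; rewrite eq_le ss0.
by move: H; rewrite -es E ltxx.
Qed.

(** On a curve of length below [D + e], let [h r] be the first point at distance [r] from [x]. Cut
    at [h s] and [h t], the curve has total length below [D + e], so [mdist (h s) (h t)] exceeds
    [t - s] by at most [e]. *)
Lemma length_space_geodesic : compact [set: X] -> length_space X -> geodesic_space X.
Proof.
move=> cX lX x y; apply: compact_geodesic => // e e0.
set D := mdist x y.
have [_ [c [lh cc [cx cy]] <-] Lc] : exists2 L, [set curve_length c | c in [set c : pcurve R X |
      [/\ lo c < hi c, {within `[lo c, hi c], continuous (cmap c)}
        & joins c x y]]] L & (L < (D + e)%:E)%E.
  by apply: ereal_inf_lt; rewrite -lX lte_fin ltrDl.
pose A r := [set s | lo c <= s <= hi c /\ r <= mdist x (cmap c s)].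
pose h r := cmap c (inf (A r)).
have hit r : 0 <= r -> r <= D ->
    [/\ lo c <= inf (A r), inf (A r) <= hi c & mdist x (h r) = r].
  by move=> r0 rD; apply: first_hitting; rewrite ?cx ?cy ?mdistxx// ltW.
have D0 : 0 <= D := mdist_ge0 _ _.
have hh s t : 0 <= s -> s <= t -> t <= D ->
    mdist x (h s) + (mdist (h s) (h t) + mdist (h t) y) <= D + e.
  move=> s0 st tD; have [ls sh es] := hit s s0 (le_trans st tD).
  have [lt th et] := hit t (le_trans s0 st) tD.
  have ist : inf (A s) <= inf (A t).
    apply: lb_le_inf; first by exists (hi c); rewrite /A/= (ltW lh) lexx cy.
    move=> w [wI tw]; apply: ge_inf; first by exists (lo c) => v [/andP[]].
    by split => //; exact: le_trans tw.
  have := @chain_length_le_curve_length c [:: inf (A s); inf (A t); hi c].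
  rewrite /chain /= ls ist th eqxx cx cy addr0 => /(_ isT) hL.
  by rewrite -lee_fin; apply: le_trans hL _; exact: ltW.
exists h; split.
- have [_ _ e1] := hit 0 (lexx 0) D0; rewrite metric_sym e1; exact: ltW.
- have [_ _ e1] := hit D D0 (lexx D).
  have := hh D D D0 (lexx D) (lexx D); rewrite e1 mdistxx; lra.
move=> s t s0 st tD.
have [_ _ e1] := hit s s0 (le_trans st tD); have [_ _ e2] := hit t (le_trans s0 st) tD.
have := hh s t s0 st tD; have := metric_triangle x (h s) (h t).
have := metric_triangle x (h t) y; rewrite -/D e1 e2 ler_norml.
by move=> *; apply/andP; split; lra.
Qed.

End CompactGeodesics.

Section GromovHausdorff.
Context {R : realType} (Xn : nat -> metricType R) (X : metricType R).
Hypothesis Xn_cvg : gh_dist (Xn n) X @[n --> \oo] --> 0%E.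

(** [f] and [g] pick points within [r < e / 2] in a common space [Z], so each end of a distance
    moves by less than [e / 2]. *)
Lemma gh_approximation (e : R) : 0 < e -> exists n (f : X -> Xn n) (g : Xn n -> X),
  [/\ forall x y, `|mdist (f x) (f y) - mdist x y| <= e,
      forall u v, `|mdist (g u) (g v) - mdist u v| <= e &
      forall x, mdist (g (f x)) x <= e].
Proof.
move=> e0; have e20 : 0 < e / 2 by rewrite divr_gt0.
have nb : nbhs (0%E : \bar R) [set z : \bar R | (z < (e / 2)%:E)%E].
  by apply: open_nbhs_nbhs; split; [exact: open_ereal_lt_ereal|rewrite /= lte_fin].
have [N _ HN] := Xn_cvg nb.
have /ereal_inf_lt[_ [Z [i [j [iI jI ->]]]]] :
  (gh_dist (Xn N) X < (e / 2)%:E)%E by exact: (HN N (leqnn N)).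
move=> /ereal_inf_lt[_ [r [r0 H1 H2] <-]]; rewrite lte_fin => re.
have /choice[f Hf] x : exists u, mdist (j x) (i u) < r.
  by have [|_ [u _ <-] hu] := H2 (j x); [exists x|exists u].
have /choice[g Hg] u : exists x, mdist (i u) (j x) < r.
  by have [|_ [x _ <-] hx] := H1 (i u); [exists u|exists x].
exists N, f, g; split.
- move=> x y; rewrite -(iI (f x)) -(jI x y) ler_norml.
  have := Hf x; have := Hf y.
  have := metric_triangle (i (f x)) (j x) (i (f y)).
  have := metric_triangle (j x) (j y) (i (f y)).
  have := metric_triangle (j x) (i (f x)) (j y).
  have := metric_triangle (i (f x)) (i (f y)) (j y).
  rewrite (metric_sym (i (f x)) (j x)) (metric_sym (i (f y)) (j y)).
  by move=> *; apply/andP; split; lra.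
- move=> x y; rewrite -(jI (g x)) -(iI x y) ler_norml.
  have := Hg x; have := Hg y.
  have := metric_triangle (j (g x)) (i x) (j (g y)).
  have := metric_triangle (i x) (i y) (j (g y)).
  have := metric_triangle (i x) (j (g x)) (i y).
  have := metric_triangle (j (g x)) (j (g y)) (i y).
  rewrite (metric_sym (j (g x)) (i x)) (metric_sym (j (g y)) (i y)).
  by move=> *; apply/andP; split; lra.
- move=> x; rewrite -jI; have := Hf x; have := Hg (f x).
  have := metric_triangle (j (g (f x))) (i (f x)) (j x).
  rewrite (metric_sym (j (g (f x))) (i (f x))) (metric_sym (i (f x)) (j x)); lra.
Qed.

Hypothesis Xn_geo : forall n, geodesic_space (Xn n).

Lemma gh_limit_geodesic : compact [set: X] -> geodesic_space X.
Proof.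
move=> cX x y; apply: compact_geodesic => // e e0.
have e30 : 0 < e / 3 by rewrite divr_gt0.
have [n [f [g [fE gE gf]]]] := gh_approximation e30.
have [k [k0 k1 sk]] := Xn_geo (f x) (f y).
pose D := mdist x y; pose Dn := mdist (f x) (f y).
have /andP[D1 D2] : - (e / 3) <= Dn - D <= e / 3 by have := fE x y; rewrite ler_norml.
have D0 : 0 <= D := mdist_ge0 _ _; have Dn0 : 0 <= Dn := mdist_ge0 _ _.
(* The geodesic of [Xn n] has length [Dn], not [D]; parameters beyond [Dn] are cut off, at a cost of
   at most [e / 3]. *)
pose h r := g (k (Num.min r Dn)).
have kE s t : 0 <= s -> s <= t -> mdist (k (Num.min s Dn)) (k (Num.min t Dn)) =
    Num.min t Dn - Num.min s Dn.
  move=> s0 st; apply: sk; first by rewrite le_min s0.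
    by rewrite le_min !ge_min st lexx orbT.
  by rewrite ge_min lexx orbT.
exists h; split.
- rewrite /h (min_idPl Dn0) k0; apply: le_trans (gf x) _; lra.
- have := gE (k (Num.min D Dn)) (f y).
  have -> : mdist (k (Num.min D Dn)) (f y) = Dn - Num.min D Dn.
    by rewrite -k1 sk// ?ge_min ?le_min ?D0 ?lexx ?orbT.
  rewrite ler_norml /h => /andP[_ h1].
  have := metric_triangle (g (k (Num.min D Dn))) (g (f y)) y; have := gf y.
  have h2 : Dn - Num.min D Dn <= e / 3.
    by rewrite lerBlDr -lerBlDl le_min; apply/andP; split; lra.
  lra.
move=> s t s0 st tD; have := gE (k (Num.min s Dn)) (k (Num.min t Dn)).
rewrite kE// /h !ler_norml => /andP[h1 h2].
have tD' : t <= D := tD.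
by case: (leP s Dn) h1 h2; case: (leP t Dn) => *; apply/andP; split; lra.
Qed.

End GromovHausdorff.

(** * Stewart's inequality in the limit *)

Section StewartLimit.
Context {R : realType}.

Lemma stewart_inequality_closed (a b D p q w : R) :
  (forall e, 0 < e -> exists v : R * R * R * R * R * R,
     let: (a', b', D', p', q', w') := v in
     [/\ `|a - a'| <= e, `|b - b'| <= e & `|D - D'| <= e] /\
     [/\ `|p - p'| <= e, `|q - q'| <= e, `|w - w'| <= e &
         b' * p' ^+ 2 + a' * q' ^+ 2 <= D' * (w' ^+ 2 + a' * b')]) ->
  b * p ^+ 2 + a * q ^+ 2 <= D * (w ^+ 2 + a * b).
Proof.
move=> H.
have /choice[v Hv] n : exists v : R * R * R * R * R * R,
     let: (a', b', D', p', q', w') := v in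
     [/\ `|a - a'| <= n.+1%:R^-1, `|b - b'| <= n.+1%:R^-1 & `|D - D'| <= n.+1%:R^-1] /\
     [/\ `|p - p'| <= n.+1%:R^-1, `|q - q'| <= n.+1%:R^-1, `|w - w'| <= n.+1%:R^-1 &
         b' * p' ^+ 2 + a' * q' ^+ 2 <= D' * (w' ^+ 2 + a' * b')].
  by apply: H; rewrite invr_gt0.
pose v1 n := (v n).1.1.1.1.1; pose v2 n := (v n).1.1.1.1.2.
pose v3 n := (v n).1.1.1.2; pose v4 n := (v n).1.1.2.
pose v5 n := (v n).1.2; pose v6 n := (v n).2.
have {}Hv n : [/\ `|a - v1 n| <= n.+1%:R^-1, `|b - v2 n| <= n.+1%:R^-1 & `|D - v3 n| <= n.+1%:R^-1] /\
     [/\ `|p - v4 n| <= n.+1%:R^-1, `|q - v5 n| <= n.+1%:R^-1, `|w - v6 n| <= n.+1%:R^-1 &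
         v2 n * v4 n ^+ 2 + v1 n * v5 n ^+ 2 <= v3 n * (v6 n ^+ 2 + v1 n * v2 n)].
  by have := Hv n; rewrite /v1 /v2 /v3 /v4 /v5 /v6; case: (v n) => [[[[[]]]]].
have cvgv (u : nat -> R) l : (forall n, `|l - u n| <= n.+1%:R^-1) -> u n @[n --> \oo] --> l.
  move=> Hu; apply/cvgrPdist_le => e e0; near=> n.
  apply: le_trans (Hu n) _.
  rewrite invf_ple ?posrE//; apply: le_trans (_ : n%:R <= _); last by rewrite ler_nat.
  by near: n; exact: nbhs_infty_ger.
have c1 : v1 n @[n --> \oo] --> a by apply: cvgv => n; have [[]] := Hv n.
have c2 : v2 n @[n --> \oo] --> b by apply: cvgv => n; have [[]] := Hv n.
have c3 : v3 n @[n --> \oo] --> D by apply: cvgv => n; have [[]] := Hv n.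
have c4 : v4 n @[n --> \oo] --> p by apply: cvgv => n; have [_ []] := Hv n.
have c5 : v5 n @[n --> \oo] --> q by apply: cvgv => n; have [_ []] := Hv n.
have c6 : v6 n @[n --> \oo] --> w by apply: cvgv => n; have [_ []] := Hv n.
have cl : (v2 n * (v4 n * v4 n) + v1 n * (v5 n * v5 n)) @[n --> \oo] --> b * (p * p) + a * (q * q).
  by apply: cvgD; apply: cvgM => //; apply: cvgM.
have cr : (v3 n * (v6 n * v6 n + v1 n * v2 n)) @[n --> \oo] --> D * (w * w + a * b).
  by apply: cvgM => //; apply: cvgD; apply: cvgM.
rewrite !expr2; apply: (ler_cvg_to cl cr); apply: nearW => n.
by have [_ [_ _ _]] := Hv n; rewrite !expr2.
Unshelve. all: by end_near. Qed.

(** A geodesic from [p] to [q] may pass far from [u], as between antipodes of a sphere. One that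
    starts at [u'], inside a geodesic [p u], may not: in nonnegative curvature geodesics do not
    branch, and Stewart's inequality quantifies this. *)
Lemma almost_between (Z : metricType R) (p q u : Z) (e eta : R) :
  geodesic_space Z -> stewart Z -> 0 < e -> 0 < eta ->
  mdist p u + mdist u q <= mdist p q + 3 * eta ->
  e <= mdist p u -> 3 * eta <= mdist p u -> 3 * eta <= mdist u q ->
  6 * eta * mdist p u ^+ 2 <= e ^+ 3 ->
  exists u' v : Z, [/\ mdist p u' = e, mdist u' v = mdist p u - e,
    mdist u' v + mdist v q = mdist u' q & mdist v u <= e].
Proof.
move=> geoZ stZ e0 eta0 pq epu pu3 uq3 small.
have [s [s0 s1 ss]] := geoZ p u.
pose u' := s e.
have pu' : mdist p u' = e by rewrite /u' -{1}s0 ss ?subr0// ltW.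
have u'u : mdist u' u = mdist p u - e by rewrite /u' -{1}s1 ss// ltW.
pose rho := mdist p u - e.
have rho0 : 0 <= rho by rewrite subr_ge0.
have [g [g0 g1 gg]] := geoZ u' q.
have tri1 := metric_triangle p u' q.
have rq : rho <= mdist u' q by rewrite /rho; lra.
pose v := g rho.
have u'v : mdist u' v = rho by rewrite /v -{1}g0 gg ?subr0.
have vq : mdist v q = mdist u' q - rho by rewrite /v -{1}g1 gg.
exists u', v; split => //; first by rewrite vq u'v addrC subrK.
have tri2 := metric_triangle u' u q.
have tri3 := metric_triangle p v q.
have pv : mdist p u - 3 * eta <= mdist p v by move: vq; rewrite /rho; lra.
(* Stewart's inequality for [u'] on [p u], seen from [v]: as [v] is nearly as far from [p] as [u]
   is, it bounds [mdist v u]. *)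
have := @stZ p u v u'; rewrite pu' u'u (metric_sym v u') u'v -/rho.
have -> : e + rho = mdist p u by rewrite /rho; ring.
move=> /(_ erefl) S.
have S' : e * mdist v u ^+ 2 <= rho * (mdist p u ^+ 2 - mdist v p ^+ 2).
  by apply: (ler_ofB _ S); rewrite /rho; ring.
have h1 : mdist p u ^+ 2 - mdist v p ^+ 2 <= 6 * eta * mdist p u.
  have : (mdist p u - 3 * eta) ^+ 2 <= mdist v p ^+ 2.
    by rewrite (metric_sym v p) ler_sqr ?nnegrE ?mdist_ge0 ?subr_ge0.
  have := sqr_ge0 (3 * eta); rewrite !expr2; lra.
have h2 : e * mdist v u ^+ 2 <= e * e ^+ 2.
  apply: le_trans S' _; apply: le_trans (_ : mdist p u * (6 * eta * mdist p u) <= _).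
    apply: (@le_trans _ _ (rho * (6 * eta * mdist p u))); first by rewrite ler_wpM2l.
    by rewrite ler_wpM2r ?mulr_ge0 ?mdist_ge0// ?ltW// /rho; lra.
  rewrite -exprS; apply: le_trans small.
  by rewrite le_eqVlt; apply/orP; left; apply/eqP; ring.
by move: h2; rewrite ler_pM2l// ler_sqr ?nnegrE ?mdist_ge0// ltW.
Qed.

Variables (Xn : nat -> metricType R) (X : metricType R).
Hypothesis Xn_cvg : gh_dist (Xn n) X @[n --> \oo] --> 0%E.
Hypothesis Xn_geo : forall n, geodesic_space (Xn n).
Hypothesis Xn_stewart : forall n, stewart (Xn n).

Theorem gh_limit_stewart : stewart X.
Proof.
move=> x y z m D.
have a0 := mdist_ge0 x m; have b0 := mdist_ge0 m y.
have [xm|xm] := eqVneq x m.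
  by rewrite -xm mdistxx !mul0r !addr0.
have [my|my] := eqVneq m y.
  by rewrite -my mdistxx mulr0 mul0r addr0 add0r.
have ap : 0 < mdist x m by rewrite mdist_gt0.
have bp : 0 < mdist m y by rewrite mdist_gt0.
apply: stewart_inequality_closed => e0 e00.
pose e := Num.min (e0 / 6) (Num.min 1 (Num.min (mdist x m / 4) (mdist m y / 4))).
have [e1 e2 e3 [e4 ep]] : [/\ e <= e0 / 6, e <= 1, e <= mdist x m / 4 &
    e <= mdist m y / 4 /\ 0 < e].
  split; rewrite /e ?ge_min ?lexx ?orbT//; split; rewrite ?ge_min ?lexx ?orbT//.
  by rewrite !lt_min ltr01 !divr_gt0.
(* Makes [eta = e ^+ 3 / K] satisfy the last condition of [almost_between], as
   [mdist (f x) (f m) <= mdist x m + 1]. *)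
pose K := 6 * (mdist x m + 1) ^+ 2.
have K6 : 6 <= K.
  have : 1 <= (mdist x m + 1) ^+ 2 by rewrite exprn_ege1// lerDr ltW.
  by rewrite /K; lra.
have K0 : 0 < K by lra.
pose eta := e ^+ 3 / K.
have eta0 : 0 < eta by rewrite divr_gt0 ?exprn_gt0.
have etae : 6 * eta <= e.
  have e3e : e ^+ 3 <= e by rewrite exprS ger_pMr// exprn_ile1 ?(ltW ep).
  rewrite /eta mulrA ler_pdivrMr//; apply: (@le_trans _ _ (6 * e)).
    by rewrite ler_pM2l.
  by rewrite mulrC ler_pM2l.
have [n [f [g [fE _ _]]]] := gh_approximation Xn_cvg eta0.
have fB u v : mdist u v - eta <= mdist (f u) (f v) <= mdist u v + eta.
  by have := fE u v; rewrite ler_norml => /andP[h1 h2]; apply/andP; split; lra.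
have /andP[b1 b2] := fB x m; have /andP[b3 b4] := fB m y; have /andP[b5 b6] := fB x y.
have /andP[b7 b8] := fB z x; have /andP[b9 b10] := fB z y; have /andP[b11 b12] := fB z m.
have c1 : mdist (f x) (f m) + mdist (f m) (f y) <= mdist (f x) (f y) + 3 * eta by lra.
have c2 : e <= mdist (f x) (f m) by lra.
have c3 : 3 * eta <= mdist (f x) (f m) by lra.
have c4 : 3 * eta <= mdist (f m) (f y) by lra.
have c5 : 6 * eta * mdist (f x) (f m) ^+ 2 <= e ^+ 3.
  have h : mdist (f x) (f m) ^+ 2 <= (mdist x m + 1) ^+ 2.
    by rewrite ler_sqr ?nnegrE ?mdist_ge0 ?addr_ge0//; lra.
  apply: (@le_trans _ _ (6 * eta * (mdist x m + 1) ^+ 2)).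
    by rewrite ler_pM2l// mulr_gt0.
  have -> : 6 * eta * (mdist x m + 1) ^+ 2 = eta * K by rewrite /K; ring.
  by rewrite /eta divfK// lt0r_neq0.
have [u' [v [h1 h2 h3 h4]]] := almost_between (@Xn_geo n) (@Xn_stewart n) ep eta0 c1 c2 c3 c4 c5.
have S := Xn_stewart (f z) h3.
(* An exact configuration in [Xn n]: [u'] and [v] replace [f x] and [f m], from which they are
   within [e]. *)
exists (mdist u' v, mdist v (f y), mdist u' (f y),
  mdist (f z) u', mdist (f z) (f y), mdist (f z) v).
have t1 := metric_triangle v (f m) (f y); have t2 := metric_triangle (f m) v (f y).
rewrite (metric_sym (f m) v) in t2.
have t3 := metric_triangle (f z) (f x) u'; have t4 := metric_triangle (f z) u' (f x).
rewrite (metric_sym u' (f x)) in t4.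
have t5 := metric_triangle (f z) (f m) v; have t6 := metric_triangle (f z) v (f m).
rewrite (metric_sym (f m) v) in t5.
split; split; rewrite ?ler_norml; try (apply/andP; split; lra).
exact: S.
Qed.

End StewartLimit.

(** * From timelike curvature to Stewart's inequality *)

Section MinkowskiLine.
Context {R : realType}.
Local Notation M := (minkowski2 R).
Local Notation tauM := (fun p : mink_plane R => p.1).
Local Notation posM := (fun p : mink_plane R => p.2 : R^o).

Definition mink_line (p q : mink_plane R) : pcurve R (mink_plane R) :=
  PCurve 0 1 (fun s => (p.1 + s * (q.1 - p.1), p.2 + s * (q.2 - p.2)) : mink_plane R).

Lemma mink_line_joins p q : joins (mink_line p q) p q.
Proof.
split; rewrite /=; first by rewrite !mul0r !addr0; case: p.
by rewrite !mul1r ![_ + (_ - _)]addrC !subrK; case: q.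
Qed.

Lemma mink_line_maximal (p q : mink_plane R) : `|q.2 - p.2| < q.1 - p.1 ->
  @maximal_curve R M (mink_line p q).
Proof.
move=> pq; have T0 : 0 < q.1 - p.1 := le_lt_trans (normr_ge0 _) pq.
apply: (uniform_curve_maximal mink_coordinates (h := q.1 - p.1) (k := `|q.2 - p.2|)) => //=.
  exact: ltW.
move=> s t s0 st t1; split; first by ring.
rewrite /mdist/= (_ : _ - _ = (t - s) * (q.2 - p.2)); last by ring.
by rewrite normrM ger0_norm ?subr_ge0// mulrC.
Qed.

Lemma mink_line_affine p q l : 0 <= l -> l <= 1 ->
  @affine_on R M R^o tauM posM p q l (cmap (mink_line p q) l).
Proof.
move=> l0 l1; split => /=; first by ring.
  by rewrite /mdist/= addrAC subrr add0r normrM ger0_norm.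
rewrite /mdist/= (_ : _ - _ = (1 - l) * (q.2 - p.2)); last by ring.
by rewrite normrM ger0_norm// subr_ge0.
Qed.

Definition mink_triangle (x y z : mink_plane R) (xy : `|y.2 - x.2| < y.1 - x.1)
    (yz : `|z.2 - y.2| < z.1 - y.1) (xz : `|z.2 - x.2| < z.1 - x.1) : triangle M :=
  @Triangle R M x y z (mink_line x y) (mink_line y z) (mink_line x z) xy yz
    (let: conj _ e := mink_line_maximal xz in
     ltac:(by rewrite (tsepE mink_coordinates) ltry))
    (conj (mink_line_maximal xy) (mink_line_joins x y))
    (conj (mink_line_maximal yz) (mink_line_joins y z))
    (conj (mink_line_maximal xz) (mink_line_joins x z)).

(* The vertices are [(0, 0)], [(s, h)] and [(c, 0)]. *)
Lemma mink_comparison_points (a b c : R) : 0 < a -> 0 < b -> a + b <= c ->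
  exists x y z : mink_plane R,
  [/\ `|y.2 - x.2| < y.1 - x.1, `|z.2 - y.2| < z.1 - y.1, `|z.2 - x.2| < z.1 - x.1 &
   [/\ @sep R M R^o tauM posM x y = a, @sep R M R^o tauM posM y z = b &
       @sep R M R^o tauM posM x z = c]].
Proof.
move=> a0 b0 abc; have c0 : 0 < c by lra.
(* Subtracting [b^2 = (c - s)^2 - h^2] from [a^2 = s^2 - h^2] determines [s]; the hypothesis [abc]
   then gives [a <= s] and [b <= c - s], so that [h] exists. *)
pose s := (a ^+ 2 + c ^+ 2 - b ^+ 2) / (2 * c).
have sE : 2 * c * s = a ^+ 2 + c ^+ 2 - b ^+ 2.
  by rewrite /s mulrC divfK// mulf_neq0// ?lt0r_neq0.
have as_ : a <= s.
  rewrite -(ler_pM2l (_ : 0 < 2 * c)) ?mulr_gt0// sE.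
  have : b ^+ 2 <= (c - a) ^+ 2 by rewrite ler_sqr ?nnegrE; lra.
  rewrite sqrrB; lra.
have cs : b <= c - s.
  rewrite -(ler_pM2l (_ : 0 < 2 * c)) ?mulr_gt0// mulrBr sE.
  have : a ^+ 2 <= (c - b) ^+ 2 by rewrite ler_sqr ?nnegrE; lra.
  rewrite sqrrB !expr2; lra.
pose h := Num.sqrt (s ^+ 2 - a ^+ 2).
have h0 : 0 <= h := sqrtr_ge0 _.
have h2 : h ^+ 2 = s ^+ 2 - a ^+ 2.
  by rewrite sqr_sqrtr// subr_ge0 ler_sqr ?nnegrE; lra.
have hs : h < s.
  by rewrite -ltr_sqr ?nnegrE; [rewrite h2 ltrBlDr ltrDl exprn_gt0| |]; lra.
have h2' : h ^+ 2 = (c - s) ^+ 2 - b ^+ 2.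
  by rewrite h2 sqrrB; move: sE; rewrite !expr2; lra.
have hcs : h < c - s.
  by rewrite -ltr_sqr ?nnegrE; [rewrite h2' ltrBlDr ltrDl exprn_gt0| |]; lra.
exists (0, 0), (s, h), (c, 0) => /=.
have e1 : `|h - 0| = h by rewrite subr0 ger0_norm.
have e2 : `|0 - h| = h by rewrite sub0r normrN ger0_norm.
have e3 : `|(0 : R) - 0| = 0 by rewrite subrr normr0.
rewrite e1 e2 e3 ?subr0; split => //; split; rewrite /sep /= /mdist/= ?e1 ?e2 ?e3 ?subr0.
- by rewrite (minkowski_sep_ge h0 (ltW hs)) h2 opprB addrCA subrr addr0 sqrtr_sqr ger0_norm ?ltW.
- by rewrite (minkowski_sep_ge h0 (ltW hcs)) h2' opprB addrCA subrr addr0 sqrtr_sqr ger0_norm ?ltW.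
- by rewrite (minkowski_sep_ge (lexx 0) (ltW c0)) expr0n/= subr0 sqrtr_sqr ger0_norm ?ltW.
Qed.

End MinkowskiLine.

(** * A local Stewart inequality from the curvature of the product *)

Section LocalStewart.
Context {R : realType} (a b : R) (X : metricType R).
Hypothesis geoX : geodesic_space X.
Local Notation Y := (lorentz_product `[a, b]%classic X).
Local Notation tau := (fun p : Y => \val p.1).
Local Notation pos := (fun p : Y => p.2).
Local Notation M := (minkowski2 R).
Local Notation tauM := (fun p : mink_plane R => p.1).
Local Notation posM := (fun p : mink_plane R => p.2 : R^o).
Local Notation s := (sep tau pos).
Local Notation sM := (@sep R M R^o tauM posM).
Local Notation Q := (sqsep tau pos).
Local Notation QM := (@sqsep R M R^o tauM posM).
Let coordY : @lorentz_coordinates R Y X tau pos := cone_coordinates a b geoX.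
Let coordM : @lorentz_coordinates R M R^o tauM posM := mink_coordinates.

Lemma minkowski_sepZ (l T D : R) : 0 <= l ->
  minkowski_sep (l * T) (l * D) = l * minkowski_sep T D.
Proof.
move=> l0; rewrite /minkowski_sep -{1}(mulr0 l) -maxr_pMr// !exprMn -mulrBr.
by rewrite sqrtrM ?sqr_ge0// sqrtr_sqr ger0_norm.
Qed.

Lemma affine_on_sep (W : lorentz_data R) (Z : metricType R) (t : W -> R)
    (ps : W -> Z) x y p l : 0 <= l -> l <= 1 -> affine_on t ps x y l p ->
  sep t ps x p = l * sep t ps x y /\ sep t ps p y = (1 - l) * sep t ps x y.
Proof.
move=> l0 l1 [h1 h2 h3]; rewrite /sep h2 h3 h1 -!minkowski_sepZ ?subr_ge0//.
by split; congr minkowski_sep; ring.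
Qed.

Lemma sep_self (W : lorentz_data R) (Z : metricType R) (t : W -> R)
    (ps : W -> Z) x : sep t ps x x = 0.
Proof. by rewrite /sep minkowski_sep_eq0 ?mdist_ge0// subrr mdistxx. Qed.

(** The curvature bound compares [pm] on the side [px py] with the vertex [pz], and [mink_sqsep]
    evaluates the comparison points. As [pm << pz], these have positive separation, so they are
    causally related and the bound can be squared. *)
Lemma curvature_sqsep (U : set Y) (px py pz pm : Y) gxy gyz gxz l :
  (forall (T : triangle Y) (T' : triangle M),
     triangle_in U T -> comparison_triangle T T' ->
     forall (p q : Y) (p' q' : M),
       corresponding T T' p p' -> corresponding T T' q q' ->
       (tsep p q <= tsep p' q')%E) ->
  geodesic px.2 py.2 gxy -> geodesic py.2 pz.2 gyz -> geodesic px.2 pz.2 gxz ->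
  mdist px.2 py.2 < \val py.1 - \val px.1 ->
  mdist py.2 pz.2 < \val pz.1 - \val py.1 ->
  mdist px.2 pz.2 < \val pz.1 - \val px.1 ->
  mdist pm.2 pz.2 < \val pz.1 - \val pm.1 ->
  trace (straight_curve px py gxy) `<=` U ->
  trace (straight_curve py pz gyz) `<=` U ->
  trace (straight_curve px pz gxz) `<=` U ->
  0 <= l -> l <= 1 -> affine_on tau pos px py l pm ->
  trace (straight_curve px py gxy) pm ->
  Q pm pz <= (1 - l) * Q px pz + l * Q py pz - l * (1 - l) * Q px py.
Proof.
move=> HU geoxy geoyz geoxz cxy cyz cxz cmz Uxy Uyz Uxz l0 l1 am tpm.
have T0 (p q : Y) : mdist p.2 q.2 < \val q.1 - \val p.1 -> 0 < \val q.1 - \val p.1.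
  by apply: le_lt_trans; exact: mdist_ge0.
have jxy := straight_joins geoxy (T0 _ _ cxy).
have jyz := straight_joins geoyz (T0 _ _ cyz).
have jxz := straight_joins geoxz (T0 _ _ cxz).
have fin_xz : (@tsep R Y px pz < +oo)%E by rewrite (tsepE coordY) ltry.
pose T : triangle Y := @Triangle R Y px py pz
  (straight_curve px py gxy) (straight_curve py pz gyz) (straight_curve px pz gxz)
  (cone_chron_lt geoX cxy) (cone_chron_lt geoX cyz) fin_xz
  (conj (straight_maximal geoX geoxy (T0 _ _ cxy) (ltW cxy)) jxy)
  (conj (straight_maximal geoX geoyz (T0 _ _ cyz) (ltW cyz)) jyz)
  (conj (straight_maximal geoX geoxz (T0 _ _ cxz) (ltW cxz)) jxz).
have TU : triangle_in U T by [].
have sepxy := @sep_pos R Y X tau pos px py cxy.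
have sepyz := @sep_pos R Y X tau pos py pz cyz.
have [x' [y' [z' [c1 c2 c3 [e1 e2 e3]]]]] := mink_comparison_points sepxy sepyz
  (@sep_triangle R Y X tau pos px py pz (ltW cxy) (ltW cyz)).
pose T' := mink_triangle c1 c2 c3.
have cT : comparison_triangle T T'.
  by split; rewrite (tsepE coordY) (tsepE coordM) /= ?e1 ?e2 ?e3.
pose m' := cmap (mink_line x' y') l.
have am' := mink_line_affine x' y' l0 l1; rewrite -/m' in am'.
have [u1 u2] := affine_on_sep l0 l1 am; have [u1' u2'] := affine_on_sep l0 l1 am'.
have [jxy0 jxy1] := jxy; have [jxz0 jxz1] := jxz.
have [ixy0 ixy1] := mink_line_joins x' y'; have [ixz0 ixz1] := mink_line_joins x' z'.
have cpm : corresponding T T' pm m'.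
  apply: Or31; split => //.
  - by exists l => //=; rewrite in_itv/= l0.
  - by rewrite [sxy T]/= [sxy T']/= jxy0 ixy0 (tsepE coordY) (tsepE coordM) u1 u1' e1.
  - by rewrite [sxy T]/= [sxy T']/= jxy1 ixy1 (tsepE coordY) (tsepE coordM) u2 u2' e1.
have cpz : corresponding T T' pz z'.
  apply: Or33; split.
  - by exists (\val pz.1) => //=; rewrite in_itv/= lexx andbT -subr_ge0 ltW// T0.
  - by exists 1 => //=; rewrite in_itv/= lexx ler01.
  - by rewrite [sxz T]/= [sxz T']/= jxz0 ixz0 (tsepE coordY) (tsepE coordM) e3.
  - by rewrite [sxz T]/= [sxz T']/= jxz1 ixz1 (tsepE coordY) (tsepE coordM) !sep_self.
have := HU T T' TU cT _ _ _ _ cpm cpz.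
rewrite (tsepE coordY) (tsepE coordM) lee_fin => smz.
have cmz' : mdist (posM m') (posM z') <= tauM z' - tauM m'.
  rewrite leNgt; apply/negP => hlt.
  have smz0 : sM m' z' = 0 by rewrite /sep minkowski_sep_eq0 ?mdist_ge0// ltW.
  have := @sep_pos R Y X tau pos pm pz cmz.
  by rewrite ltNge -smz0 smz.
have Qmz : Q pm pz <= QM m' z'.
  rewrite /sqsep -(@sep_sqr R Y X tau pos _ _ (ltW cmz)) -(@sep_sqr R M R^o tauM posM _ _ cmz').
  by rewrite ler_sqr ?nnegrE ?sep_ge0.
have Qxy : Q px py = QM x' y' by apply: sep_eq_sqsep; rewrite e1.
have Qyz : Q py pz = QM y' z' by apply: sep_eq_sqsep; rewrite e2.
have Qxz : Q px pz = QM x' z'.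
  by apply: sep_eq_sqsep; rewrite e3//; exact: (@sep_pos R Y X tau pos px pz cxz).
have QMm := mink_sqsep z' l0 l1 am'.
rewrite (@sqsepC R M _ _ _ z' x') (@sqsepC R M _ _ _ z' y') (@sqsepC R M _ _ _ z' m') in QMm.
by rewrite Qxy Qxz Qyz -QMm.
Qed.

End LocalStewart.

(** The times [0], [l * (2 * r)], [2 * r] and [4 * r] after [tx] satisfy Stewart's theorem exactly
    and cancel. *)
Lemma sqsep_main (R : realType) (tx r l dxy dmz dxz dyz : R) :
  (tx + 4 * r - (tx + l * (2 * r))) ^+ 2 - dmz ^+ 2 <=
  (1 - l) * ((tx + 4 * r - tx) ^+ 2 - dxz ^+ 2) +
  l * ((tx + 4 * r - (tx + 2 * r)) ^+ 2 - dyz ^+ 2) -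
  l * (1 - l) * ((tx + 2 * r - tx) ^+ 2 - dxy ^+ 2) ->
  (1 - l) * dxz ^+ 2 + l * dyz ^+ 2 <= dmz ^+ 2 + l * (1 - l) * dxy ^+ 2.
Proof. by move=> h; apply: (ler_ofB _ h); ring. Qed.

(* A small metric triangle is lifted to widely separated times, so that its lift
   is a timelike triangle. *)
Lemma curvature_local_stewart (R : realType) (a b : R) (X : metricType R) :
  geodesic_space X -> a < b ->
  timelike_curvature_ge0 (lorentz_product `[a, b]%classic X) -> forall o : X,
  exists2 r : R, 0 < r & forall x y z m : X, mdist o x < r ->
  mdist x m + mdist m y = mdist x y ->
  mdist x y < r -> mdist z x < r -> mdist z y < r ->
  mdist m y * mdist z x ^+ 2 + mdist x m * mdist z y ^+ 2 <=
  mdist x y * (mdist z m ^+ 2 + mdist x m * mdist m y).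
Proof.
set Y := lorentz_product _ _ => geoX ltab curv o.
pose tau (p : Y) : R := \val p.1; pose pos (p : Y) : X := p.2.
have mk (t : R) (w : X) : a <= t -> t <= b -> exists p : Y, \val p.1 = t /\ p.2 = w.
  move=> h1 h2; have tI : t \in `[a, b]%classic.
    by apply/mem_set; rewrite /= in_itv/= h1.
  by exists (exist _ t tI, w).
(* Triangles are lifted upwards in time from the midpoint, which leaves room [(b - a) / 2]. *)
have [tm [tma tmb]] : exists tm, a <= tm /\ tm + (b - a) / 2 <= b.
  by exists ((a + b) / 2); split; lra.
have tmb' : tm <= b by lra.
have [po [to poo]] := mk tm o tma tmb'.
have [U [oU _ _ HU]] := curv po.
have [rho /= rho0 rhoU] := (nbhs_ballP _ _).1 oU.
(* The lift stays within [4 * r] of [po] in time and in position, hence in the ball of radius [rho];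
   20 leaves a margin. *)
have [r [r1 r2 r0]] : exists r : R, [/\ r <= rho / 20, r <= (b - a) / 20 & 0 < r].
  exists (Num.min (rho / 20) ((b - a) / 20)).
  by rewrite !ge_min !lexx orbT lt_min !divr_gt0// subr_gt0.
exists r => // x y z m ox D xyr zxr zyr.
have d1 := mdist_ge0 x m; have d2 := mdist_ge0 m y; have d3 := mdist_ge0 x y.
have [xy0|xy0] := eqVneq (mdist x y) 0.
  have xm0 : mdist x m = 0 by lra.
  have my0 : mdist m y = 0 by lra.
  by rewrite xm0 my0 xy0 !mul0r addr0.
have xyp : 0 < mdist x y by rewrite lt_neqAle eq_sym xy0.
have [l [l0 l1 lD lD']] : exists l, [/\ 0 <= l, l <= 1, l * mdist x y = mdist x m &
    (1 - l) * mdist x y = mdist m y].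
  exists (mdist x m / mdist x y); rewrite divr_ge0// ler_pdivrMr// mul1r.
  by rewrite mulrBl mul1r divfK// -D lerDl; split => //; ring.
have xz : mdist x z < r by rewrite metric_sym.
have yz : mdist y z < r by rewrite metric_sym.
have mz : mdist m z < 2 * r.
  by have := metric_triangle m x z; rewrite (metric_sym m x); lra.
(* Time gaps of at least [2 * r] exceed the side lengths, which are below [r]; and [m], lifted to a
   time at most [tm + 2 * r], still precedes [z] as [mdist m z < 2 * r]. *)
have [||px [tx pxx]] := mk tm x; try lra.
have [||py [ty pyy]] := mk (tm + 2 * r) y; try lra.
have [||pz [tz pzz]] := mk (tm + 4 * r) z; try lra.
have inU (w : Y) : tm <= \val w.1 -> \val w.1 <= tm + 4 * r -> mdist o w.2 < 4 * r -> U w.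
  move=> h1 h2 h3; apply: rhoU; rewrite ballEmdist /=.
  change (`|\val po.1 - \val w.1| + mdist po.2 w.2 < rho).
  rewrite to poo distrC ger0_norm ?subr_ge0//.
  by clear -h1 h2 h3 r1 rho0; lra.
have ow v w : mdist o v < 2 * r -> mdist v w < r -> mdist o w < 4 * r.
  by have := metric_triangle o v w; have := mdist_ge0 v w; clear; lra.
have ox2 : mdist o x < 2 * r by clear -ox r0; lra.
have oy2 : mdist o y < 2 * r.
  by have := metric_triangle o x y; clear -ox xyr; lra.
have [gxy geoxy gm] := geodesic_through geoX D.
have [gyz geoyz] := geoX y z; have [gxz geoxz] := geoX x z.
have r2r : 0 < 2 * r by clear -r0; lra.
have Txy : \val py.1 - \val px.1 = 2 * r by rewrite tx ty; clear; ring.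
have Tyz : \val pz.1 - \val py.1 = 2 * r by rewrite tz ty; clear; ring.
have Txz : \val pz.1 - \val px.1 = 4 * r by rewrite tx tz; clear; ring.
have geoxy' : geodesic px.2 py.2 gxy by rewrite pxx pyy.
have geoyz' : geodesic py.2 pz.2 gyz by rewrite pyy pzz.
have geoxz' : geodesic px.2 pz.2 gxz by rewrite pxx pzz.
have Txy0 : 0 < \val py.1 - \val px.1 by rewrite Txy.
have Tyz0 : 0 < \val pz.1 - \val py.1 by rewrite Tyz.
have Txz0 : 0 < \val pz.1 - \val px.1 by rewrite Txz; clear -r0; lra.
have [pm trm []] := straight_point geoxy' Txy0 l0 l1.
rewrite pxx pyy lD gm Txy tx => tpm pmm.
have lr : l * (2 * r) <= 2 * r by apply: ler_piMl => //; exact: ltW.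
suff : sqsep tau pos pm pz <= (1 - l) * sqsep tau pos px pz + l * sqsep tau pos py pz
    - l * (1 - l) * sqsep tau pos px py.
  rewrite /sqsep /tau /pos tx ty tz tpm pxx pyy pzz pmm => /sqsep_main.
  rewrite (metric_sym m z) (metric_sym x z) (metric_sym y z) -(ler_pM2l xyp) => main.
  by rewrite -lD' -lD; apply: (ler_ofB _ main); clear; ring.
apply: (curvature_sqsep geoX HU geoxy' geoyz' geoxz') => //.
- by rewrite pxx pyy Txy; clear -xyr r0; lra.
- by rewrite pyy pzz Tyz; clear -yz r0; lra.
- by rewrite pxx pzz Txz; clear -xz r0; lra.
- by rewrite pmm pzz tz tpm; clear -mz lr; lra.
- move=> w /(straight_trace geoxy' Txy0)[h1 h2 h3]; rewrite tx in h1; rewrite ty in h2.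
  rewrite pxx pyy in h3; apply: inU => //; first by clear -h2 r0; lra.
  by apply: (ow x) => //; exact: le_lt_trans xyr.
- move=> w /(straight_trace geoyz' Tyz0)[h1 h2 h3]; rewrite ty in h1; rewrite tz in h2.
  rewrite pyy pzz in h3; apply: inU => //; first by clear -h1 r0; lra.
  by apply: (ow y) => //; exact: le_lt_trans yz.
- move=> w /(straight_trace geoxz' Txz0)[h1 h2 h3]; rewrite tx in h1; rewrite tz in h2.
  rewrite pxx pzz in h3; apply: inU => //.
  by apply: (ow x) => //; exact: le_lt_trans xz.
- split; rewrite ?tpm ?tx ?ty ?pxx ?pyy ?pmm ?lD ?lD' //.
  by clear; ring.
Qed.

(** The local inequality only asks [x] to be near the centre [o], the other points being controlled
    by the size; compactness then gives one size for all [x], like a Lebesgue number. *)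
Lemma curvature_stewart_below (R : realType) (a b : R) (X : metricType R) :
  a < b -> compact [set: X] -> geodesic_space X ->
  timelike_curvature_ge0 (lorentz_product `[a, b]%classic X) ->
  exists2 r : R, 0 < r & stewart_below X r.
Proof.
move=> ltab cX geoX curv.
pose P (r : R) (x : X) := forall y z m : X, mdist x m + mdist m y = mdist x y ->
  mdist x y < r -> mdist z x < r -> mdist z y < r ->
  mdist m y * mdist z x ^+ 2 + mdist x m * mdist z y ^+ 2 <=
  mdist x y * (mdist z m ^+ 2 + mdist x m * mdist m y).
have nc : forall x, [set: X] x -> \forall x' \near x & t \near (0 : R)^'+, P t x'.
  move=> x _; have [r r0 Hr] := curvature_local_stewart geoX ltab curv x.
  exists (ball x r, [set t | t < r]).
    by split; [exact: nbhsx_ballx|exact: nbhs_right_lt].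
  move=> [x' t] [/= xx' tr] y z m D h1 h2 h3.
  by apply: Hr => //; [move: xx'; rewrite ballEmdist|exact: lt_trans tr..].
have /compact_near_coveringP/(_ R _ P _ nc)[d /= d0 Hd] := cX.
exists (d / 2); first by rewrite divr_gt0.
move=> x y z m; apply: (Hd (d / 2)) => //=; last by rewrite divr_gt0.
by rewrite sub0r normrN gtr0_norm ?divr_gt0// ltr_pdivrMr// ltr_pMr// ltr1n.
Qed.

Theorem theorem4p21 (R : realType) (a b : R) (ltab : a < b)
    (Xn : nat -> metricType R) (X : metricType R)
    (Xn_compact : forall n, compact [set: Xn n])
    (Xn_length : forall n, length_space (Xn n))
    (X_compact : compact [set: X])
    (Xn_cvg : gh_dist (Xn n) X @[n --> \oo] --> 0%E)
    (Xn_curv : forall n,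
      timelike_curvature_ge0 (lorentz_product `[a, b]%classic (Xn n))) :
  timelike_curvature_ge0 (lorentz_product `[a, b]%classic X).
Proof.
have Xn_geo n : geodesic_space (Xn n) by exact: length_space_geodesic.
(* The size [r] depends on [n] and may tend to 0; globalization removes it before the limit is
   taken. *)
have Xn_stewart n : stewart (Xn n).
  have [r r0 loc] := curvature_stewart_below ltab (@Xn_compact n) (@Xn_geo n) (@Xn_curv n).
  exact (stewart_globalization (@Xn_geo n) r0 loc).
apply: stewart_curvature; first exact: gh_limit_geodesic Xn_cvg Xn_geo X_compact.
exact: gh_limit_stewart Xn_cvg Xn_geo Xn_stewart.
Qed.
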